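(* Let $\Lambda\leq\mathbb{R}^+$ be a non-trivial multiplicative subgroup of the positive reals, let $\Gamma\subset\mathbb{R}$ be a $\mathbb{Z}\Lambda$-submodule with $\Lambda\cdot\Gamma=\Gamma$, and let $\ell\in\Gamma$ with $\ell\geq1$. Set $F=F(\Gamma,\Lambda,\ell)$ and $T=T(\Gamma,\Lambda,\ell)$. Then the $C^*$-algebra $C^*_{\lambda_{T/F}}T$ is simple and purely infinite.
   Context: Thompson-Stein groups. $V(\Gamma,\Lambda,\ell)$ is the group of right continuous, piecewise linear bijections of $[0,\ell)$ with slopes in $\Lambda$ and finitely many discontinuities, all in $\Gamma$. $T(\Gamma,\Lambda,\ell)\subset V(\Gamma,\Lambda,\ell)$ is the subgroup of those elements which are continuous piecewise linear bijections of the circle $[0,\ell]/\{0\sim\ell\}\cong\mathbb{R}/\ell\mathbb{Z}$, with (finitely many) non-differentiable points in $\Gamma$ and slopes in $\Lambda$; being in $V(\Gamma,\Lambda,\ell)$ means in particular that, viewed as a bijection of $[0,\ell)$, the element has its discontinuities in $\Gamma$. $F(\Gamma,\Lambda,\ell)\subset T(\Gamma,\Lambda,\ell)$ is the subgroup of piecewise linear homeomorphisms of $[0,\ell]$ with non-differentiable points in $\Gamma$ and slopes in $\Lambda$; it is the stabilizer of $0$ for the natural action of $T(\Gamma,\Lambda,\ell)$ on $\mathbb{R}/\ell\mathbb{Z}$. These groups are regarded as discrete groups. $\lambda_{T/F}$ is the quasi-regular representation of $T$ on $\ell^2(T/F)$ and $C^*_{\lambda_{T/F}}T$ is the $C^*$-algebra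 generated by $\lambda_{T/F}(T)$. *)

(* Defs.v *)
From HB Require Import structures.
From mathcomp Require Import all_boot all_order all_algebra.
From mathcomp Require Import all_classical all_reals all_analysis.
From mathcomp Require Import complex lra.

Set Implicit Arguments.
Unset Strict Implicit.
Unset Printing Implicit Defensive.

Import Order.TTheory GRing.Theory Num.Theory.
Import numFieldNormedType.Exports.

Local Open Scope classical_set_scope.
Local Open Scope ring_scope.
Local Open Scope complex_scope.

(** * Slopes and breakpoints *)

Section SlopesBreakpoints.
Variable R : realType.
Implicit Types L G : set R.

Definition mul_subgroup_pos L :=
  [/\ L `<=` [set x | 0 < x], L 1,
      forall x y, L x -> L y -> L (x * y) &
      forall x, L x -> L x^-1].

(* An additive subgroup of R is a Z[L]-submodule iff it is stable under
   multiplication by the elements of L, which generate Z[L] additively. *)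
Definition submodule_over L G :=
  [/\ G 0, forall x y, G x -> G y -> G (x - y) &
      forall a x, L a -> G x -> G (a * x)].

End SlopesBreakpoints.

(** * Thompson-Stein groups *)

(* A bijection of [0, l) is represented by the function R -> R that extends it
   by the identity outside [0, l); the group law is composition. *)

Section ThompsonStein.
Variable R : realType.
Implicit Types (L G : set R) (l x s : R) (f : R -> R).

Definition piecewise_linear L l f :=
  exists (n : nat) (a : nat -> R),
    [/\ a 0%N = 0, a n = l,
        forall i, (i < n)%N -> a i < a i.+1 &
        forall i, (i < n)%N -> exists2 s, L s &
          exists b, forall x, a i < x < a i.+1 -> f x = s * x + b].

(* Continuity at x of f as a self-map of [0, l) (not of the circle). *)
Definition interval_continuous_at l f x :=
  f y @[y --> within `[0, l[ (nbhs x)] --> f x.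

Definition right_continuous_at f x := f y @[y --> x^'+] --> f x.

Definition V_group G L l : set (R -> R) := [set f |
  [/\ set_bij `[0, l[ `[0, l[ f,
      forall x, x \notin `[0, l[ -> f x = x,
      piecewise_linear L l f,
      forall x, x \in `[0, l[ -> right_continuous_at f x &
      let D := [set x | (x \in `[0, l[) /\ ~ interval_continuous_at l f x] in
      finite_set D /\ D `<=` G]].

(* Points of the circle R / lZ are represented by their representatives
   in [0, l); integer multiples of l account for the quotient. *)
Definition circle_continuous_at l f x :=
  forall e, 0 < e -> exists2 d, 0 < d &
    forall y (j : int), y \in `[0, l[ -> `|y - x + j%:~R * l| < d ->
      exists k : int, `|f y - f x + k%:~R * l| < e.

Definition circle_differentiable_at l f x :=
  exists s, forall e, 0 < e -> exists2 d, 0 < d &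
    forall y (j : int), y \in `[0, l[ ->
      let h := y - x + j%:~R * l in
      `|h| < d ->
      exists k : int, `|f y - f x + k%:~R * l - s * h| <= e * `|h|.

Definition T_group G L l : set (R -> R) := [set f |
  [/\ V_group G L l f,
      forall x, x \in `[0, l[ -> circle_continuous_at l f x &
      let D := [set x | (x \in `[0, l[) /\ ~ circle_differentiable_at l f x] in
      finite_set D /\ D `<=` G]].

Definition extend_endpoint l f : R -> R := fun x => if x < l then f x else l.

Definition homeomorphism_on (A : set R) f :=
  [/\ set_bij A A f, {within A, continuous f} &
      exists g : R -> R,
        {within A, continuous g} /\ forall x, A x -> g (f x) = x].

Definition F_group G L l : set (R -> R) := [set f |
  T_group G L l f /\ homeomorphism_on `[0, l] (extend_endpoint l f)].

End ThompsonStein.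

(** * The Hilbert space l2(X) *)

Section L2.
Variables (R : realType) (X : choiceType).

Definition square_summable : {pred X -> R[i]^o} :=
  mem [set xi : X -> R[i]^o |
    summable [set: X] (fun x => (Normc.normc (xi x) ^+ 2)%:E)].

Lemma square_summable_submod_closed : submod_closed square_summable.
Proof.
have nge0 (z : R[i]) : 0 <= Normc.normc z by case: z => a b; exact: sqrtr_ge0.
have abs2 (z : R[i]) : `|(Normc.normc z ^+ 2)%:E|%E = (Normc.normc z ^+ 2)%:E.
  by rewrite gee0_abs// lee_fin sqr_ge0.
have scale (K : R) (a : X -> \bar R) : 0 <= K -> (forall x, 0 <= a x)%E ->
    (\esum_(x in [set: X]) a x < +oo -> 
     \esum_(x in [set: X]) (K%:E * a x) < +oo)%E.
  move=> K0 a0 ha; apply: (@le_lt_trans _ _ (K%:E * \esum_(x in [set: X]) a x)%E).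
    apply: ge_ereal_sup => _ [A [finA _] <-].
    rewrite -ge0_mule_fsumr//; apply: lee_wpmul2l; first by rewrite lee_fin.
    by apply: ereal_sup_ubound; exists A.
  by rewrite lte_mul_pinfty// lee_fin.
split.
  rewrite inE /= /summable esum1// => x _.
  by rewrite expr0n/= addr0 sqrtr0 expr0n/= normr0.
move=> c u v; rewrite !inE /= /summable => su sv.
apply: (@le_lt_trans _ _ (\esum_(x in [set: X])
   ((2 * Normc.normc c ^+ 2)%:E * `|(Normc.normc (u x) ^+ 2)%:E| +
    2%:E * `|(Normc.normc (v x) ^+ 2)%:E|))%E).
  apply: le_esum => x _; rewrite !abs2 -!EFinM -EFinD lee_fin.
  have h : Normc.normc ((c *: u + v) x) <=
      Normc.normc c * Normc.normc (u x) + Normc.normc (v x).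
    by rewrite -Normc.normcM; exact: le_normcD.
  have := nge0 ((c *: u + v) x); move: h.
  set p := Normc.normc _; set q := Normc.normc c; set r := Normc.normc (u x).
  set t := Normc.normc (v x) => h p0.
  have : p ^+ 2 <= (q * r + t) ^+ 2 by rewrite lerXn2r ?nnegrE// (le_trans p0 h).
  have := sqr_ge0 (q * r - t); rewrite !expr2; lra.
have ge0 (w : X -> R[i]) x : (0 <= `|(Normc.normc (w x) ^+ 2)%:E|)%E.
  exact: abse_ge0.
rewrite esumD; last 2 first.
- by move=> x _; rewrite mule_ge0// lee_fin mulr_ge0// sqr_ge0.
- by move=> x _; rewrite mule_ge0// lee_fin.
rewrite lte_add_pinfty//; apply: scale => //.
by rewrite mulr_ge0// sqr_ge0.
Qed.

HB.instance Definition _ := GRing.isSubmodClosed.Build _ _ square_summable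
  square_summable_submod_closed.

Record l2 := L2 { l2_fun :> X -> R[i]^o; _ : l2_fun \in square_summable }.

HB.instance Definition _ := [isSub for l2_fun].
HB.instance Definition _ := [Choice of l2 by <:].
HB.instance Definition _ := [SubChoice_isSubLmodule of l2 by <:].

Definition l2_norm (xi : l2) : R :=
  Num.sqrt (fine (\esum_(x in [set: X]) (Normc.normc (xi x) ^+ 2)%:E)).

(* Sum of an absolutely summable real family. *)
Definition real_sum (u : X -> R) : R :=
  fine (\esum_(x in [set: X]) (Num.max (u x) 0)%:E) -
  fine (\esum_(x in [set: X]) (Num.max (- u x) 0)%:E).

(* Linear in the first variable. *)
Definition l2_inner (xi eta : l2) : R[i] :=
  real_sum (fun x => complex.Re (xi x * conjc (eta x))) +i*
  real_sum (fun x => complex.Im (xi x * conjc (eta x))).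

End L2.

(** * C*-algebras of operators on l2(X) *)

Section Operators.
Variables (R : realType) (X : choiceType).
Local Notation H := (l2 R X).
Local Notation op := (H -> H).
Implicit Types (S T a b p q v w : op) (A B J : set op).

Definition bounded_operator T :=
  linear T /\ exists M : R, forall xi, l2_norm (T xi) <= M * l2_norm xi.

(* Meaningful for bounded T only. *)
Definition op_norm T : R :=
  sup [set l2_norm (T xi) | xi in [set xi : H | l2_norm xi <= 1]].

Definition is_adjoint T S :=
  forall xi eta, l2_inner (T xi) eta = l2_inner xi (S eta).

Definition norm_closed A :=
  forall T, bounded_operator T ->
    (forall e : R, 0 < e -> exists2 S, A S & op_norm (T - S) < e) -> A T.

Definition linear_subspace A :=
  A 0 /\ forall (c : R[i]) S T, A S -> A T -> A (c *: S + T).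

Definition cstar_algebra A :=
  [/\ A `<=` bounded_operator, linear_subspace A,
      forall S T, A S -> A T -> A (S \o T),
      forall S T, A S -> is_adjoint S T -> A T &
      norm_closed A].

Definition cstar_generated (E : set op) : set op := smallest cstar_algebra E.

Definition closed_ideal A J :=
  [/\ J `<=` A, linear_subspace J,
      forall S T, A S -> J T -> J (S \o T) /\ J (T \o S) &
      norm_closed J].

Definition simple_cstar A :=
  A <> [set 0] /\ forall J, closed_ideal A J -> J = [set 0] \/ J = A.

Definition op_le S T :=
  forall xi, 0 <= l2_inner ((T - S) xi) xi.

Definition hereditary_subalgebra A B :=
  [/\ cstar_algebra B, B `<=` A &
      forall a b, A a -> B b -> op_le 0 a -> op_le a b -> B a].

Definition projection p := p \o p = p /\ is_adjoint p p.

(* p is Murray-von Neumann equivalent in A to a proper subprojection: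
   w = v^*, v^* v = p and v v^* < p. *)
Definition infinite_projection A p :=
  [/\ A p, projection p &
      exists v w, [/\ A v, is_adjoint v w, w \o v = p,
        op_le (v \o w) p & v \o w <> p]].

(* Cuntz' definition, for simple C*-algebras. *)
Definition purely_infinite A :=
  forall B, hereditary_subalgebra A B -> B <> [set 0] ->
    exists2 p, B p & infinite_projection A p.

End Operators.

(** * Quasi-regular representations *)

Section QuasiRegular.
Variable S : Type.
Implicit Types (G K : set (S -> S)) (g h : S -> S) (c : set (S -> S)).

Definition translate g c : set (S -> S) := [set g \o h | h in c].

(* The set G / K of left cosets, for groups K <= G of bijections of S. *)
Definition left_cosets G K : set (set (S -> S)) :=
  [set translate g K | g in G].

(* U is the operator lambda_{G/K}(g), that is, (U xi)(g c) = xi(c). When K <= G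
   are groups of bijections and g is in G, translation by g permutes G / K and
   there is exactly one such U. *)
Definition is_quasi_regular (R : realType) G K g
    (U : l2 R (left_cosets G K) -> l2 R (left_cosets G K)) :=
  forall xi (c d : left_cosets G K),
    val d = translate g (val c) -> U xi d = xi c.

Definition quasi_regular_cstar (R : realType) G K :
    set (l2 R (left_cosets G K) -> l2 R (left_cosets G K)) :=
  cstar_generated [set U | exists2 g, G g & @is_quasi_regular R G K g U].

End QuasiRegular.

Arguments quasi_regular_cstar {S} R G K.

(* Main.v *)
From HB Require Import structures.
Require Import Defs.
From mathcomp Require Import all_boot all_order all_algebra.
From mathcomp Require Import all_classical all_reals all_analysis.
From mathcomp Require Import finmap complex ring lra zify.

(* T acts on X = T / F, which is the orbit of 0 in the circle, and the algebra A is
   the norm closure of the span of the permutation operators of this action.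

   Given a in A, normalised so that <a d_0, d_0> = 1 for the point mass d_0, take
   points e_k p in X close to 0, where e_k runs over a Folner set of slopes, and
   t_k in T of slope e_k near 0 with t_k 0 = e_k p.  An element g of T moving 0 moves
   these points away from 0, while an element fixing 0 multiplies them
   by its slope, and then g t_k and t_j have the same germ at 0 when
   g (e_k p) = e_j p.  Hence Y = m^(-1/2) sum_k t_k is isometric on vectors supported
   in a small neighbourhood U of 0, and Y^* a Y is close to 1 on these vectors.  An
   isometry of A with range in l2(U) then yields W in A with W^* a W close to 1.

   Such isometries exist because T compresses the complement of any arc into any
   other arc: if u in T fixes an arc pointwise, suitable conjugates of u - 1 have
   disjointly supported ranges and, by Powers' averaging argument, the square of their
   normalised sum is close to 1.

   Compression makes every nonzero ideal contain an invertible element.  For b in a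
   hereditary subalgebra B, it gives V in A with (b V)^* (b V) = 1, and then
   p = b V V^* b^* is a projection of B; it is infinite since A has a non-unitary
   isometry t, which moves p properly inside itself through b V t V^* b^*. *)

Set Implicit Arguments.
Unset Strict Implicit.
Unset Printing Implicit Defensive.

Import Order.TTheory GRing.Theory Num.Theory.
Import numFieldNormedType.Exports.

Local Open Scope classical_set_scope.
Local Open Scope ring_scope.
Local Open Scope complex_scope.

(** * Sums over arbitrary index sets *)

(** What replaces it is that only right-hand germs at 0 matter: the points e_k p lie to the right of
    0, each t_k carries a two-sided neighbourhood of 0 to the right of 0, and there an element
    fixing 0 acts by its right slope. Right slopes form an abelian group, whence the Folner sets.
    The price is that g t_k = t_j holds only near 0, which is why vectors have to be squeezed into a
    small arc first.

    The definitions of T and F mix the interval, with its cut at 0, and the circle. They are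
    replaced by a condition on the germ at each point of the circle together with invariance of
    Gamma in both directions; the delicate point of this translation is that Gamma is preserved
    although a partition into linear pieces may have nodes outside Gamma.

    On the operator side, adjoints are limits of adjoints of finite combinations, and the only
    functional calculus is an inverse square root near 1, found as a fixed point. The tolerance 1/10
    required by that iteration fixes the number 800 of conjugates. *)

Section RealSum.
Variables (R : realType) (X : choiceType).
Implicit Types (u v : X -> R) (s : seq X).

(** Bounding finite sums over duplicate-free lists turns summability into real inequalities, away
    from extended reals. *)
Definition abs_summable u :=
  exists M : R, forall s, uniq s -> \sum_(x <- s) `|u x| <= M.

Definition esumR u := fine (\esum_(x in [set: X]) (u x)%:E).

Lemma esum_ge_seq u s : (forall x, 0 <= u x) -> uniq s ->
  ((\sum_(x <- s) u x)%:E <= \esum_(x in [set: X]) (u x)%:E)%E.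
Proof.
move=> u0 us; apply: esum_ge; exists [set` s]; first by split.
by rewrite -fsbig_seq// sumEFin.
Qed.

Lemma esum_le_seq u (M : R) : (forall s, uniq s -> \sum_(x <- s) u x <= M) ->
  (\esum_(x in [set: X]) (u x)%:E <= M%:E)%E.
Proof.
move=> h; apply: ge_ereal_sup => _ [A [finA _] <-].
by rewrite fsbig_finite// sumEFin lee_fin; apply: h; exact: fset_uniq.
Qed.

Lemma esumR_fin u : (forall x, 0 <= u x) -> abs_summable u ->
  (esumR u)%:E = \esum_(x in [set: X]) (u x)%:E.
Proof.
move=> u0 [M hM]; rewrite fineK// ge0_fin_numE; last first.
  by apply: esum_ge0 => x _; rewrite lee_fin.
apply: le_lt_trans (ltry M); apply: esum_le_seq => s /hM.
by congr (_ <= _); apply: eq_bigr => x _; rewrite ger0_norm.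
Qed.

Lemma esumR_ge u s : (forall x, 0 <= u x) -> abs_summable u -> uniq s ->
  \sum_(x <- s) u x <= esumR u.
Proof. by move=> u0 su us; rewrite -lee_fin esumR_fin//; exact: esum_ge_seq. Qed.

Lemma esumR_le u (M : R) : (forall x, 0 <= u x) ->
  (forall s, uniq s -> \sum_(x <- s) u x <= M) -> esumR u <= M.
Proof.
move=> u0 h; rewrite -lee_fin esumR_fin//; first exact: esum_le_seq.
by exists M => s /h; congr (_ <= _); apply: eq_bigr => x _; rewrite ger0_norm.
Qed.

Lemma esumR_ge0 u : (forall x, 0 <= u x) -> 0 <= esumR u.
Proof.
by move=> u0; apply: fine_ge0; apply: esum_ge0 => x _; rewrite lee_fin.
Qed.

Lemma abs_summable_le u v :
  (forall x, `|u x| <= `|v x|) -> abs_summable v -> abs_summable u.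
Proof.
by move=> h [M hM]; exists M => s /hM; apply: le_trans; apply: ler_sum.
Qed.

Lemma abs_summableD u v : abs_summable u -> abs_summable v ->
  abs_summable (fun x => u x + v x).
Proof.
move=> [M hM] [N hN]; exists (M + N) => s us.
apply: le_trans (lerD (hM s us) (hN s us)); rewrite -big_split/=.
by apply: ler_sum => x _; exact: ler_normD.
Qed.

Lemma abs_summableZ c u : abs_summable u -> abs_summable (fun x => c * u x).
Proof.
move=> [M hM]; exists (`|c| * M) => s us.
under eq_bigr do rewrite normrM.
by rewrite -mulr_sumr ler_wpM2l// hM.
Qed.

Lemma esumRD u v : (forall x, 0 <= u x) -> (forall x, 0 <= v x) ->
  abs_summable u -> abs_summable v ->
  esumR (fun x => u x + v x) = esumR u + esumR v.
Proof.
move=> u0 v0 su sv; apply: EFin_inj; rewrite esumR_fin//; last first.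
- exact: abs_summableD.
- by move=> x; rewrite addr_ge0.
by rewrite EFinD !esumR_fin// -esumD// => x _; rewrite lee_fin.
Qed.

Lemma esumRZ c u : (forall x, 0 <= u x) -> abs_summable u -> 0 <= c ->
  esumR (fun x => c * u x) = c * esumR u.
Proof.
move=> u0 su c0; have u0' x : 0 <= c * u x by rewrite mulr_ge0.
apply/eqP; rewrite eq_le; apply/andP; split.
  by apply: esumR_le => // s us; rewrite -mulr_sumr ler_wpM2l// esumR_ge.
have [->|cn0] := eqVneq c 0; first by rewrite mul0r; apply: esumR_ge0 => x; rewrite mul0r.
rewrite mulrC -ler_pdivlMr ?lt_def ?cn0//; apply: esumR_le => // s us.
rewrite ler_pdivlMr ?lt_def ?cn0// mulrC mulr_sumr; apply: esumR_ge => //.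
exact: abs_summableZ.
Qed.

Lemma abs_summable_max u : abs_summable u -> abs_summable (fun x => Num.max (u x) 0).
Proof.
apply: abs_summable_le => x; rewrite /Num.max; case: ltP => // _.
by rewrite normr0.
Qed.

Lemma abs_summableN u : abs_summable u -> abs_summable (fun x => - u x).
Proof. by apply: abs_summable_le => x; rewrite normrN. Qed.

(** The value does not depend on the splitting of a family into two nonnegative ones: after adding
    across, only additivity of nonnegative sums is left. Linearity of [real_sum] follows by choosing
    a convenient splitting. *)
Lemma real_sumB u v : (forall x, 0 <= u x) -> (forall x, 0 <= v x) ->
  abs_summable u -> abs_summable v ->
  real_sum (fun x => u x - v x) = esumR u - esumR v.
Proof.
move=> u0 v0 su sv; rewrite /real_sum -!/(esumR _).
have sB := abs_summableD su (abs_summableN sv).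
have mge0 (a : R) : 0 <= Num.max a 0 by rewrite le_max lexx orbT.
have s1 := abs_summable_max sB; have s2 := abs_summable_max (abs_summableN sB).
suff : esumR u + esumR (fun x => Num.max (- (u x - v x)) 0) =
       esumR (fun x => Num.max (u x - v x) 0) + esumR v by lra.
rewrite -esumRD => //; rewrite -esumRD//.
congr fine; apply: eq_esum => x _; congr EFin.
rewrite opprB /Num.max; case: ltP => h1; case: ltP => h2; lra.
Qed.

Lemma real_sum_posneg u :
  real_sum u = esumR (fun x => Num.max (u x) 0) - esumR (fun x => Num.max (- u x) 0).
Proof. by []. Qed.

Lemma max_posneg (a : R) : a = Num.max a 0 - Num.max (- a) 0.
Proof. by rewrite /Num.max; case: ltP => h1; case: ltP => h2; lra. Qed.

Lemma real_sumD u v : abs_summable u -> abs_summable v ->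
  real_sum (fun x => u x + v x) = real_sum u + real_sum v.
Proof.
move=> su sv; rewrite (real_sum_posneg u) (real_sum_posneg v).
have mge0 (a : R) : 0 <= Num.max a 0 by rewrite le_max lexx orbT.
have su1 := abs_summable_max su; have sv1 := abs_summable_max sv.
have su2 := abs_summable_max (abs_summableN su).
have sv2 := abs_summable_max (abs_summableN sv).
transitivity (real_sum (fun x => (Num.max (u x) 0 + Num.max (v x) 0)
   - (Num.max (- u x) 0 + Num.max (- v x) 0))).
  congr real_sum; apply/funext => x.
  by rewrite {1}[u x]max_posneg {1}[v x]max_posneg; lra.
rewrite real_sumB ?esumRD//; first by lra.
- by move=> x; rewrite addr_ge0.
- by move=> x; rewrite addr_ge0.
- exact: abs_summableD.
- exact: abs_summableD.
Qed.

Lemma real_sumZ c u : abs_summable u ->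
  real_sum (fun x => c * u x) = c * real_sum u.
Proof.
move=> su; rewrite (real_sum_posneg u).
have mge0 (a : R) : 0 <= Num.max a 0 by rewrite le_max lexx orbT.
have su1 := abs_summable_max su.
have su2 := abs_summable_max (abs_summableN su).
have [c0|c0] := leP 0 c.
  transitivity (real_sum (fun x => c * Num.max (u x) 0 - c * Num.max (- u x) 0)).
    by congr real_sum; apply/funext => x; rewrite {1}[u x]max_posneg; lra.
  rewrite real_sumB ?esumRZ//; first by lra.
  - by move=> x; rewrite mulr_ge0.
  - by move=> x; rewrite mulr_ge0.
  - exact: abs_summableZ.
  - exact: abs_summableZ.
transitivity (real_sum (fun x => (- c) * Num.max (- u x) 0 - (- c) * Num.max (u x) 0)).
  by congr real_sum; apply/funext => x; rewrite {1}[u x]max_posneg; lra.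
have c0' : 0 <= - c by lra.
rewrite real_sumB ?esumRZ//; first by lra.
- by move=> x; rewrite mulr_ge0.
- by move=> x; rewrite mulr_ge0.
- exact: abs_summableZ.
- exact: abs_summableZ.
Qed.

Lemma real_sum_nneg u : (forall x, 0 <= u x) -> real_sum u = esumR u.
Proof.
move=> u0; rewrite /real_sum -!/(esumR _) (_ : esumR (fun x => Num.max (- u x) 0) = 0).
  by rewrite subr0; congr esumR; apply/funext => x; apply/max_idPl.
rewrite /esumR esum1// => x _; congr EFin; apply/max_idPr.
by rewrite oppr_le0.
Qed.

Lemma real_sum_reindex (e e' : X -> X) u : cancel e e' -> cancel e' e ->
  real_sum (fun x => u (e x)) = real_sum u.
Proof.
move=> eK e'K; rewrite /real_sum.
have h (w : X -> \bar R) : \esum_(x in [set: X]) w x = \esum_(x in [set: X]) w (e x).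
  apply: reindex_esum; split.
  - by move=> x _.
  - by move=> x y _ _ /(congr1 e'); rewrite !eK.
  - by move=> y _; exists (e' y) => //; rewrite e'K.
by rewrite (h (fun x => (Num.max (u x) 0)%:E)) (h (fun x => (Num.max (- u x) 0)%:E)).
Qed.

Lemma real_sum_single (x0 : X) (a : R) :
  real_sum (fun x => if x == x0 then a else 0) = a.
Proof.
have h (b : R) : 0 <= b -> esumR (fun x : X => if x == x0 then b else 0) = b.
  move=> b0; rewrite /esumR (esumID [set x0])/=; last first.
    by move=> x _; case: ifP; rewrite lee_fin.
  rewrite setTI esum_set1 ?eqxx ?lee_fin// esum1 ?adde0//.
  by move=> x [_ /eqP/negbTE ->].
rewrite /real_sum -!/(esumR _).
rewrite (_ : (fun x => Num.max (if x == x0 then a else 0) 0) =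
             (fun x => if x == x0 then Num.max a 0 else 0)); last first.
  by apply/funext => x; case: ifP => // _; rewrite maxxx.
rewrite (_ : (fun x => Num.max (- (if x == x0 then a else 0)) 0) =
             (fun x => if x == x0 then Num.max (- a) 0 else 0)); last first.
  by apply/funext => x; case: ifP => // _; rewrite oppr0 maxxx.
by rewrite !h -?max_posneg// le_max lexx orbT.
Qed.

End RealSum.

(** * Geometry of l2 *)

Section ComplexSum.
Variables (R : realType) (X : choiceType).
Implicit Types (f g : X -> R[i]).

Definition complex_summable f :=
  abs_summable (fun x => complex.Re (f x)) /\ abs_summable (fun x => complex.Im (f x)).

Definition complex_sum f : R[i] :=
  real_sum (fun x => complex.Re (f x)) +i* real_sum (fun x => complex.Im (f x)).

Lemma ReD (a b : R[i]) : complex.Re (a + b) = complex.Re a + complex.Re b.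
Proof. by case: a b => ? ? [? ?]. Qed.

Lemma ImD (a b : R[i]) : complex.Im (a + b) = complex.Im a + complex.Im b.
Proof. by case: a b => ? ? [? ?]. Qed.

Lemma ReM (a b : R[i]) : complex.Re (a * b) =
  complex.Re a * complex.Re b - complex.Im a * complex.Im b.
Proof. by case: a b => ? ? [? ?]. Qed.

Lemma ImM (a b : R[i]) : complex.Im (a * b) =
  complex.Re a * complex.Im b + complex.Im a * complex.Re b.
Proof. by case: a b => ? ? [? ?]. Qed.

Lemma complex_sumD f g : complex_summable f -> complex_summable g ->
  complex_sum (fun x => f x + g x) = complex_sum f + complex_sum g.
Proof.
move=> [f1 f2] [g1 g2]; rewrite /complex_sum.
rewrite (_ : (fun x => complex.Re (f x + g x)) =
  (fun x => complex.Re (f x) + complex.Re (g x))); last first.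
  by apply/funext => x; rewrite ReD.
rewrite (_ : (fun x => complex.Im (f x + g x)) =
  (fun x => complex.Im (f x) + complex.Im (g x))); last first.
  by apply/funext => x; rewrite ImD.
by rewrite !real_sumD.
Qed.

Lemma complex_sumZ c f : complex_summable f ->
  complex_sum (fun x => c * f x) = c * complex_sum f.
Proof.
move=> [f1 f2]; rewrite /complex_sum.
rewrite (_ : (fun x => complex.Re (c * f x)) =
  (fun x => complex.Re c * complex.Re (f x) + (- complex.Im c) * complex.Im (f x)));
  last by apply/funext => x; rewrite ReM mulNr.
rewrite (_ : (fun x => complex.Im (c * f x)) =
  (fun x => complex.Re c * complex.Im (f x) + complex.Im c * complex.Re (f x)));
  last by apply/funext => x; rewrite ImM.
rewrite !real_sumD; try exact: abs_summableZ.
by rewrite !real_sumZ//; case: c => a b; simpc.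
Qed.

Lemma complex_sum_conj f : complex_summable f ->
  complex_sum (fun x => conjc (f x)) = conjc (complex_sum f).
Proof.
move=> [f1 f2]; rewrite /complex_sum /=; congr Complex.
  by congr real_sum; apply/funext => x; case: (f x).
rewrite -mulN1r -real_sumZ//; congr real_sum; apply/funext => x.
by rewrite mulN1r; case: (f x).
Qed.

Lemma complex_sum_reindex (e e' : X -> X) f : cancel e e' -> cancel e' e ->
  complex_sum (fun x => f (e x)) = complex_sum f.
Proof.
move=> eK e'K; rewrite /complex_sum.
rewrite (real_sum_reindex (fun x => complex.Re (f x)) eK e'K).
by rewrite (real_sum_reindex (fun x => complex.Im (f x)) eK e'K).
Qed.

End ComplexSum.

Arguments l2_inner : simpl never.
Arguments conjc : simpl never.

Section InnerProduct.
Variables (R : realType) (X : choiceType).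
Local Notation H := (l2 R X).
Implicit Types (xi eta zeta : H) (c : R[i]).

Definition sqnormc (z : R[i]) : R := complex.Re z ^+ 2 + complex.Im z ^+ 2.

Lemma sqnormc_ge0 z : 0 <= sqnormc z.
Proof. by rewrite addr_ge0// sqr_ge0. Qed.

Lemma sqnormcE (z : R[i]) : Normc.normc z ^+ 2 = sqnormc z.
Proof. by case: z => a b; rewrite /= sqr_sqrtr// addr_ge0// sqr_ge0. Qed.

Lemma normc_ge0 (z : R[i]) : 0 <= Normc.normc z.
Proof. by case: z => a b; exact: sqrtr_ge0. Qed.

Lemma conjcD (a b : R[i]) : conjc (a + b) = conjc a + conjc b.
Proof. by rewrite rmorphD. Qed.

Lemma conjcM (a b : R[i]) : conjc (a * b) = conjc a * conjc b.
Proof. by rewrite rmorphM. Qed.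

Lemma conjcN (a : R[i]) : conjc (- a) = - conjc a.
Proof. by rewrite rmorphN. Qed.

Lemma mulcJ (z : R[i]) : z * conjc z = (sqnormc z)%:C.
Proof. by case: z => a b; simpc; rewrite /sqnormc/= !expr2; congr Complex; ring. Qed.

Lemma square_summableP (f : X -> R[i]^o) :
  (f \in @square_summable R X) <-> abs_summable (fun x => sqnormc (f x)).
Proof.
have -> : (f \in @square_summable R X) = (f \in [set xi : X -> R[i]^o |
    summable [set: X] (fun x => (Normc.normc (xi x) ^+ 2)%:E)]) by [].
rewrite in_setE /=; split => [h|[M hM]].
  exists (esumR (fun x => sqnormc (f x))) => s us.
  rewrite (eq_bigr (fun x => sqnormc (f x))) => [|x _]; last first.
    by rewrite ger0_norm// sqnormc_ge0.
  rewrite -lee_fin; apply: le_trans (esum_ge_seq _ us) _.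
    by move=> x; exact: sqnormc_ge0.
  rewrite fineK// ge0_fin_numE; last first.
    by apply: esum_ge0 => x _; rewrite lee_fin sqnormc_ge0.
  apply: le_lt_trans h; apply: le_esum => x _.
  by rewrite sqnormcE gee0_abs// lee_fin sqnormc_ge0.
apply: (@le_lt_trans _ _ M%:E); last exact: ltry.
rewrite (_ : (fun x => _) = (fun x => (sqnormc (f x))%:E)).
  apply: esum_le_seq => s /hM; congr (_ <= _); apply: eq_bigr => x _.
  by rewrite ger0_norm// sqnormc_ge0.
by apply/funext => x; rewrite sqnormcE gee0_abs// lee_fin sqnormc_ge0.
Qed.

Lemma l2_summable xi : abs_summable (fun x => sqnormc (xi x)).
Proof. by apply/square_summableP; case: xi. Qed.

Lemma l2D xi eta x : (xi + eta) x = xi x + eta x.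
Proof. by []. Qed.

Lemma l2N xi x : (- xi) x = - xi x.
Proof. by []. Qed.

Lemma l2B xi eta x : (xi - eta) x = xi x - eta x.
Proof. by []. Qed.

Lemma l2Z c xi x : (c *: xi) x = c * xi x.
Proof. by []. Qed.

Lemma l20 x : (0 : H) x = 0.
Proof. by []. Qed.

Lemma l2_ext xi eta : (forall x, xi x = eta x) -> xi = eta.
Proof. by move=> h; apply/val_inj/funext. Qed.

Lemma l2_sum (I : Type) (r : seq I) (P : pred I) (F : I -> H) x :
  (\sum_(i <- r | P i) F i) x = \sum_(i <- r | P i) F i x.
Proof. by elim/big_rec2 : _ => // i a b _ <-. Qed.

Lemma inner_summable xi eta : complex_summable (fun x => xi x * conjc (eta x)).
Proof.
have S : abs_summable (fun x => sqnormc (xi x) + sqnormc (eta x)).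
  by apply: abs_summableD; exact: l2_summable.
have key (p a b c d : R) : p = a * c + b * d \/ p = b * c - a * d ->
    `|p| <= `|(a ^+ 2 + b ^+ 2) + (c ^+ 2 + d ^+ 2)|.
  rewrite [leRHS]ger0_norm ?addr_ge0 ?sqr_ge0// ler_norml !expr2.
  have := (sqr_ge0 (a + c), sqr_ge0 (a - c), sqr_ge0 (b + d), sqr_ge0 (b - d)).
  have := (sqr_ge0 (a + d), sqr_ge0 (a - d), sqr_ge0 (b + c), sqr_ge0 (b - c)).
  rewrite !expr2 => -[[[h1 h2] h3] h4] [[[h5 h6] h7] h8].
  by move=> [->|->]; apply/andP; split; lra.
split; apply: abs_summable_le S => x; case: (xi x) => a b; case: (eta x) => c d;
  rewrite /sqnormc /=; apply: key; [left|right]; ring.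
Qed.

Lemma l2_innerE xi eta : l2_inner xi eta = complex_sum (fun x => xi x * conjc (eta x)).
Proof. by []. Qed.

Lemma innerDl xi eta zeta :
  l2_inner (xi + eta) zeta = l2_inner xi zeta + l2_inner eta zeta.
Proof.
rewrite !l2_innerE -complex_sumD; try exact: inner_summable.
by congr complex_sum; apply/funext => x; rewrite l2D mulrDl.
Qed.

Lemma innerZl c xi zeta : l2_inner (c *: xi) zeta = c * l2_inner xi zeta.
Proof.
rewrite !l2_innerE -complex_sumZ; try exact: inner_summable.
by congr complex_sum; apply/funext => x; rewrite l2Z mulrA.
Qed.

Lemma innerC xi eta : l2_inner eta xi = conjc (l2_inner xi eta).
Proof.
rewrite !l2_innerE -complex_sum_conj; try exact: inner_summable.
congr complex_sum; apply/funext => x.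
by rewrite conjcM conjcK mulrC.
Qed.

Lemma innerDr xi eta zeta :
  l2_inner zeta (xi + eta) = l2_inner zeta xi + l2_inner zeta eta.
Proof. by rewrite innerC innerDl conjcD -!innerC. Qed.

Lemma innerZr c xi zeta : l2_inner zeta (c *: xi) = conjc c * l2_inner zeta xi.
Proof. by rewrite innerC innerZl conjcM -innerC. Qed.

Lemma innerNl xi zeta : l2_inner (- xi) zeta = - l2_inner xi zeta.
Proof. by rewrite -scaleN1r innerZl mulN1r. Qed.

Lemma innerNr xi zeta : l2_inner zeta (- xi) = - l2_inner zeta xi.
Proof. by rewrite innerC innerNl conjcN -innerC. Qed.

Lemma innerBl xi eta zeta :
  l2_inner (xi - eta) zeta = l2_inner xi zeta - l2_inner eta zeta.
Proof. by rewrite innerDl innerNl. Qed.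

Lemma innerBr xi eta zeta :
  l2_inner zeta (xi - eta) = l2_inner zeta xi - l2_inner zeta eta.
Proof. by rewrite innerDr innerNr. Qed.

Lemma inner0l zeta : l2_inner 0 zeta = 0.
Proof. by rewrite -(scale0r (0 : H)) innerZl mul0r. Qed.

Lemma inner0r zeta : l2_inner zeta 0 = 0.
Proof. by rewrite innerC inner0l conjc0. Qed.

Lemma inner_suml (I : Type) (r : seq I) (P : pred I) (F : I -> H) zeta :
  l2_inner (\sum_(i <- r | P i) F i) zeta = \sum_(i <- r | P i) l2_inner (F i) zeta.
Proof.
by elim/big_rec2 : _ => [|i a b _ <-]; rewrite ?inner0l ?innerDl.
Qed.

Lemma inner_sumr (I : Type) (r : seq I) (P : pred I) (F : I -> H) zeta :
  l2_inner zeta (\sum_(i <- r | P i) F i) = \sum_(i <- r | P i) l2_inner zeta (F i).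
Proof.
by elim/big_rec2 : _ => [|i a b _ <-]; rewrite ?inner0r ?innerDr.
Qed.

Lemma l2_normE xi : l2_norm xi ^+ 2 = esumR (fun x => sqnormc (xi x)).
Proof.
rewrite /l2_norm (_ : (fun x => _) = (fun x => (sqnormc (xi x))%:E)); last first.
  by apply/funext => x; rewrite sqnormcE.
by rewrite sqr_sqrtr// esumR_ge0// => x; exact: sqnormc_ge0.
Qed.

Lemma norm_ge0 xi : 0 <= l2_norm xi.
Proof. exact: sqrtr_ge0. Qed.

Lemma inner_normE xi : l2_inner xi xi = (l2_norm xi ^+ 2)%:C.
Proof.
rewrite l2_innerE l2_normE /complex_sum -real_sum_nneg; last first.
  by move=> x; exact: sqnormc_ge0.
congr Complex.
  by congr real_sum; apply/funext => x; rewrite mulcJ.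
rewrite real_sum_nneg => [|x]; last by rewrite mulcJ.
by rewrite /esumR esum1// => x _; rewrite mulcJ.
Qed.

Lemma norm_eq0 xi : l2_norm xi = 0 -> xi = 0.
Proof.
move=> h; apply: l2_ext => x; rewrite l20.
have := esumR_ge (s := [:: x]) (fun x => sqnormc_ge0 (xi x)) (l2_summable xi) isT.
rewrite -l2_normE h expr0n/= big_seq1; case: (xi x) => a b.
rewrite /sqnormc/= => h2; have := sqr_ge0 a; have := sqr_ge0 b => ? ?.
have /eqP : a ^+ 2 = 0 by lra.
have /eqP : b ^+ 2 = 0 by lra.
by rewrite !sqrf_eq0 => /eqP -> /eqP ->.
Qed.

Lemma norm_expand xi eta w : l2_norm (xi - w *: eta) ^+ 2 =
  l2_norm xi ^+ 2 - 2 * complex.Re (conjc w * l2_inner xi eta)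
  + sqnormc w * l2_norm eta ^+ 2.
Proof.
apply: (@complexI R); rewrite -inner_normE innerBl !innerBr !innerZl !innerZr.
rewrite (innerC xi eta) !inner_normE.
case: (l2_inner xi eta) => a b; case: w => c d; rewrite /sqnormc.
by simpc; rewrite /= !expr2; congr Complex; ring.
Qed.

Lemma cauchy_schwarz xi eta :
  Normc.normc (l2_inner xi eta) <= l2_norm xi * l2_norm eta.
Proof.
rewrite -(@ler_pXn2r _ 2)//; last 2 first.
- by rewrite nnegrE normc_ge0.
- by rewrite nnegrE mulr_ge0// norm_ge0.
rewrite sqnormcE exprMn; set c := l2_inner xi eta.
(* Scaling [eta] by [t * c] makes the cross term real. The resulting nonnegative quadratic in [t] is
   used at its minimum [b^-1], or, when [b = 0], at a [t] where it would equal -1. *)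
have key (t : R) : 0 <= l2_norm xi ^+ 2 - 2 * t * sqnormc c
    + t ^+ 2 * sqnormc c * l2_norm eta ^+ 2.
  have := norm_expand xi eta (t%:C * c); rewrite -/c.
  rewrite (_ : complex.Re _ = t * sqnormc c); last first.
    by rewrite conjcM conjc_real -mulrA [conjc c * c]mulrC mulcJ; simpc.
  rewrite (_ : sqnormc (_ * _) = t ^+ 2 * sqnormc c); last first.
    by case: (c) => a b; rewrite /sqnormc; simpc => /=; ring.
  by rewrite mulrA => <-; rewrite sqr_ge0.
have := sqr_ge0 (l2_norm xi); have := sqnormc_ge0 c; move: key.
set a := l2_norm xi ^+ 2; set n := sqnormc c; set b := l2_norm eta ^+ 2.
move=> key n0 a0.
have [b0|b0] := eqVneq b 0.
  rewrite b0 mulr0; have [//|n1] := leP n 0.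
  have := key ((a + 1) / (2 * n)); rewrite b0 mulr0.
  by rewrite (_ : 2 * _ * n = a + 1); [lra|field; rewrite gt_eqF].
have b1 : 0 < b by rewrite lt_def b0 sqr_ge0.
have := key b^-1; rewrite (_ : _ - _ + _ = a - n / b); last by field.
by rewrite subr_ge0 ler_pdivrMr.
Qed.

Lemma Re_le_normc (z : R[i]) : complex.Re z <= Normc.normc z.
Proof.
case: z => a b /=; apply: le_trans (ler_norm a) _.
by rewrite -sqrtr_sqr ler_wsqrtr// lerDl sqr_ge0.
Qed.

Lemma norm_triangle xi eta : l2_norm (xi + eta) <= l2_norm xi + l2_norm eta.
Proof.
rewrite -(@ler_pXn2r _ 2)//; last 2 first.
- by rewrite nnegrE norm_ge0.
- by rewrite nnegrE addr_ge0// norm_ge0.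
have -> : xi + eta = xi - (-1) *: eta by rewrite scaleN1r opprK.
rewrite norm_expand conjcN conjc1 mulN1r.
have -> : sqnormc (- 1) = 1 by rewrite /sqnormc /=; ring.
have := le_trans (Re_le_normc _) (cauchy_schwarz xi eta).
case: (l2_inner xi eta) => a b /=; rewrite !expr2; lra.
Qed.

Lemma normZ c xi : l2_norm (c *: xi) = Normc.normc c * l2_norm xi.
Proof.
apply/eqP; rewrite -(@eqrXn2 _ 2)//; last 2 first.
- exact: norm_ge0.
- by rewrite mulr_ge0// ?normc_ge0// norm_ge0.
apply/eqP/(@complexI R); rewrite exprMn sqnormcE -inner_normE innerZl innerZr inner_normE.
by rewrite mulrA mulcJ -rmorphM.
Qed.

Lemma norm0 : l2_norm (0 : H) = 0.
Proof. by rewrite -(scale0r (0 : H)) normZ Normc.normc0 mul0r. Qed.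

Lemma normN xi : l2_norm (- xi) = l2_norm xi.
Proof. by rewrite -scaleN1r normZ normcN Normc.normc1 mul1r. Qed.

Lemma norm_distC xi eta : l2_norm (xi - eta) = l2_norm (eta - xi).
Proof. by rewrite -normN opprB. Qed.

Lemma norm_triangleB xi eta : l2_norm (xi - eta) <= l2_norm xi + l2_norm eta.
Proof. by rewrite -(normN eta); exact: norm_triangle. Qed.

Lemma norm_sum (I : Type) (r : seq I) (P : pred I) (F : I -> H) :
  l2_norm (\sum_(i <- r | P i) F i) <= \sum_(i <- r | P i) l2_norm (F i).
Proof.
elim/big_rec2 : _ => [|i a b _ h]; first by rewrite norm0.
by apply: le_trans (norm_triangle _ _) _; rewrite lerD2l.
Qed.

Lemma norm_pythagoras (I : finType) (F : I -> H) :
  (forall i j, i != j -> l2_inner (F i) (F j) = 0) ->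
  l2_norm (\sum_i F i) ^+ 2 = \sum_i l2_norm (F i) ^+ 2.
Proof.
move=> h; apply: (@complexI R); rewrite -inner_normE inner_suml rmorph_sum /=.
apply: eq_bigr => i _; rewrite inner_sumr (bigD1 i)//= big1 ?addr0 ?inner_normE//.
by move=> j ji; apply: h; rewrite eq_sym.
Qed.

Lemma norm_le_inner xi (M : R) : 0 <= M ->
  (forall eta, Normc.normc (l2_inner xi eta) <= M * l2_norm eta) -> l2_norm xi <= M.
Proof.
move=> M0 /(_ xi); rewrite inner_normE /= expr0n /= addr0 sqrtr_sqr.
rewrite ger0_norm ?sqr_ge0// expr2.
have [->//|x0] := eqVneq (l2_norm xi) 0.
by rewrite ler_pM2r// lt_def x0 norm_ge0.
Qed.

Lemma norm_ge_seq xi (s : seq X) : uniq s ->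
  \sum_(x <- s) sqnormc (xi x) <= l2_norm xi ^+ 2.
Proof.
move=> us; rewrite l2_normE; apply: esumR_ge => //; last exact: l2_summable.
by move=> x; exact: sqnormc_ge0.
Qed.

Lemma norm_le_seq xi (M : R) : 0 <= M ->
  (forall s, uniq s -> \sum_(x <- s) sqnormc (xi x) <= M ^+ 2) -> l2_norm xi <= M.
Proof.
move=> M0 h; rewrite -(@ler_pXn2r _ 2)// ?nnegrE ?norm_ge0//.
by rewrite l2_normE; apply: esumR_le => // x; exact: sqnormc_ge0.
Qed.

Lemma inner_disjoint xi eta : (forall x, xi x = 0 \/ eta x = 0) -> l2_inner xi eta = 0.
Proof.
move=> h; rewrite l2_innerE.
rewrite (_ : (fun x => _) = (fun x => 0 * (xi x * conjc (eta x)))).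
  by rewrite complex_sumZ ?mul0r//; exact: inner_summable.
by apply/funext => x; case: (h x) => ->; rewrite ?conjc0 ?mul0r ?mulr0 ?mul0r.
Qed.

End InnerProduct.

(** * Point masses and completeness of l2 *)

Section Completeness.
Variables (R : realType) (X : choiceType).
Local Notation H := (l2 R X).
Implicit Types (xi eta zeta : H) (c : R[i]).

Lemma delta_subproof (x0 : X) :
  (fun x => (if x == x0 then 1 else 0) : R[i]^o) \in @square_summable R X.
Proof.
apply/square_summableP; exists 1 => s us.
rewrite (eq_bigr (fun x => ((x == x0)%:R : R))); last first.
  by move=> x _; case: eqP => _; rewrite /sqnormc /= ?expr0n ?expr1n /= ?addr0 ?normr1 ?normr0.
rewrite -natr_sum -big_mkcond/= sum1_count.
by rewrite (count_uniq_mem x0 us) lern1 leq_b1.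
Qed.

Definition delta (x0 : X) : H := L2 (delta_subproof x0).

Lemma inner_delta xi x : l2_inner xi (delta x) = xi x.
Proof.
rewrite l2_innerE /complex_sum.
rewrite (_ : (fun y => complex.Re _) =
  (fun y => if y == x then complex.Re (xi x) else 0)); last first.
  by apply/funext => y /=; case: eqP => [->|_]; rewrite ?conjc1 ?conjc0 ?mulr1 ?mulr0.
rewrite (_ : (fun y => complex.Im _) =
  (fun y => if y == x then complex.Im (xi x) else 0)); last first.
  by apply/funext => y /=; case: eqP => [->|_]; rewrite ?conjc1 ?conjc0 ?mulr1 ?mulr0.
by rewrite !real_sum_single; case: (xi x).
Qed.

Lemma norm_delta x : l2_norm (delta x) = 1.
Proof.
apply/eqP; rewrite -(@eqrXn2 _ 2)// ?norm_ge0//; apply/eqP/(@complexI R).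
by rewrite -inner_normE inner_delta /= eqxx expr1n.
Qed.

Lemma normc_le_norm xi x : Normc.normc (xi x) <= l2_norm xi.
Proof. by rewrite -inner_delta -[leRHS]mulr1 -(norm_delta x) cauchy_schwarz. Qed.

Lemma geometric_cvg0 (C : R) : (fun n => C / 2 ^+ n) @ \oo --> (0 : R).
Proof.
rewrite -(mulr0 C); apply: cvgM; first exact: cvg_cst.
under eq_fun do rewrite -exprVn.
by apply: cvg_expr; rewrite ger0_norm; lra.
Qed.

(** Subtracting [2 * C / 2 ^+ n] makes the sequence nondecreasing, because this correction shrinks
    by [C / 2 ^+ n] at each step, which outweighs any decrease of [u]. *)
Lemma geometric_cauchy_cvg (C : R) (u : nat -> R) :
  (forall m n, (m <= n)%N -> `|u n - u m| <= C / 2 ^+ m) ->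
  exists L : R, u @ \oo --> L.
Proof.
move=> h; pose a n := u n - 2 * C / 2 ^+ n.
have C0 : 0 <= C by have := h 0%N 0%N isT; rewrite subrr normr0 expr0 divr1.
have ca : cvgn a.
  apply: nondecreasing_is_cvgn.
    apply/nondecreasing_seqP => n; have := h n n.+1 (leqnSn n).
    rewrite /a ler_norml => /andP[h1 _].
    have -> : 2 * C / 2 ^+ n.+1 = C / 2 ^+ n.
      by rewrite exprS; field; rewrite expf_neq0.
    by move: h1; rewrite -!mulrA; set c := C / 2 ^+ n; lra.
  exists (u 0%N + C) => _ [n _ <-]; rewrite /a.
  have := h 0%N n isT; rewrite expr0 divr1 ler_norml => /andP[_ h2].
  have : 0 <= 2 * C / 2 ^+ n by rewrite divr_ge0 ?mulr_ge0 ?exprn_ge0.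
  lra.
exists (limn a + 0).
rewrite (_ : u = (fun n => a n + 2 * C / 2 ^+ n)); last first.
  by apply/funext => n; rewrite /a subrK.
by apply: cvgD => //; exact: geometric_cvg0.
Qed.

(** The limit is taken coordinatewise. The bound passes to the limit in each finite partial sum,
    which gives square summability and the rate at once. *)
Lemma l2_complete (C : R) (u : nat -> H) : 0 <= C ->
  (forall m n, (m <= n)%N -> l2_norm (u n - u m) <= C / 2 ^+ m) ->
  exists zeta : H, forall m, l2_norm (zeta - u m) <= C / 2 ^+ m.
Proof.
move=> C0 h.
have hRe x : exists L : R, (fun n => complex.Re (u n x)) @ \oo --> L.
  apply: (@geometric_cauchy_cvg C) => m n mn; apply: le_trans (h m n mn).
  apply: le_trans (normc_le_norm _ x); rewrite l2B.
  case: (u n x) => a b; case: (u m x) => c d /=.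
  by rewrite -sqrtr_sqr ler_wsqrtr// lerDl sqr_ge0.
have hIm x : exists L : R, (fun n => complex.Im (u n x)) @ \oo --> L.
  apply: (@geometric_cauchy_cvg C) => m n mn; apply: le_trans (h m n mn).
  apply: le_trans (normc_le_norm _ x); rewrite l2B.
  case: (u n x) => a b; case: (u m x) => c d /=.
  by rewrite -sqrtr_sqr ler_wsqrtr// lerDr sqr_ge0.
have [fr hfr] := choice hRe; have [fi hfi] := choice hIm.
pose f : X -> R[i]^o := fun x => fr x +i* fi x.
have key m (s : seq X) : uniq s ->
    \sum_(x <- s) sqnormc (f x - u m x) <= (C / 2 ^+ m) ^+ 2.
  move=> us.
  have cv : (fun n => \sum_(x <- s) sqnormc (u n x - u m x)) @ \oo -->
      \sum_(x <- s) sqnormc (f x - u m x).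
    elim: (s) => [|x s' IH].
      by under eq_fun do rewrite big_nil; rewrite big_nil; exact: cvg_cst.
    under eq_fun do rewrite big_cons; rewrite big_cons; apply: cvgD => //.
    have E n : sqnormc (u n x - u m x) =
      (complex.Re (u n x) - complex.Re (u m x)) ^+ 2 +
      (complex.Im (u n x) - complex.Im (u m x)) ^+ 2.
      by case: (u n x) => a b; case: (u m x).
    under eq_fun do rewrite E.
    have -> : sqnormc (f x - u m x) = (fr x - complex.Re (u m x)) ^+ 2 +
        (fi x - complex.Im (u m x)) ^+ 2 by rewrite /f; case: (u m x).
    rewrite !expr2; apply: cvgD.
      by under eq_fun do rewrite expr2; apply: cvgM; (apply: cvgB; [exact: hfr|exact: cvg_cst]).
    by under eq_fun do rewrite expr2; apply: cvgM; (apply: cvgB; [exact: hfi|exact: cvg_cst]).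
  apply: (cvgr_to_le cv); near=> n.
  apply: (@le_trans _ _ (l2_norm (u n - u m) ^+ 2)).
    exact: (norm_ge_seq (u n - u m) us).
  rewrite ler_pXn2r ?nnegrE ?norm_ge0//; last by rewrite divr_ge0// exprn_ge0.
  by apply: h; near: n; exact: nbhs_infty_ge.
have S0 : (fun x => f x - u 0%N x : R[i]^o) \in @square_summable R X.
  apply/square_summableP; exists ((C / 2 ^+ 0) ^+ 2) => s us.
  apply: le_trans (key 0%N s us); apply: ler_sum => x _.
  by rewrite ger0_norm// sqnormc_ge0.
exists (L2 S0 + u 0%N) => m; apply: norm_le_seq; first by rewrite divr_ge0// exprn_ge0.
move=> s us; apply: le_trans (key m s us); apply: ler_sum => x _.
by rewrite l2B l2D /= subrK.
Unshelve. all: by end_near.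
Qed.

End Completeness.

(** * Permutation operators and the norm closure of their span *)

(** The inverse is part of the data because permutation operators compose with it. The classical
    [eqType] structure below allows membership in lists of group elements. *)
Record aut (X : Type) := Aut {
  fwd :> X -> X; bwd : X -> X; fwdK : cancel fwd bwd; bwdK : cancel bwd fwd }.

HB.instance Definition _ X := gen_eqMixin (aut X).
HB.instance Definition _ X := gen_choiceMixin (aut X).

Section Aut.
Variable X : Type.
Implicit Types g h : aut X.

Definition aut1 : aut X := @Aut X id id (fun=> erefl) (fun=> erefl).
Definition aut_inv g : aut X := Aut (@bwdK X g) (@fwdK X g).
Definition aut_mul g h : aut X :=
  Aut (can_comp (@fwdK X g) (@fwdK X h)) (can_comp (@bwdK X h) (@bwdK X g)).

Definition subgroup (G : set (aut X)) :=
  [/\ G aut1, forall g h, G g -> G h -> G (aut_mul g h) &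
      forall g, G g -> G (aut_inv g)].

End Aut.

Section Operators.
Variables (R : realType) (X : choiceType).
Local Notation H := (l2 R X).
Local Notation op := (H -> H).
Implicit Types (xi eta : H) (c : R[i]) (g h : aut X) (S T : op) (M : R).

(** Norm estimates take this form, which does not presuppose that the supremum in [op_norm] is
    finite; [op_norm_le] and [op_norm_bnd] translate between the two. *)
Definition bounded_by T M := forall xi, l2_norm (T xi) <= M * l2_norm xi.

Section Linear.
Variable T : op.
Hypothesis linT : linear T.

Lemma linD xi eta : T (xi + eta) = T xi + T eta.
Proof. by have := linT 1 xi eta; rewrite !scale1r. Qed.

Lemma lin0 : T 0 = 0.
Proof. by apply: (addrI (T 0)); rewrite -linD !addr0. Qed.

Lemma linZ c xi : T (c *: xi) = c *: T xi.
Proof. by have := linT c xi 0; rewrite !addr0 lin0 addr0. Qed.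

Lemma linN xi : T (- xi) = - T xi.
Proof. by rewrite -scaleN1r linZ scaleN1r. Qed.

Lemma linB xi eta : T (xi - eta) = T xi - T eta.
Proof. by rewrite linD linN. Qed.

Lemma lin_sum (I : Type) (r : seq I) (P : pred I) (F : I -> H) :
  T (\sum_(i <- r | P i) F i) = \sum_(i <- r | P i) T (F i).
Proof. by elim/big_rec2 : _ => [|i a b _ <-]; rewrite ?lin0 ?linD. Qed.

End Linear.

Lemma linear_comp S T : linear S -> linear T -> linear (S \o T).
Proof. by move=> hS hT c xi eta; rewrite /= hT hS. Qed.

Lemma linear_combine c S T : linear S -> linear T -> linear (c *: S + T).
Proof.
move=> hS hT d xi eta; rewrite -[LHS]/(c *: S _ + T _).
rewrite -[(c *: S + T) xi]/(c *: S xi + T xi) -[(c *: S + T) eta]/(c *: S eta + T eta).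
rewrite hS hT !scalerDr !scalerA [d * c]mulrC -!addrA; congr (_ + _).
by rewrite addrCA.
Qed.

Lemma bounded_by_le T M M' : bounded_by T M -> M <= M' -> bounded_by T M'.
Proof. by move=> h MM xi; apply: le_trans (h xi) _; rewrite ler_wpM2r ?norm_ge0. Qed.

Lemma bounded_by_comp S T M N :
  0 <= M -> bounded_by S M -> bounded_by T N -> bounded_by (S \o T) (M * N).
Proof.
move=> M0 hS hT xi; apply: le_trans (hS _) _.
by rewrite -mulrA ler_wpM2l.
Qed.

Lemma bounded_by_combine c S T M N : bounded_by S M -> bounded_by T N ->
  bounded_by (c *: S + T) (Normc.normc c * M + N).
Proof.
move=> hS hT xi; rewrite -[(c *: S + T) xi]/(c *: S xi + T xi).
apply: le_trans (norm_triangle _ _) _; rewrite normZ mulrDl -mulrA.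
by rewrite lerD// ler_wpM2l// normc_ge0.
Qed.

Lemma bounded_by_trans S T U M N :
  bounded_by (S - T) M -> bounded_by (T - U) N -> bounded_by (S - U) (M + N).
Proof.
move=> h1 h2 xi; rewrite -[(S - U) xi]/(S xi - U xi).
have -> : S xi - U xi = (S xi - T xi) + (T xi - U xi) by rewrite addrA subrK.
apply: le_trans (norm_triangle _ _) _; rewrite mulrDl.
exact: lerD (h1 xi) (h2 xi).
Qed.

Lemma bounded_by_sym S T M : bounded_by (S - T) M -> bounded_by (T - S) M.
Proof. by move=> h xi; have := h xi; rewrite -[(S - T) xi]/(S xi - T xi) norm_distC. Qed.

Lemma bounded_operatorP T : bounded_operator T <->
  linear T /\ exists2 M, 0 <= M & bounded_by T M.
Proof.
split=> [[linT [M h]]|[linT [M M0 h]]]; split => //; last by exists M.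
exists (Num.max M 0); first by rewrite le_max lexx orbT.
by apply: bounded_by_le h _; rewrite le_max lexx.
Qed.

Lemma op_norm_le T M : 0 <= M -> bounded_by T M -> op_norm T <= M.
Proof.
move=> M0 h; apply: ge_sup.
  by exists (l2_norm (T 0)); exists 0 => //=; rewrite norm0.
move=> _ [xi /= xi1 <-]; apply: le_trans (h xi) _.
by rewrite -[leRHS]mulr1 ler_wpM2l.
Qed.

Lemma normcR (a : R) : 0 <= a -> Normc.normc a%:C = a.
Proof. by move=> a0; rewrite /= expr0n/= addr0 sqrtr_sqr ger0_norm. Qed.

Lemma op_norm_bnd T : bounded_operator T -> bounded_by T (op_norm T).
Proof.
move=> /bounded_operatorP [linT [M M0 h]] xi.
have [x0|x0] := eqVneq (l2_norm xi) 0.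
  by rewrite (norm_eq0 x0) lin0// norm0 mulr0.
have xp : 0 < l2_norm xi by rewrite lt_def x0 norm_ge0.
rewrite -ler_pdivrMr//.
have -> : l2_norm (T xi) / l2_norm xi = l2_norm (T (((l2_norm xi)^-1)%:C *: xi)).
  by rewrite linZ// normZ normcR ?invr_ge0 ?norm_ge0// mulrC.
apply: sup_ubound; last first.
  by exists (((l2_norm xi)^-1)%:C *: xi) => //=;
    rewrite normZ normcR ?invr_ge0 ?norm_ge0// mulVf.
exists M => _ [eta /= e1 <-]; apply: le_trans (h eta) _.
by rewrite -[leRHS]mulr1 ler_wpM2l.
Qed.

Lemma lam_subproof g xi : (fun x => xi (bwd g x)) \in @square_summable R X.
Proof.
apply/square_summableP; have [M hM] := l2_summable xi; exists M => s us.
have := hM [seq bwd g x | x <- s]; rewrite big_map; apply.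
by rewrite map_inj_uniq//; exact: can_inj (@bwdK X g).
Qed.

Definition lam g xi : H := L2 (lam_subproof g xi).

Lemma lamE g xi x : lam g xi x = xi (bwd g x).
Proof. by []. Qed.

Lemma lam_linear g : linear (lam g).
Proof. by move=> c xi eta; exact: l2_ext. Qed.

Lemma lamM g h xi : lam (aut_mul g h) xi = lam g (lam h xi).
Proof. exact: l2_ext. Qed.

Lemma lam1 xi : lam (@aut1 X) xi = xi.
Proof. exact: l2_ext. Qed.

Lemma lamK g xi : lam (aut_inv g) (lam g xi) = xi.
Proof. by apply: l2_ext => x; rewrite !lamE /= fwdK. Qed.

Lemma lamVK g xi : lam g (lam (aut_inv g) xi) = xi.
Proof. by apply: l2_ext => x; rewrite !lamE /= bwdK. Qed.

Lemma inner_lam g xi eta : l2_inner (lam g xi) (lam g eta) = l2_inner xi eta.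
Proof.
rewrite !l2_innerE.
exact: (complex_sum_reindex (fun x => xi x * conjc (eta x)) (@bwdK X g) (@fwdK X g)).
Qed.

Lemma lam_adj g xi eta : l2_inner (lam g xi) eta = l2_inner xi (lam (aut_inv g) eta).
Proof. by rewrite -{1}(lamVK g eta) inner_lam. Qed.

Lemma norm_lam g xi : l2_norm (lam g xi) = l2_norm xi.
Proof.
apply/eqP; rewrite -(@eqrXn2 _ 2)// ?norm_ge0//; apply/eqP/(@complexI R).
by rewrite -!inner_normE inner_lam.
Qed.

Lemma lam_delta g x : lam g (delta R x) = delta R (g x).
Proof. by apply: l2_ext => y; rewrite lamE /= (can2_eq (@bwdK X g) (@fwdK X g)). Qed.

Implicit Types s t : seq (R[i] * aut X).

(** Lists with possible repetitions represent the group algebra, so that sums, products and adjoints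
    are plain list operations. *)
Definition comb s : op := fun xi => \sum_(p <- s) p.1 *: lam p.2 xi.

Lemma comb_linear s : linear (comb s).
Proof.
move=> c xi eta; rewrite /comb scaler_sumr -big_split/=.
apply: eq_bigr => p _; rewrite lam_linear scalerDr !scalerA mulrC //.
Qed.

Lemma comb_cat s t : comb (s ++ t) = comb s + comb t.
Proof. by apply/funext => xi; rewrite /comb big_cat. Qed.

Definition comb_scale c s := [seq (c * p.1, p.2) | p <- s].

Lemma comb_scaleE c s : comb (comb_scale c s) = c *: comb s.
Proof.
apply/funext => xi; rewrite -[RHS]/(c *: comb s xi) /comb big_map scaler_sumr.
by apply: eq_bigr => p _; rewrite scalerA.
Qed.

Definition comb_mul s t := [seq (p.1 * q.1, aut_mul p.2 q.2) | p <- s, q <- t].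

Lemma comb_mulE s t : comb (comb_mul s t) = comb s \o comb t.
Proof.
apply/funext => xi; rewrite /comb /= big_allpairs_dep; apply: eq_bigr => p _ /=.
rewrite (lin_sum (@lam_linear p.2)) scaler_sumr; apply: eq_bigr => q _.
by rewrite lamM linZ ?scalerA//; exact: lam_linear.
Qed.

Definition comb_adj s := [seq (conjc p.1, aut_inv p.2) | p <- s].

Lemma comb_adjP s : is_adjoint (comb s) (comb (comb_adj s)).
Proof.
move=> xi eta; rewrite /comb big_map inner_suml inner_sumr.
by apply: eq_bigr => p _; rewrite innerZl innerZr conjcK lam_adj.
Qed.

Lemma comb_bnd s : bounded_by (comb s) (\sum_(p <- s) Normc.normc p.1).
Proof.
move=> xi; apply: le_trans (norm_sum _ _ _) _; rewrite mulr_suml.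
by apply: ler_sum => p _; rewrite normZ norm_lam.
Qed.

Lemma adjoint_sym S T : is_adjoint S T -> is_adjoint T S.
Proof. by move=> h xi eta; rewrite innerC -h -innerC. Qed.

Lemma adjoint_unique S T U : is_adjoint S T -> is_adjoint S U -> T = U.
Proof.
move=> h1 h2; apply/funext => xi; apply: l2_ext => x.
by rewrite -!(inner_delta _ x) (adjoint_sym h1) (adjoint_sym h2).
Qed.

Lemma adjoint_comp S S' T T' : is_adjoint S S' -> is_adjoint T T' ->
  is_adjoint (S \o T) (T' \o S').
Proof. by move=> h1 h2 xi eta; rewrite /= h1 h2. Qed.

Lemma adjoint_linear S T : is_adjoint S T -> linear T.
Proof.
move=> h c xi eta; apply: l2_ext => x; rewrite -!(inner_delta _ x).
by rewrite innerDl innerZl !(adjoint_sym h) innerDl innerZl.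
Qed.

Lemma adjoint_bnd S T M : 0 <= M -> is_adjoint S T -> bounded_by S M -> bounded_by T M.
Proof.
move=> M0 h hS xi; apply: norm_le_inner; first by rewrite mulr_ge0 ?norm_ge0.
move=> eta; rewrite (adjoint_sym h).
apply: le_trans (cauchy_schwarz _ _) _; rewrite -mulrA [leRHS]mulrCA.
by rewrite ler_wpM2l ?norm_ge0.
Qed.

End Operators.

(** * The norm closure of the group algebra is the generated C*-algebra *)

Section Closure.
Variables (R : realType) (X : choiceType) (G : set (aut X)).
Hypothesis Ggrp : subgroup G.
Local Notation H := (l2 R X).
Local Notation op := (H -> H).
Implicit Types (xi eta : H) (c : R[i]) (g h : aut X) (S T : op) (M : R).
Implicit Types s t : seq (R[i] * aut X).

Definition over s := forall p, p \in s -> G p.2.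

Lemma over_cat s t : over s -> over t -> over (s ++ t).
Proof. by move=> hs ht p; rewrite mem_cat => /orP[/hs|/ht]. Qed.

Lemma over_scale c s : over s -> over (comb_scale c s).
Proof. by move=> hs _ /mapP[p /hs ? ->]. Qed.

Lemma over_mul s t : over s -> over t -> over (comb_mul s t).
Proof.
by move=> hs ht _ /allpairsP[[p q] /= [/hs ? /ht ? ->]] /=; case: Ggrp => _ + _; apply.
Qed.

Lemma over_adj s : over s -> over (comb_adj s).
Proof. by move=> hs _ /mapP[p /hs ? ->] /=; case: Ggrp => _ _; apply. Qed.

Variant closed_span T : Prop := InClosedSpan of linear T &
  forall e : R, 0 < e -> exists2 s, over s & bounded_by (T - comb s) e.

Lemma closed_span_approx T e : closed_span T -> 0 < e ->
  exists2 s, over s & bounded_by (T - comb s) e.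
Proof. by case=> _ + e0; apply. Qed.

Lemma bnd0 T M : 0 <= M -> (forall xi, T xi = 0) -> bounded_by T M.
Proof. by move=> M0 h xi; rewrite h norm0 mulr_ge0 ?norm_ge0. Qed.

Lemma bndB_refl T M : 0 <= M -> bounded_by (T - T) M.
Proof. by move=> M0; apply: bnd0 => // xi; rewrite -[LHS]/(T xi - T xi) subrr. Qed.

Lemma closed_span_comb s : over s -> closed_span (comb s).
Proof.
move=> hs; split; first exact: comb_linear.
by move=> e e0; exists s => //; apply: bndB_refl; exact: ltW.
Qed.

Lemma comb1 c g : comb [:: (c, g)] = c *: @lam R X g.
Proof. by apply/funext => xi; rewrite /comb big_seq1. Qed.

Lemma closed_span_lam g : G g -> closed_span (@lam R X g).
Proof.
move=> Gg; have -> : @lam R X g = comb [:: (1, g)] by rewrite comb1 scale1r.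
by apply: closed_span_comb => p; rewrite inE => /eqP ->.
Qed.

Lemma closed_span_id : closed_span id.
Proof.
have -> : id = @lam R X (aut1 X) by apply/funext => xi; rewrite lam1.
by apply: closed_span_lam; case: Ggrp.
Qed.

Lemma closed_span_linear T : closed_span T -> linear T. Proof. by case. Qed.

Lemma comb_bounded s : exists2 M : R, 0 <= M & bounded_by (comb s) M.
Proof.
exists (\sum_(p <- s) Normc.normc p.1); last exact: comb_bnd.
by apply: sumr_ge0 => p _; exact: normc_ge0.
Qed.

Lemma bounded_by_near S T M N : bounded_by (T - S) M -> bounded_by S N -> bounded_by T (M + N).
Proof.
move=> h1 h2 xi; have -> : T xi = (T xi - S xi) + S xi by rewrite subrK.
apply: le_trans (norm_triangle _ _) _; rewrite mulrDl.
exact: lerD (h1 xi) (h2 xi).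
Qed.

Lemma closed_span_bnd T : closed_span T -> exists2 M : R, 0 <= M & bounded_by T M.
Proof.
move=> [_ /(_ 1 ltr01)[s _ hs]]; have [M M0 hM] := comb_bounded s.
by exists (1 + M); [rewrite addr_ge0|exact: bounded_by_near hs hM].
Qed.

Lemma closed_span_bounded T : closed_span T -> bounded_operator T.
Proof.
move=> h; apply/bounded_operatorP; split; first exact: closed_span_linear.
exact: closed_span_bnd.
Qed.

(** Allowing a factor [K] and only errors below 1 fits products: there the error involves the norm
    of an approximant, which is bounded only once the error is. *)
Lemma closed_span_crit T K : linear T -> 0 <= K ->
  (forall e : R, 0 < e -> e <= 1 -> exists2 s, over s & bounded_by (T - comb s) (K * e)) ->
  closed_span T.
Proof.
move=> linT K0 h; split => // e e0.
have K1 : 0 < K + 1 by rewrite ltr_wpDl.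
have m0 : 0 < Num.min 1 (e / (K + 1)) by rewrite lt_min ltr01 divr_gt0.
have [|s os hs] := h _ m0; first by rewrite ge_min lexx.
exists s => //; apply: bounded_by_le hs _.
apply: (@le_trans _ _ (K * (e / (K + 1)))).
  by rewrite ler_wpM2l// ge_min lexx orbT.
rewrite mulrA ler_pdivrMr// mulrC ler_wpM2l ?ltW//; lra.
Qed.

Lemma closed_span_combine c S T : closed_span S -> closed_span T -> closed_span (c *: S + T).
Proof.
move=> [lS hS] [lT hT].
apply: (@closed_span_crit _ (Normc.normc c + 1)); first exact: linear_combine.
  by rewrite addr_ge0// normc_ge0.
move=> e e0 _; have [s os hs] := hS e e0; have [t ot ht] := hT e e0.
exists (comb_scale c s ++ t); first by apply: over_cat => //; exact: over_scale.
rewrite comb_cat comb_scaleE mulrDl mul1r.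
have -> : c *: S + T - (c *: comb s + comb t) = c *: (S - comb s) + (T - comb t).
  by rewrite scalerBr opprD addrACA.
exact: bounded_by_combine.
Qed.

Lemma Cl0 : closed_span 0.
Proof.
have -> : 0 = comb [::] :> op by apply/funext => xi; rewrite /comb big_nil.
exact: closed_span_comb.
Qed.

Lemma closed_span_scale c S : closed_span S -> closed_span (c *: S).
Proof.
move=> h; have -> : c *: S = c *: S + 0 by rewrite addr0.
exact: closed_span_combine h Cl0.
Qed.

Lemma closed_span_add S T : closed_span S -> closed_span T -> closed_span (S + T).
Proof.
move=> hS hT; have -> : S + T = 1 *: S + T by rewrite scale1r.
exact: closed_span_combine.
Qed.

Lemma closed_span_sub S T : closed_span S -> closed_span T -> closed_span (S - T).
Proof.
move=> hS hT; have -> : S - T = -1 *: T + S by rewrite scaleN1r addrC.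
exact: closed_span_combine.
Qed.

Lemma closed_span_sum (I : Type) (r : seq I) (F : I -> op) :
  (forall i, closed_span (F i)) -> closed_span (\sum_(i <- r) F i).
Proof. by move=> h; elim/big_rec : _ => [|i a _ ha]; [exact: Cl0|exact: closed_span_add]. Qed.

Lemma closed_span_comp S T : closed_span S -> closed_span T -> closed_span (S \o T).
Proof.
move=> hS hT; have [M M0 hM] := closed_span_bnd hS; have [N N0 hN] := closed_span_bnd hT.
apply: (@closed_span_crit _ (N + (1 + M))).
- by apply: linear_comp; exact: closed_span_linear.
- by rewrite !addr_ge0.
move=> e e0 e1; have [s os hs] := closed_span_approx hS e0.
have [t ot ht] := closed_span_approx hT e0.
exists (comb_mul s t); first exact: over_mul.
have hs' : bounded_by (comb s) (1 + M).
  by apply: bounded_by_le (bounded_by_near (bounded_by_sym hs) hM) _; rewrite lerD2r.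
rewrite comb_mulE mulrDl; apply: (@bounded_by_trans _ _ _ (comb s \o T)).
  have -> : (S \o T) - (comb s \o T) = (S - comb s) \o T by [].
  by rewrite [N * e]mulrC; exact: bounded_by_comp (ltW e0) hs hN.
have -> : (comb s \o T) - (comb s \o comb t) = comb s \o (T - comb t).
  by apply/funext => xi; rewrite /= -[LHS]/(comb s _ - comb s _) -(linB (@comb_linear _ _ s)).
by apply: bounded_by_comp hs' ht; rewrite addr_ge0.
Qed.

Lemma adjointB S S' T T' : is_adjoint S S' -> is_adjoint T T' ->
  is_adjoint (S - T : op) (S' - T').
Proof.
move=> h1 h2 xi eta; rewrite -[(S - T) xi]/(S xi - T xi) -[(S' - T') eta]/(S' eta - T' eta).
by rewrite innerBl innerBr h1 h2.
Qed.

Lemma closed_span_adj S T : closed_span S -> is_adjoint S T -> closed_span T.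
Proof.
move=> [lS hS] h; split; first exact: adjoint_linear h.
move=> e e0; have [s os hs] := hS e e0; exists (comb_adj s); first exact: over_adj.
apply: adjoint_bnd hs; first exact: ltW.
by apply: adjointB => //; exact: comb_adjP.
Qed.

Lemma closed_span_closed T : linear T ->
  (forall e : R, 0 < e -> exists2 S, closed_span S & bounded_by (T - S) e) -> closed_span T.
Proof.
move=> linT h; apply: (@closed_span_crit _ 2) => // e e0 _.
have [S [_ /(_ e e0)[s os hs]] hS] := h e e0; exists s => //.
have -> : 2 * e = e + e by ring.
exact: bounded_by_trans hS hs.
Qed.

Lemma small_eq0 (K a : R) : 0 <= a -> (forall m, a <= K / 2 ^+ m) -> a = 0.
Proof.
move=> a0 h; apply/eqP; rewrite eq_le a0 andbT.
by apply: (cvgr_to_ge (geometric_cvg0 K)); exact: nearW.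
Qed.

Lemma small_l2_eq0 (K : R) xi : (forall m, l2_norm xi <= K / 2 ^+ m) -> xi = 0.
Proof. by move=> /small_eq0 h; apply/norm_eq0/h/norm_ge0. Qed.

(** The pointwise limits given by [l2_complete] inherit a rate uniform on the unit ball, so
    linearity and membership pass to the limit. *)
Lemma closed_span_lim (C : R) (u : nat -> op) : 0 <= C -> (forall n, closed_span (u n)) ->
  (forall m n, (m <= n)%N -> bounded_by (u n - u m) (C / 2 ^+ m)) ->
  exists2 T, closed_span T & forall m, bounded_by (T - u m) (C / 2 ^+ m).
Proof.
move=> C0 hu h.
have ex xi : exists zeta : H, forall m, l2_norm (zeta - u m xi) <= C * l2_norm xi / 2 ^+ m.
  apply: l2_complete; first by rewrite mulr_ge0 ?norm_ge0.
  by move=> m n mn; apply: le_trans (h m n mn xi) _; rewrite mulrAC.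
have [T hT] := choice ex.
have hT' m : bounded_by (T - u m) (C / 2 ^+ m).
  by move=> xi; apply: le_trans (hT xi m) _; rewrite mulrAC.
exists T => //; apply: closed_span_closed.
  move=> c xi eta; apply/eqP; rewrite -subr_eq0; apply/eqP.
  pose K := C * l2_norm (c *: xi + eta) +
            (Normc.normc c * (C * l2_norm xi) + C * l2_norm eta).
  apply: (@small_l2_eq0 K) => m.
  have -> : T (c *: xi + eta) - (c *: T xi + T eta) =
     (T (c *: xi + eta) - u m (c *: xi + eta)) - (c *: (T xi - u m xi) + (T eta - u m eta)).
    rewrite (closed_span_linear (hu m)); apply: l2_ext => x.
    by rewrite !(l2D, l2N, l2Z); ring.
  apply: le_trans (norm_triangleB _ _) _; rewrite /K mulrDl; apply: lerD; first exact: hT.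
  apply: le_trans (norm_triangle _ _) _; rewrite mulrDl; apply: lerD; last exact: hT.
  by rewrite normZ -mulrA ler_wpM2l ?normc_ge0.
move=> e e0.
have /cvgrPdist_lt /(_ e e0) [m _ hm] := geometric_cvg0 C.
exists (u m) => //; apply: bounded_by_le (hT' m) _.
have := hm m (leqnn m); rewrite /= sub0r normrN => /ltW; apply: le_trans.
exact: ler_norm.
Qed.

(** Taking adjoints preserves norm bounds, so the adjoints of approximating combinations form a
    Cauchy sequence, whose limit is the adjoint. It lies in the algebra by construction. *)
Lemma closed_span_adjoint S : closed_span S -> exists2 T, closed_span T & is_adjoint S T.
Proof.
move=> hS.
have p2 n : (0 : R) < 2 ^+ n by rewrite exprn_gt0.
(* The extra factor 1/2 lets two errors add up to [1 / 2 ^+ m]. *)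
have ex (n : nat) : exists s, over s /\ bounded_by (S - comb s) (2^-1 / 2 ^+ n).
  have [|s os hs] := @closed_span_approx S (2^-1 / 2 ^+ n) hS; first by rewrite divr_gt0.
  by exists s.
have [s hs] := choice ex.
have hs2 m n : (m <= n)%N -> bounded_by (comb (s n) - comb (s m)) (1 / 2 ^+ m).
  move=> mn; apply: bounded_by_le (bounded_by_trans (bounded_by_sym (hs n).2) (hs m).2) _.
  have le : 2^-1 / 2 ^+ n <= 2^-1 / 2 ^+ m :> R.
    by rewrite ler_wpM2l// lef_pV2 ?posrE// ler_weXn2l// ler1n.
  have -> : 1 / 2 ^+ m = 2^-1 / 2 ^+ m + 2^-1 / 2 ^+ m :> R.
    by rewrite -mulrDl; congr (_ / _); field.
  exact: lerD.
have [|n|m n mn|T ClT hT] := @closed_span_lim 1 (fun n => comb (comb_adj (s n))).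
- by [].
- by apply: closed_span_comb; apply: over_adj; case: (hs n).
- apply: adjoint_bnd (hs2 _ _ mn); first by rewrite divr_ge0// ltW.
  by apply: adjointB; exact: comb_adjP.
exists T => // xi eta; apply/eqP; rewrite -subr_eq0; apply/eqP/(@Normc.eq0_normc R).
apply: (@small_eq0 (2 * (l2_norm xi * l2_norm eta))); first exact: normc_ge0.
move=> m.
have -> : l2_inner (S xi) eta - l2_inner xi (T eta) =
    l2_inner (S xi - comb (s m) xi) eta - l2_inner xi (T eta - comb (comb_adj (s m)) eta).
  by rewrite innerBl innerBr comb_adjP; ring.
apply: le_trans (le_normcD _ _) _; rewrite normcN.
have -> (a : R) : 2 * a / 2 ^+ m = a / 2 ^+ m + a / 2 ^+ m.
  by rewrite -mulrDl; congr (_ / _); ring.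
apply: lerD.
  apply: le_trans (cauchy_schwarz _ _) _.
  rewrite mulrAC ler_wpM2r ?norm_ge0//; apply: le_trans ((hs m).2 xi) _.
  by rewrite [leRHS]mulrC ler_wpM2r ?norm_ge0// ler_piMl ?invr_ge0 ?(ltW (p2 m))//; lra.
apply: le_trans (cauchy_schwarz _ _) _.
rewrite -!mulrA ler_wpM2l ?norm_ge0//; apply: le_trans (hT m eta) _.
by rewrite mul1r mulrC.
Qed.

Lemma closed_span_cstar : cstar_algebra closed_span.
Proof.
split.
- exact: closed_span_bounded.
- by split; [exact: Cl0|move=> c S T; exact: closed_span_combine].
- exact: closed_span_comp.
- exact: closed_span_adj.
move=> T bT h; apply: closed_span_closed; first by case: bT.
move=> e e0; have [S ClS hS] := h e e0; exists S => //.
apply: bounded_by_le (op_norm_bnd _) (ltW hS); apply/bounded_operatorP; split.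
  rewrite (_ : T - S = -1 *: S + T); last by rewrite scaleN1r addrC.
  by apply: linear_combine; [exact: closed_span_linear|case: bT].
have [M M0 hM] := closed_span_bnd ClS; case/bounded_operatorP : bT => _ [N N0 hN].
exists (Normc.normc (-1 : R[i]) * M + N); first by rewrite addr_ge0// mulr_ge0// normc_ge0.
rewrite (_ : T - S = -1 *: S + T); last by rewrite scaleN1r addrC.
exact: bounded_by_combine.
Qed.

(** The closed span is a C*-algebra containing [E], and any other one contains all combinations and
    their norm limits. *)
Lemma cstar_generated_lam (E : set op) :
  (forall U, E U <-> exists2 g, G g & U = @lam R X g) -> cstar_generated E = closed_span.
Proof.
move=> hE; apply/seteqP; split => [T|T ClT B [[Bb [B0 Bl] _ _ Bc] EB]].
  by apply; split; [exact: closed_span_cstar|move=> U /hE[g Gg ->]; exact: closed_span_lam].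
have Bcomb s : over s -> B (comb s).
  elim: s => [_|p s IH os].
    by rewrite (_ : comb [::] = 0)//; apply/funext => xi; rewrite /comb big_nil.
  have -> : comb (p :: s) = p.1 *: @lam R X p.2 + comb s.
    by apply/funext => xi; rewrite /comb big_cons.
  apply: Bl; first by apply/EB/hE; exists p.2 => //; apply: os; rewrite mem_head.
  by apply: IH => q qs; apply: os; rewrite inE qs orbT.
apply: Bc; first exact: closed_span_bounded.
move=> e e0; have [s os hs] := closed_span_approx ClT (divr_gt0 e0 (ltr0Sn R 1)).
exists (comb s); first exact: Bcomb.
apply: le_lt_trans (op_norm_le _ hs) _; first by rewrite ltW// divr_gt0.
by rewrite ltr_pdivrMr// ltr_pMr// ltr1n.
Qed.

End Closure.

(** * Inverse square roots of operators near the identity *)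

Section InverseSquareRoot.
Variables (R : realType) (X : choiceType) (G : set (aut X)).
Hypothesis Ggrp : subgroup G.
Local Notation H := (l2 R X).
Local Notation op := (H -> H).
Local Notation Cl := (@closed_span R X G).
Implicit Types (xi eta : H) (S T y z : op).

Lemma bounded_by_add S T (M N : R) : bounded_by S M -> bounded_by T N -> bounded_by (S + T) (M + N).
Proof.
move=> hS hT xi; rewrite -[(S + T) xi]/(S xi + T xi) mulrDl.
by apply: le_trans (norm_triangle _ _) _; exact: lerD (hS xi) (hT xi).
Qed.

Lemma bounded_by_sub S T (M N : R) : bounded_by S M -> bounded_by T N -> bounded_by (S - T) (M + N).
Proof.
move=> hS hT xi; rewrite -[(S - T) xi]/(S xi - T xi) mulrDl.
by apply: le_trans (norm_triangleB _ _) _; exact: lerD (hS xi) (hT xi).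
Qed.

Lemma bounded_by_half S (M : R) : bounded_by S M -> bounded_by ((2^-1)%:C *: S) (2^-1 * M).
Proof.
move=> hS xi; rewrite -[(_ *: S) xi]/((2^-1)%:C *: S xi) normZ normcR ?invr_ge0//.
by rewrite -mulrA ler_wpM2l ?invr_ge0.
Qed.

Lemma bounded_by_eq (K : R) S T : (forall m, bounded_by (S - T) (K / 2 ^+ m)) -> S = T.
Proof.
move=> h; apply/funext => xi; apply/eqP; rewrite -subr_eq0; apply/eqP.
apply: (@small_l2_eq0 _ _ (K * l2_norm xi)) => m.
by have := h m xi; rewrite mulrAC.
Qed.

Lemma bounded_by_geometric (C : R) (u : nat -> op) :
  (forall n, bounded_by (u n.+1 - u n) (C / 2 ^+ n)) ->
  forall m n, (m <= n)%N -> bounded_by (u n - u m) (2 * C / 2 ^+ m).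
Proof.
move=> h m n mn.
have C0 xi : 0 <= C * l2_norm xi.
  by have := h 0%N xi; rewrite expr0 divr1; apply: le_trans; exact: norm_ge0.
(* The bound is sharpened by the remaining tail of the geometric series, which makes the induction
   on [k] close. *)
suff step k : bounded_by (u (m + k)%N - u m) (2 * C / 2 ^+ m - 2 * C / 2 ^+ (m + k)).
  rewrite -(subnKC mn) => xi; apply: le_trans (step (n - m)%N xi) _.
  rewrite mulrBl lerBlDr lerDl mulrAC -[2 * C * _]mulrA.
  by apply: divr_ge0; rewrite ?exprn_ge0// mulr_ge0.
elim: k => [|k IH]; first by rewrite addn0 [_ / _ - _]subrr; exact: bndB_refl.
rewrite addnS; apply: bounded_by_le (bounded_by_trans (h (m + k)%N) IH) _.
rewrite exprS le_eqVlt; apply/orP; left; apply/eqP.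
by field; rewrite !expf_neq0.
Qed.

Section FixedPoint.
Variable x : op.
Hypothesis Clx : Cl x.
Hypothesis adjx : is_adjoint x x.
Hypothesis bndx : bounded_by x 10^-1.

(* For d = 1 - y the equation d (1 - x) d = 1 reads y = (y^2 - (1 - y) x (1 - y)) / 2,
   and the right-hand side is a contraction on a small ball when x is small. *)
Definition sqrt_step y : op :=
  (2^-1)%:C *: ((y \o y) - ((id - y) \o x \o (id - y))).

Lemma sqrt_stepE y xi : sqrt_step y xi =
  (2^-1)%:C *: (y (y xi) - (x (xi - y xi) - y (x (xi - y xi)))).
Proof. by []. Qed.

Lemma closed_span_step y : Cl y -> Cl (sqrt_step y).
Proof.
move=> Cly; have Cl1y : Cl (id - y) by apply: closed_span_sub => //; exact: closed_span_id.
apply: closed_span_scale => //; apply: closed_span_sub => //; first exact: closed_span_comp.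
by apply: closed_span_comp => //; apply: closed_span_comp.
Qed.

Lemma adjoint_half S T : is_adjoint S T -> is_adjoint ((2^-1)%:C *: S) ((2^-1)%:C *: T).
Proof.
move=> h xi eta; rewrite -[(_ *: S) xi]/(_ *: S xi) -[(_ *: T) eta]/(_ *: T eta).
by rewrite innerZl innerZr conjc_real h.
Qed.

Lemma adj_step y : is_adjoint y y -> is_adjoint (sqrt_step y) (sqrt_step y).
Proof.
move=> h; have h1 : is_adjoint (id - y) (id - y) by apply: adjointB.
apply: adjoint_half; apply: adjointB; first exact: adjoint_comp.
exact: (adjoint_comp (adjoint_comp h1 adjx) h1).
Qed.

Lemma bounded_by_id_sub y (M : R) : bounded_by y M -> bounded_by (id - y) (1 + M).
Proof. by move=> h; apply: bounded_by_sub => // xi; rewrite mul1r. Qed.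

Lemma bounded_by_step y : bounded_by y 10^-1 -> bounded_by (sqrt_step y) 10^-1.
Proof.
move=> h; have h1 := bounded_by_id_sub h.
have i0 : 0 <= 10^-1 :> R by rewrite invr_ge0.
have j0 : 0 <= 1 + 10^-1 :> R by rewrite addr_ge0.
have := bounded_by_half (bounded_by_sub (bounded_by_comp i0 h h)
  (bounded_by_comp (mulr_ge0 j0 i0) (bounded_by_comp j0 h1 bndx) h1)).
by move/bounded_by_le; apply; lra.
Qed.

(** On the ball of radius 3/10 the factor is (0.3 + 0.3 + 1.3 * 0.1 + 1.3 * 0.1) / 2 = 0.43. The
    iterates stay in the ball of radius 1/10, but the estimates only place their limit in the ball
    of radius 2/10 + 1/10. *)
Lemma step_lipschitz y z (D : R) : 0 <= D -> linear y -> linear z ->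
  bounded_by y (3 / 10) -> bounded_by z (3 / 10) ->
  bounded_by (y - z) D -> bounded_by (sqrt_step y - sqrt_step z) (2^-1 * D).
Proof.
move=> D0 ly lz hy hz hD.
have E : sqrt_step y - sqrt_step z = (2^-1)%:C *:
    (((y \o (y - z)) + ((y - z) \o z)) +
     (((id - y) \o x \o (y - z)) + ((y - z) \o x \o (id - z)))).
  apply/funext => xi; rewrite -[LHS]/(sqrt_step y xi - sqrt_step z xi) !sqrt_stepE.
  rewrite -[RHS]/((2^-1)%:C *: (y (y xi - z xi) + (y (z xi) - z (z xi)) +
    ((x (y xi - z xi) - y (x (y xi - z xi))) +
     (y (x (xi - z xi)) - z (x (xi - z xi)))))).
  have lx := closed_span_linear Clx.
  rewrite -scalerBr !(linB lx) !(linB ly) !(linB lz); congr (_ *: _).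
  by apply: l2_ext => p; rewrite !(l2D, l2N); ring.
have i0 : 0 <= 10^-1 :> R by rewrite invr_ge0.
have k0 : 0 <= 3 / 10 :> R by rewrite divr_ge0.
have j0 : 0 <= 1 + 3 / 10 :> R by rewrite addr_ge0.
have hy1 := bounded_by_id_sub hy; have hz1 := bounded_by_id_sub hz.
have := bounded_by_half (bounded_by_add
  (bounded_by_add (bounded_by_comp k0 hy hD) (bounded_by_comp D0 hD hz))
  (bounded_by_add (bounded_by_comp (mulr_ge0 j0 i0) (bounded_by_comp j0 hy1 bndx) hD)
           (bounded_by_comp (mulr_ge0 D0 i0) (bounded_by_comp D0 hD bndx) hz1))).
by rewrite E => /bounded_by_le; apply; lra.
Qed.

Lemma inverse_sqrt_fixpoint :
  exists d : op, [/\ Cl d, is_adjoint d d & d \o (id - x) \o d = id].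
Proof.
pose u n := iter n sqrt_step (0 : op).
have Clu n : Cl (u n) by elim: n => [|n IH]; [exact: Cl0|exact: closed_span_step].
have adju n : is_adjoint (u n) (u n).
  elim: n => [|n IH]; last exact: adj_step.
  by move=> xi eta; rewrite /= inner0l inner0r.
have bu n : bounded_by (u n) 10^-1.
  by elim: n => [|n IH]; [apply: bnd0; rewrite ?invr_ge0|exact: bounded_by_step].
have le10 : 10^-1 <= 3 / 10 :> R by lra.
have i0 : 0 <= 10^-1 :> R by rewrite invr_ge0.
have bu' n : bounded_by (u n) (3 / 10) by exact: bounded_by_le (bu n) le10.
have du n : bounded_by (u n.+1 - u n) (10^-1 / 2 ^+ n).
  elim: n => [|n IH].
    rewrite expr0 divr1 => xi; have := bu 1%N xi.
    by rewrite -[(_ - _) xi]/(u 1%N xi - 0) subr0.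
  have e0 : 0 <= 10^-1 / 2 ^+ n :> R by rewrite divr_ge0// exprn_ge0.
  have := step_lipschitz e0 (closed_span_linear (Clu n.+1))
    (closed_span_linear (Clu n)) (bu' _) (bu' _) IH.
  by move/bounded_by_le; apply; rewrite exprS invfM mulrCA.
have gu := bounded_by_geometric du.
have C0 : 0 <= 2 * 10^-1 :> R by rewrite mulr_ge0.
have [y Cly hy] := closed_span_lim C0 Clu gu.
have Cl1 : Cl id by exact: closed_span_id.
have by3 : bounded_by y (3 / 10).
  have := bounded_by_near (hy 0%N) (bu 0%N); rewrite expr0 divr1.
  by move/bounded_by_le; apply; lra.
have adjy : is_adjoint y y.
  (* The adjoint of [y] is approximated by the same self-adjoint iterates as [y], hence equals
     [y]. *)
  have [y' Cly' hy'] := closed_span_adjoint Ggrp Cly.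
  suff E : y' = y by rewrite E in hy'.
  apply: (@bounded_by_eq (2 * (2 * 10^-1))) => m.
  have p0 : 0 <= 2 * 10^-1 / 2 ^+ m :> R by rewrite divr_ge0 ?exprn_ge0.
  have h1 : bounded_by (y' - u m) (2 * 10^-1 / 2 ^+ m).
    by apply: adjoint_bnd p0 _ (hy m); exact: adjointB.
  have := bounded_by_trans h1 (bounded_by_sym (hy m)); move/bounded_by_le; apply.
  by rewrite -mulrDl le_eqVlt; apply/orP; left; apply/eqP; congr (_ / _); ring.
have fixy : sqrt_step y = y.
  apply: (@bounded_by_eq (2 * (2 * 10^-1))) => m.
  have p0 : 0 <= 2 * 10^-1 / 2 ^+ m :> R by rewrite divr_ge0 ?exprn_ge0.
  have h1 := step_lipschitz p0 (closed_span_linear Cly)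
    (closed_span_linear (Clu m)) by3 (bu' m) (hy m).
  have := bounded_by_trans h1 (bounded_by_sym (hy m.+1)); move/bounded_by_le; apply.
  have : 0 <= (2 ^+ m)^-1 :> R by rewrite invr_ge0 exprn_ge0.
  by rewrite [2 ^+ m.+1]exprS invfM; set a := (2 ^+ m)^-1; lra.
exists (id - y); split.
- exact: closed_span_sub.
- exact: adjointB.
(* The fixed point equation says 2 y = y^2 - (1 - y) x (1 - y), so that (1 - y) (1 - x) (1 - y) = 1
   - 2 y + y^2 - (1 - y) x (1 - y) = 1. *)
apply/funext => xi; have := congr1 (fun f : op => f xi) fixy.
rewrite sqrt_stepE => h.
rewrite -[LHS]/(((xi - y xi) - x (xi - y xi)) - y ((xi - y xi) - x (xi - y xi))).
have ly := closed_span_linear Cly.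
have {}h : y (y xi) - (x (xi - y xi) - y (x (xi - y xi))) = y xi + y xi.
  have -> : y xi + y xi = (2%:R : R[i]) *: ((2^-1)%:C *:
      (y (y xi) - (x (xi - y xi) - y (x (xi - y xi))))).
    by rewrite h scaler_nat mulr2n.
  rewrite scalerA.
  have -> : 2%:R * (2^-1)%:C = 1 :> R[i].
    by rewrite -(rmorph_nat (real_complex R)) -rmorphM/= divff.
  by rewrite scale1r.
rewrite !(linB ly).
have {}h : y (y xi) + y (x (xi - y xi)) - x (xi - y xi) = y xi + y xi.
  by rewrite -h; apply: l2_ext => p; rewrite !(l2D, l2N); ring.
apply: l2_ext => p; have := congr1 (fun f : H => f p) h; rewrite !(l2D, l2N) => hp.
transitivity (xi p + ((y (y xi) p + y (x (xi - y xi)) p - x (xi - y xi) p)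
  - (y xi p + y xi p))); first by ring.
by rewrite hp subrr addr0.
Qed.

End FixedPoint.

(** Here [d] plays the part of k^(-1/2). It turns an almost isometric [w] into an isometry: with k =
    w^* w, the product w d satisfies d w^* w d = 1. *)
Lemma inverse_sqrt (k : op) : Cl k -> is_adjoint k k -> bounded_by (k - id) 10^-1 ->
  exists d : op, [/\ Cl d, is_adjoint d d & d \o k \o d = id].
Proof.
move=> Clk ak bk; have Cl1 : Cl id by exact: closed_span_id.
have [||| d [Cld ad hd]] := @inverse_sqrt_fixpoint (id - k).
- exact: closed_span_sub.
- exact: adjointB.
- exact: bounded_by_sym.
exists d; split => //; rewrite -[RHS]hd; congr (_ \o _ \o _).
by apply/funext => xi; rewrite -[RHS]/(xi - (xi - k xi)) opprB addrC subrK.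
Qed.

End InverseSquareRoot.

(** * Isometries with small range *)

Section DisjointSupports.
Variables (R : realType) (X : choiceType).
Local Notation H := (l2 R X).
Implicit Types (xi eta : H) (D : set X).

Lemma restr_subproof D xi :
  (fun x => if x \in D then xi x else 0) \in @square_summable R X.
Proof.
apply/square_summableP; apply: abs_summable_le (l2_summable xi) => x.
by case: ifP => // _; rewrite /sqnormc /= expr0n/= addr0 normr0.
Qed.

Definition restr D xi : H := L2 (restr_subproof D xi).

Lemma restrE D xi x : restr D xi x = if x \in D then xi x else 0.
Proof. by []. Qed.

Lemma inner_restr D xi eta : l2_inner (restr D xi) eta = l2_inner xi (restr D eta).
Proof.
rewrite !l2_innerE; congr complex_sum; apply/funext => x; rewrite !restrE.
by case: ifP => // _; rewrite conjc0 mul0r mulr0.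
Qed.

Lemma norm_restr D xi : l2_norm (restr D xi) <= l2_norm xi.
Proof.
apply: norm_le_seq; first exact: norm_ge0.
move=> s us; apply: le_trans (norm_ge_seq xi us); apply: ler_sum => x _.
rewrite restrE; case: ifP => // _.
by rewrite /sqnormc /= expr0n/= addr0 addr_ge0 ?sqr_ge0.
Qed.

Lemma restr_split D xi : xi = restr D xi + restr (~` D) xi.
Proof.
apply: l2_ext => x; rewrite l2D !restrE in_setC.
by case: (x \in D); rewrite ?addr0 ?add0r.
Qed.

(** Orthogonality makes the norm grow like the square root of [n] only. [N] is any upper bound of
    that root, so that the constants can stay rational. *)
Lemma norm_sum_disjoint (n : nat) (D : 'I_n -> set X) (zeta : 'I_n -> H) (N a : R) :
  (forall i j x, i != j -> D i x -> ~ D j x) ->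
  (forall i x, ~ D i x -> zeta i x = 0) ->
  0 <= N -> 0 <= a -> n%:R <= N ^+ 2 -> (forall i, l2_norm (zeta i) <= a) ->
  l2_norm (\sum_i zeta i) <= N * a.
Proof.
move=> hD hz N0 a0 nN ha; rewrite -(@ler_pXn2r _ 2)// ?nnegrE ?norm_ge0 ?mulr_ge0//.
rewrite norm_pythagoras => [|i j ij]; last first.
  apply: inner_disjoint => x; have [Dx|Dx] := pselect (D i x).
    by right; apply: hz; exact: hD ij Dx.
  by left; exact: hz.
apply: (@le_trans _ _ (\sum_(i < n) a ^+ 2)).
  by apply: ler_sum => i _; rewrite ler_pXn2r// ?nnegrE ?norm_ge0.
rewrite sumr_const card_ord -mulr_natl exprMn.
by rewrite ler_wpM2r// sqr_ge0.
Qed.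

(* Powers' averaging estimate: the part of [lam (v i) xi] inside [D i] and the
   adjoint of the part outside it have ranges with disjoint supports. *)
Lemma powers_estimate (n : nat) (D : 'I_n -> set X) (v : 'I_n -> aut X) (N : R) xi eta :
  (forall i j x, i != j -> D i x -> ~ D j x) ->
  (forall i x, ~ D i x -> D i (v i x)) ->
  0 <= N -> n%:R <= N ^+ 2 ->
  Normc.normc (\sum_i l2_inner (lam (v i) xi) eta) <= 2 * N * (l2_norm xi * l2_norm eta).
Proof.
move=> hD hv N0 nN.
have E i : l2_inner (lam (v i) xi) eta =
    l2_inner (restr (D i) (lam (v i) xi)) eta +
    l2_inner xi (restr (D i) (lam (aut_inv (v i)) (restr (~` D i) eta))).
  rewrite {1}(restr_split (D i) (lam (v i) xi)) innerDl; congr (_ + _).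
  rewrite -(inner_restr (D i) xi) -(lam_adj (v i) (restr (D i) xi)).
  rewrite -(inner_restr (~` D i) (lam (v i) (restr (D i) xi))).
  (* A point outside [D i] is the image under [v i] of a point of [D i], so only the part of [xi] on
     [D i] contributes there. *)
  suff -> : restr (~` D i) (lam (v i) xi) =
    restr (~` D i) (lam (v i) (restr (D i) xi)) by [].
  apply: l2_ext => x; rewrite !restrE in_setC !lamE restrE.
  case: (pselect (D i x)) => [Dx|nD]; first by rewrite mem_set.
  rewrite (memNset nD) /= mem_set//; apply: contrapT => h; apply: nD.
  by have := hv i _ h; rewrite bwdK.
rewrite (eq_bigr _ (fun i _ => E i)) big_split/= -inner_suml -inner_sumr.
apply: le_trans (le_normcD _ _) _.
have -> : 2 * N * (l2_norm xi * l2_norm eta) =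
  N * l2_norm xi * l2_norm eta + l2_norm xi * (N * l2_norm eta) by ring.
apply: lerD; apply: le_trans (cauchy_schwarz _ _) _.
  rewrite ler_wpM2r ?norm_ge0//; apply: (norm_sum_disjoint hD) => //.
  - by move=> i x Dx; rewrite restrE memNset.
  - exact: norm_ge0.
  - by move=> i; apply: le_trans (norm_restr _ _) _; rewrite norm_lam.
rewrite ler_wpM2l ?norm_ge0//; apply: (norm_sum_disjoint hD) => //.
- by move=> i x Dx; rewrite restrE memNset.
- exact: norm_ge0.
- by move=> i; apply: le_trans (norm_restr _ _) _; rewrite norm_lam norm_restr.
Qed.

End DisjointSupports.

Lemma normc_conj (R : realType) (z : R[i]) : Normc.normc (conjc z) = Normc.normc z.
Proof. by case: z => a b; rewrite /conjc /= sqrrN. Qed.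

Lemma conjc_sum (R : realType) (I : Type) (r : seq I) (P : pred I) (F : I -> R[i]) :
  conjc (\sum_(i <- r | P i) F i) = \sum_(i <- r | P i) conjc (F i).
Proof. by apply: big_morph => [a b|]; [exact: conjcD|exact: conjc0]. Qed.

Section Isometry.
Variables (R : realType) (X : choiceType) (G : set (aut X)).
Hypothesis Ggrp : subgroup G.
Local Notation H := (l2 R X).
Local Notation op := (H -> H).
Local Notation Cl := (@closed_span R X G).
Implicit Types (xi eta : H).

Lemma closed_span_lam_sum n (g h : 'I_n -> aut X) (S : op) (c : R[i]) :
  (forall i, G (g i)) -> (forall i, G (h i)) -> Cl S ->
  Cl (fun xi => c *: \sum_i lam (g i) (S (lam (h i) xi))).
Proof.
move=> hg hh ClS.
have -> : (fun xi => c *: \sum_i lam (g i) (S (lam (h i) xi))) =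
   c *: (\sum_i (@lam R X (g i) \o S \o @lam R X (h i)) : op).
  apply/funext => xi; rewrite -[RHS]/(c *: (\sum_i _ : op) xi); congr (_ *: _).
  by elim/big_rec2 : _ => // i y1 y2 _ ->.
apply: closed_span_scale => //; apply: closed_span_sum => i; apply: closed_span_comp => //;
  last exact: closed_span_lam.
by apply: closed_span_comp => //; exact: closed_span_lam.
Qed.

(* With n = 2 M^2 and S = lam u - 1, the operator (2 M)^-1 sum_i lam (k i) S lam (h i)^-1
   is almost isometric: Powers' estimate bounds its defect by 2 / M = 1 / 10.
   M is a variable only to keep the unary number 800 from being computed. *)
Lemma powers_isometry (M : nat) (u : aut X) (h k : 'I_(2 * M * M) -> aut X)
    (D E : 'I_(2 * M * M) -> set X) (A Z : set X) :
  M = 20%N ->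
  G u -> (forall i, G (h i)) -> (forall i, G (k i)) ->
  (forall x, A x -> u x = x) ->
  (forall i j x, i != j -> D i x -> ~ D j x) ->
  (forall i j x, i != j -> E i x -> ~ E j x) ->
  (forall i x, ~ D i (h i x) -> D i (h i (u x))) ->
  (forall i x, ~ A x -> E i (k i x)) ->
  (forall i x, E i x -> ~ Z x) ->
  exists t t' : op, [/\ Cl t, Cl t', is_adjoint t t', t' \o t = id &
    forall xi x, Z x -> t xi x = 0].
Proof.
move=> M20 Gu Gh Gk uA hD hE hu hk hZ.
set n := (2 * M * M)%N in h k D E Gh Gk hD hE hu hk hZ *.
have MR : M%:R = 20 :> R by rewrite M20.
have nR : n%:R = 800 :> R by rewrite /n !natrM MR; lra.
pose S : op := @lam R X u - id.
have SE xi : S xi = lam u xi - xi by [].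
have ClS : Cl S by apply: closed_span_sub => //; [exact: closed_span_lam|exact: closed_span_id].
pose F i xi := lam (k i) (S (lam (aut_inv (h i)) xi)).
pose w (xi : H) : H := (40^-1)%:C *: \sum_i F i xi.
have Clw : Cl w.
  by apply: closed_span_lam_sum => // i; case: Ggrp => _ _; apply.
(* Vectors in the range of [S] vanish on [A], where [u] is the identity, and [k i] sends the
   complement of [A] into [E i]. *)
have Fsupp i xi x : ~ E i x -> F i xi x = 0.
  move=> nE; rewrite lamE SE l2B lamE.
  have Ax : A (bwd (k i) x).
    by apply: contrapT => /(hk i); rewrite bwdK.
  have -> : bwd u (bwd (k i) x) = bwd (k i) x by rewrite -{1}(uA _ Ax) fwdK.
  by rewrite subrr.
have wZ xi x : Z x -> w xi x = 0.
  move=> Zx; rewrite l2Z l2_sum big1 ?mulr0// => i _; apply: Fsupp.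
  by move/hZ.
pose v i := aut_mul (h i) (aut_mul u (aut_inv (h i))).
have hv i x : ~ D i x -> D i (v i x).
  by move=> nD; apply: (hu i (bwd (h i) x)); rewrite bwdK.
(* This is S^* S = 2 - u - u^* conjugated by [h i]; the unitary [k i] drops out. *)
have innerF i xi eta : l2_inner (F i xi) (F i eta) =
    2 * l2_inner xi eta - (l2_inner (lam (v i) xi) eta + conjc (l2_inner (lam (v i) eta) xi)).
  have E1 : l2_inner (lam (v i) xi) eta =
      l2_inner (lam u (lam (aut_inv (h i)) xi)) (lam (aut_inv (h i)) eta).
    by rewrite !lamM lam_adj.
  have E2 : conjc (l2_inner (lam (v i) eta) xi) =
      l2_inner (lam (aut_inv (h i)) xi) (lam u (lam (aut_inv (h i)) eta)).
    by rewrite -innerC !lamM -(inner_lam (aut_inv (h i)) xi) lamK.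
  rewrite E1 E2 inner_lam !SE innerBl !innerBr !inner_lam; ring.
have innerw xi eta : l2_inner (w xi) (w eta) = l2_inner xi eta -
   (40^-1)%:C * ((40^-1)%:C * (\sum_i l2_inner (lam (v i) xi) eta +
                  conjc (\sum_i l2_inner (lam (v i) eta) xi))).
  rewrite innerZl innerZr conjc_real inner_suml.
  (* Only diagonal terms survive, the [E i] being disjoint. The leading term is then 800 * 2 / 40^2
     = 1. *)
  rewrite (eq_bigr (fun i => 2 * l2_inner xi eta - (l2_inner (lam (v i) xi) eta +
      conjc (l2_inner (lam (v i) eta) xi)))); last first.
    move=> i _; rewrite inner_sumr (bigD1 i)//= big1 ?addr0 => [|j ji]; first exact: innerF.
    apply: inner_disjoint => x; have [Ex|Ex] := pselect (E i x).
      by right; apply: Fsupp; apply: hE Ex; rewrite eq_sym.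
    by left; exact: Fsupp.
  rewrite sumrB sumr_const card_ord big_split/= -conjc_sum.
  set a := l2_inner xi eta; set p := \sum_i l2_inner (lam (v i) xi) eta; set q := conjc _.
  have nC : n%:R = 800 :> R[i] by rewrite /n !natrM M20; ring.
  have -> : (40^-1)%:C = 40^-1 :> R[i] by rewrite fmorphV rmorph_nat.
  rewrite -[_ *+ n]mulr_natl nC; field; rewrite // pnatr_eq0.
have [w' Clw' adjw] := closed_span_adjoint Ggrp Clw.
have Clk : Cl (w' \o w) by exact: closed_span_comp.
have adjk : is_adjoint (w' \o w) (w' \o w).
  exact: adjoint_comp (adjoint_sym adjw) adjw.
have bndk : bounded_by ((w' \o w) - id) 10^-1.
  move=> xi; rewrite -[(_ - _) xi]/(w' (w xi) - xi).
  apply: norm_le_inner => [|eta]; first by rewrite mulr_ge0 ?invr_ge0 ?norm_ge0.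
  rewrite innerBl (adjoint_sym adjw) innerw addrC addrA addNr add0r.
  rewrite normcN !Normc.normcM normcR ?invr_ge0//.
  (* With N = 40 the two sums contribute 2 * (2 * 40) / 40^2 = 1/10, the tolerance of
     [inverse_sqrt]. *)
  have nN : n%:R <= (40 : R) ^+ 2 by rewrite nR expr2; lra.
  have N0 : 0 <= (40 : R) by [].
  have h1 := powers_estimate xi eta hD hv N0 nN.
  have h2 := powers_estimate eta xi hD hv N0 nN.
  rewrite !ler_pdivrMl//; apply: le_trans (le_normcD _ _) _.
  rewrite normc_conj; apply: le_trans (lerD h1 h2) _; rewrite [l2_norm eta * _]mulrC.
  by rewrite -mulrA; have := mulr_ge0 (norm_ge0 xi) (norm_ge0 eta); lra.
have [d [Cld adjd dkd]] := inverse_sqrt Ggrp Clk adjk bndk.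
exists (w \o d), (d \o w'); split.
- exact: closed_span_comp.
- exact: closed_span_comp.
- exact: adjoint_comp.
- exact: dkd.
- by move=> xi x Zx; exact: wZ.
Qed.

End Isometry.

(** * Compressing actions *)

(* [U] plays the role of a decreasing base of neighbourhoods of [o]. The last
   condition says that the germs at [o] of the stabiliser of [o] act amenably
   near [o], through Folner sets of the form {t k o | k < m}. *)
Record compressing_action (R : realType) (X : choiceType) (G : set (aut X))
    (o : X) (U : nat -> set X) : Prop := CompressingAction {
  ca_group : subgroup G;
  ca_transitive : forall x, exists2 g : aut X, G g & g o = x;
  ca_infinite : exists z : nat -> aut X, (forall i, G (z i)) /\
    forall i j, i != j -> z i o <> z j o;
  ca_nested : forall m n, (m <= n)%N -> U n `<=` U m;
  ca_base : forall n, U n o;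
  ca_separates : forall g, G g -> g o <> o ->
    exists n, forall x, U n x -> ~ U n (g x);
  ca_compresses : forall m n, exists2 h : aut X, G h & forall x, ~ U m x -> U n (h x);
  ca_local : exists (u : aut X) x n,
    [/\ G u, u x <> x & forall y, U n y -> u y = y];
  ca_germs : forall (s : seq (aut X)) (e : R) n,
    (forall g, g \in s -> G g /\ g o = o) -> 0 < e ->
    exists m (t : 'I_m -> aut X), [/\ (0 < m)%N,
      forall k, G (t k) /\ U n (t k o), injective (fun k => t k o),
      forall g k j, g \in s -> g (t k o) = t j o ->
        exists N, forall x, U N x -> g (t k x) = t j x &
      forall g, g \in s ->
        (1 - e) * m%:R <= #|[pred k | [exists j, g (t k o) == t j o]]|%:R :> R]
}.

Lemma eventually_seq (I : eqType) (s : seq I) (P : I -> nat -> Prop) :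
  (forall i m n, (m <= n)%N -> P i m -> P i n) ->
  (forall i, i \in s -> exists n, P i n) -> exists n, forall i, i \in s -> P i n.
Proof.
move=> mono; elim: s => [|i s IH] h; first by exists 0%N.
have [n hn] : exists n, forall i, i \in s -> P i n.
  by apply: IH => j js; apply: h; rewrite inE js orbT.
have [m hm] := h i (mem_head _ _).
exists (maxn m n) => j; rewrite inE => /orP[/eqP ->|/hn].
  by apply: mono hm; rewrite leq_maxl.
by apply: mono; rewrite leq_maxr.
Qed.

Lemma eventually_fin (I : finType) (P : I -> nat -> Prop) :
  (forall i m n, (m <= n)%N -> P i m -> P i n) ->
  (forall i, exists n, P i n) -> exists n, forall i, P i n.
Proof.
move=> mono h; have [n hn] := @eventually_seq I (enum I) P mono (fun i _ => h i).
by exists n => i; apply: hn; rewrite mem_enum.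
Qed.

Section Compression.
Variables (R : realType) (X : choiceType) (G : set (aut X)) (o : X) (U : nat -> set X).
Hypothesis act : compressing_action R G o U.
Local Notation H := (l2 R X).
Local Notation op := (H -> H).
Local Notation Cl := (@closed_span R X G).
Implicit Types (xi eta : H) (g h : aut X).

Let Ggrp : subgroup G. Proof. exact: ca_group act. Qed.
Let GM g h : G g -> G h -> G (aut_mul g h). Proof. by case: Ggrp => _ + _; exact. Qed.
Let GV g : G g -> G (aut_inv g). Proof. by case: Ggrp => _ _; exact. Qed.

(** This is [ca_separates] for h^-1 g, translated back by [h]. *)
Lemma separates_points g h : G g -> G h -> g o <> h o ->
  exists n, forall x y, U n x -> U n y -> g x <> h y.
Proof.
move=> Gg Gh ne; have Ghg : G (aut_mul (aut_inv h) g) by apply: GM => //; exact: GV.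
have [|n hn] := ca_separates act Ghg.
  by move=> /(congr1 h) /=; rewrite bwdK.
exists n => x y Ux Uy E; apply: (hn x Ux).
by rewrite /= E fwdK.
Qed.

(** Among 2n + 1 disjoint translates [z i (U N)], the first n serve as the sets [D i], the next n as
    the sets [E i], and the last one stays free. Conjugating by [z (n + n)] moves the free one onto
    [U N], which the range of the isometry therefore avoids. If [u] moves [x0 = c o], it moves all
    of [c (U b)] off itself, and [h i] sends the complement of [c (U b)] into [D i]; thus one of [x]
    and [u x] always lands in [D i]. *)
Lemma exists_isometry : exists n (t t' : op),
  [/\ Cl t, Cl t', is_adjoint t t', t' \o t = id &
    forall xi x, U n x -> t xi x = 0].
Proof.
have [u [x0 [a [Gu ux uU]]]] := ca_local act.
have [c Gc cx] := ca_transitive act x0.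
have [b hb] : exists b, forall x y, U b x -> U b y -> aut_mul u c x <> c y.
  by apply: separates_points => //; [exact: GM|rewrite /= cx].
have [z [Gz zz]] := ca_infinite act.
have [M hM] : exists M, M = 20%N by exists 20%N.
pose n := (2 * M * M)%N.
have [N hN] : exists N, forall ij : 'I_(n + n).+1 * 'I_(n + n).+1, ij.1 != ij.2 ->
    forall x y, U N x -> U N y -> z ij.1 x <> z ij.2 y.
  apply: eventually_fin => [ij p q pq h ne x y Ux Uy|[i j] /=].
    by apply: h => //; exact: (ca_nested act pq).
  have [->|ne] := eqVneq i j; first by exists 0%N => /eqP.
  by have [p hp] := separates_points (Gz i) (Gz j) (zz _ _ ne); exists p.
pose D (i : nat) : set X := [set x | exists2 y, U N y & x = z i y].
have hD i j x : (i < (n + n).+1)%N -> (j < (n + n).+1)%N -> i != j -> D i x -> ~ D j x.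
  move=> ip jp ij [y Uy ->] [y' Uy' E].
  by apply: (hN (Ordinal ip, Ordinal jp) _ y y' Uy Uy').
have [h1 Gh1 hh1] := ca_compresses act b N.
have [k1 Gk1 hk1] := ca_compresses act a N.
exists N.
have [] := @powers_isometry R X G Ggrp M u
  (fun i => aut_mul (aut_inv (z (n + n)%N)) (aut_mul (z i) (aut_mul h1 (aut_inv c))))
  (fun i => aut_mul (aut_inv (z (n + n)%N)) (aut_mul (z (n + i)%N) k1))
  (fun i => [set x | D i (z (n + n)%N x)])
  (fun i => [set x | D (n + i)%N (z (n + n)%N x)]) (U a) (U N).
- by [].
- by [].
- by move=> i; do ?apply: GM => //; exact: GV.
- by move=> i; do ?apply: GM => //; exact: GV.
- exact: uU.
- move=> i j x ij; apply: hD.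
  + by rewrite ltnS (leq_trans (ltnW (ltn_ord i)))// leq_addr.
  + by rewrite ltnS (leq_trans (ltnW (ltn_ord j)))// leq_addr.
  + exact: ij.
- move=> i j x ij; apply: hD.
  + by rewrite ltnS leq_add2l ltnW.
  + by rewrite ltnS leq_add2l ltnW.
  + by rewrite eqn_add2l.
- move=> i x /=; rewrite !bwdK => nD.
  exists (h1 (bwd c (u x))) => //; apply: (hh1) => Ub.
  have Ub' : U b (bwd c x).
    by apply: contrapT => nU; apply: nD; exists (h1 (bwd c x)) => //; exact: hh1.
  by apply: (hb _ _ Ub' Ub); rewrite /= !bwdK.
- by move=> i x nU /=; rewrite !bwdK; exists (k1 x) => //; exact: hk1.
- move=> i x /= Di Ux.
  apply: (@hD (n + i)%N (n + n)%N (z (n + n)%N x)) Di _ => //.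
  + by rewrite ltnS leq_add2l ltnW.
  + by rewrite eqn_add2l; apply/eqP => E; have := ltn_ord i; rewrite E ltnn.
  + by exists x.
by move=> t [t' ht]; exists t, t'.
Qed.


Lemma normc_sum (I : Type) (r : seq I) (P : pred I) (F : I -> R[i]) :
  Normc.normc (\sum_(i <- r | P i) F i) <= \sum_(i <- r | P i) Normc.normc (F i).
Proof.
elim/big_rec2 : _ => [|i a b _ h]; first by rewrite Normc.normc0.
by apply: le_trans (le_normcD _ _) _; rewrite lerD2l.
Qed.

Lemma comb_delta (s : seq (R[i] * aut X)) :
  comb s (delta R o) o = \sum_(p <- s) p.1 * (p.2 o == o)%:R.
Proof.
rewrite /comb l2_sum; apply: eq_bigr => p _; rewrite l2Z lam_delta /= eq_sym.
by case: eqP.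
Qed.

(** The diagonal matrix coefficient of [comb s] at the vector m^(-1/2) sum_k d_(t_k o), where d_x is
    the point mass at x. *)
Definition transfer_coef m (t : 'I_m -> aut X) (s : seq (R[i] * aut X)) : R[i] :=
  m%:R^-1 * \sum_(p <- s) p.1 * \sum_k \sum_j (p.2 (t k o) == t j o)%:R.

(* On vectors supported in a small neighbourhood of [o], the elements [t k]
   spread out a vector isometrically, and an element of the group either carries
   [t k] to some [t j] or moves it away from all of them. *)
Lemma compress_comb m (t : 'I_m -> aut X) (s : seq (R[i] * aut X)) n xi eta :
  (0 < m)%N ->
  (forall k j, k != j -> forall x y, U n x -> U n y -> t k x <> t j y) ->
  (forall p k j, p \in s -> p.2 (t k o) = t j o ->
     forall x, U n x -> p.2 (t k x) = t j x) ->
  (forall p k j, p \in s -> p.2 (t k o) <> t j o ->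
     forall x y, U n x -> U n y -> p.2 (t k x) <> t j y) ->
  (forall x, ~ U n x -> xi x = 0) -> (forall x, ~ U n x -> eta x = 0) ->
  let c := ((Num.sqrt m%:R)^-1)%:C in
  let Y zeta := c *: \sum_k lam (t k) zeta in
  l2_inner (Y xi) (Y eta) = l2_inner xi eta /\
  l2_inner (comb s (Y xi)) (Y eta) = transfer_coef t s * l2_inner xi eta.
Proof.
move=> m0 hdisj hsame hdiff sxi seta c Y.
have cc : c * c = m%:R^-1.
  rewrite -rmorphM/= -invfM -expr2 sqr_sqrtr ?ler0n//.
  by rewrite fmorphV rmorph_nat.
have m1 : m%:R != 0 :> R[i] by rewrite pnatr_eq0 -lt0n.
have supp_disj (g h : aut X) : (forall x y, U n x -> U n y -> g x <> h y) ->
    l2_inner (lam g xi) (lam h eta) = 0.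
  move=> hgh; apply: inner_disjoint => x; rewrite !lamE.
  have [Ug|nUg] := pselect (U n (bwd g x)); last by left; exact: sxi.
  have [Uh|nUh] := pselect (U n (bwd h x)); last by right; exact: seta.
  by case: (hgh _ _ Ug Uh); rewrite !bwdK.
split.
  rewrite innerZl innerZr conjc_real mulrA cc inner_suml.
  rewrite (eq_bigr (fun=> l2_inner xi eta)); last first.
    move=> k _; rewrite inner_sumr (bigD1 k)//= big1 ?addr0 ?inner_lam// => j jk.
    by apply: supp_disj; apply: hdisj; rewrite eq_sym.
  by rewrite sumr_const card_ord -(mulr_natl (l2_inner xi eta)) mulrA mulVf// mul1r.
rewrite (linZ (@comb_linear _ _ s)) innerZl innerZr conjc_real mulrA cc.
rewrite /transfer_coef -mulrA; congr (_ * _).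
rewrite /comb inner_suml mulr_suml; apply: eq_big_seq => p ps.
rewrite innerZl -mulrA; congr (_ * _).
rewrite (lin_sum (@lam_linear _ _ p.2)) inner_suml mulr_suml; apply: eq_bigr => k _.
rewrite inner_sumr mulr_suml; apply: eq_bigr => j _.
rewrite -lamM; case: eqP => [E|ne]; last first.
  by rewrite mul0r; apply: supp_disj => x y Ux Uy; exact: hdiff ps ne _ _ Ux Uy.
rewrite mul1r -(inner_lam (t j) xi).
suff -> : lam (aut_mul p.2 (t k)) xi = lam (t j) xi by [].
apply: l2_ext => x.
rewrite !lamE.
have [Ug|nUg] := pselect (U n (bwd (t j) x)).
  suff -> : bwd (aut_mul p.2 (t k)) x = bwd (t j) x by [].
  apply: (can_inj (@fwdK _ (aut_mul p.2 (t k)))); rewrite bwdK.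
  by rewrite /= (hsame p k j ps E _ Ug) bwdK.
rewrite [RHS]sxi// sxi// => Ug; apply: nUg.
suff -> : bwd (t j) x = bwd (aut_mul p.2 (t k)) x by [].
apply: (can_inj (@fwdK _ (t j))); rewrite bwdK.
by rewrite -(hsame p k j ps E _ Ug) -[RHS]/(aut_mul p.2 (t k) _) bwdK.
Qed.

(** Terms moving [o] contribute nothing to either side. A term fixing [o] contributes its
    coefficient times the proportion of points [t k o] that it keeps in the family, which lies
    between 1 - e and 1. *)
Lemma transfer_coef_near m (t : 'I_m -> aut X) (s : seq (R[i] * aut X)) (e : R) :
  (0 < m)%N -> 0 <= e -> injective (fun k => t k o) ->
  (forall p, p \in s -> p.2 o = o ->
    (1 - e) * m%:R <= #|[pred k | [exists j, p.2 (t k o) == t j o]]|%:R :> R) ->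
  (forall p k j, p \in s -> p.2 o <> o -> p.2 (t k o) <> t j o) ->
  Normc.normc (transfer_coef t s - comb s (delta R o) o) <=
    e * \sum_(p <- s) Normc.normc p.1.
Proof.
move=> m0 e0 tinj hst hns.
have m1 : 0 < m%:R :> R by rewrite ltr0n.
have m2 : m%:R != 0 :> R[i] by rewrite pnatr_eq0 -lt0n.
rewrite comb_delta /transfer_coef mulr_sumr -sumrB mulr_sumr.
apply: le_trans (normc_sum _ _ _) _; rewrite big_seq [leRHS]big_seq.
apply: ler_sum => p ps.
set S := \sum_k _.
have -> : m%:R^-1 * (p.1 * S) - p.1 * (p.2 o == o)%:R =
   p.1 * (m%:R^-1 * S - (p.2 o == o)%:R) by rewrite mulrBr mulrCA.
rewrite Normc.normcM mulrC ler_wpM2r ?normc_ge0//.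
have -> : S = #|[pred k | [exists j, p.2 (t k o) == t j o]]|%:R.
  rewrite -sum1_card natr_sum big_mkcond/=; apply: eq_bigr => k _.
  rewrite !inE; case: (boolP [exists j, _]) => [/existsP[j /eqP kj]|/existsP nj].
    rewrite (bigD1 j)//= kj eqxx big1 ?addr0// => j' jj'.
    by case: eqP => // /tinj E; move: jj'; rewrite -E eqxx.
  by rewrite big1// => j _; case: eqP => // kj; case: nj; exists j; apply/eqP.
have [po|po] := eqVneq (p.2 o) o.
  have := hst p ps po; set K := #|_| => hK.
  have Km : K%:R <= m%:R :> R by rewrite ler_nat -[leqRHS](card_ord m) max_card.
  have -> : m%:R^-1 * K%:R - true%:R = - (1 - K%:R / m%:R)%:C :> R[i].
    by rewrite rmorphB/= opprB rmorph1 rmorphM/= fmorphV !rmorph_nat mulrC.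
  rewrite normcN normcR ?subr_ge0 ?ler_pdivrMr ?mul1r//.
  by rewrite lerBlDl addrC -lerBlDl ler_pdivlMr//; lra.
rewrite eq_card0 ?mulr0 ?subr0 ?Normc.normc0// => k; rewrite !inE.
apply/negbTE/negP => /existsP[j /eqP kj].
exact: (hns p k j ps (elimN eqP po) kj).
Qed.

End Compression.

(** * Simplicity and pure infiniteness for compressing actions *)

Section SimplePurelyInfinite.
Variables (R : realType) (X : choiceType) (G : set (aut X)) (o : X) (U : nat -> set X).
Hypothesis act : compressing_action R G o U.
Local Notation H := (l2 R X).
Local Notation op := (H -> H).
Local Notation Cl := (@closed_span R X G).
Implicit Types (xi eta : H) (g h : aut X) (a S T : op).

Let Ggrp : subgroup G. Proof. exact: ca_group act. Qed.
Let GM g h : G g -> G h -> G (aut_mul g h). Proof. by case: Ggrp => _ + _; exact. Qed.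
Let GV g : G g -> G (aut_inv g). Proof. by case: Ggrp => _ _; exact. Qed.

(** The composite of three maps: [t] produces vectors vanishing on [U n], a group element pushes
    their supports into a neighbourhood [U n3] small enough for the germs involved, and [Y] spreads
    them along the Folner family. *)
Lemma exists_spread (s : seq (R[i] * aut X)) (e : R) (t : op) n :
  over G s -> 0 < e -> Cl t ->
  (forall xi eta, l2_inner (t xi) (t eta) = l2_inner xi eta) ->
  (forall xi x, U n x -> t xi x = 0) ->
  exists (W : op) (c : R[i]), [/\ Cl W,
    forall xi eta, l2_inner (W xi) (W eta) = l2_inner xi eta,
    forall xi eta, l2_inner (comb s (W xi)) (W eta) = c * l2_inner xi eta &
    Normc.normc (c - comb s (delta R o) o) <= e].
Proof.
move=> os e0 Clt tiso tsupp.
have C0 : 0 <= \sum_(p <- s) Normc.normc p.1.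
  by apply: sumr_ge0 => p _; exact: normc_ge0.
pose C := \sum_(p <- s) Normc.normc p.1.
(* [N] is fixed before the Folner family, whose points are then taken inside [U N]: terms moving [o]
   carry no point of the family to another. *)
have [N hN] : exists N, forall p, p \in s -> p.2 o <> o ->
    forall x, U N x -> ~ U N (p.2 x).
  apply: eventually_seq => [p i j ij h po x Ux Upx|p ps].
    by apply: (h po x); exact: (ca_nested act ij).
  have [po|/eqP po] := eqVneq (p.2 o) o; first by exists 0%N.
  by have [i hi] := ca_separates act (os p ps) po; exists i.
have C1 : 0 < C + 1 by rewrite ltr_wpDl.
(* The Folner error is multiplied by the sum [C] of the moduli of the coefficients; adding 1 avoids
   division by zero. *)
have e1 : 0 < e / (C + 1) by rewrite divr_gt0.
pose stab : seq (aut X) := map snd [seq p : R[i] * aut X <- s | p.2 o == o].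
have [|m [tk [m0 Gtk tinj tgerm tcard]]] := @ca_germs _ _ _ _ _ act stab _ N _ e1.
  by move=> g /mapP[p + ->]; rewrite mem_filter => /andP[/eqP po ps]; split => //; exact: os.
have hns p k j : p \in s -> p.2 o <> o -> p.2 (tk k o) <> tk j o.
  move=> ps po E; apply: (hN p ps po (tk k o)); first by case: (Gtk k).
  by rewrite E; case: (Gtk j).
have mem_stab p : p \in s -> p.2 o = o -> p.2 \in stab.
  by move=> ps po; apply/mapP; exists p => //; rewrite mem_filter po eqxx.
have [n1 hn1] : exists n, forall kj : 'I_m * 'I_m, kj.1 != kj.2 ->
    forall x y, U n x -> U n y -> tk kj.1 x <> tk kj.2 y.
  apply: eventually_fin => [kj i j ij h ne x y Ux Uy|[k j] /=].
    by apply: h => //; exact: (ca_nested act ij).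
  have [->|ne] := eqVneq k j; first by exists 0%N.
  have [|i hi] := separates_points act (proj1 (Gtk k)) (proj1 (Gtk j)).
    by move=> /tinj E; move: ne; rewrite E eqxx.
  by exists i.
have [n2 hn2] : exists n, forall p, p \in s -> forall kj : 'I_m * 'I_m,
    (p.2 (tk kj.1 o) = tk kj.2 o -> forall x, U n x -> p.2 (tk kj.1 x) = tk kj.2 x) /\
    (p.2 (tk kj.1 o) <> tk kj.2 o ->
       forall x y, U n x -> U n y -> p.2 (tk kj.1 x) <> tk kj.2 y).
  apply: eventually_seq => [p i j ij h kj|p ps].
    have [h1 h2] := h kj; split=> [E x Ux|E x y Ux Uy].
      by apply: h1 => //; exact: (ca_nested act ij).
    by apply: h2 => //; exact: (ca_nested act ij).
  apply: eventually_fin => [kj i j ij [h1 h2]|[k j] /=].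
    split=> [E x Ux|E x y Ux Uy].
      by apply: h1 => //; exact: (ca_nested act ij).
    by apply: h2 => //; exact: (ca_nested act ij).
  have [E|ne] := pselect (p.2 (tk k o) = tk j o).
    have po : p.2 o = o by apply: contrapT => po; exact: (hns p k j ps po E).
    by have [i hi] := tgerm _ k j (mem_stab p ps po) E; exists i.
  have [|||i hi] := @separates_points _ _ _ _ _ act (aut_mul p.2 (tk k)) (tk j).
  - by apply: GM; [exact: os|case: (Gtk k)].
  - by case: (Gtk j).
  - by [].
  by exists i; split.
pose n3 := maxn n1 n2.
(* Since [h] maps the complement of [U n3] into [U n], its inverse maps the complement of [U n] into
   [U n3]. *)
have [h Gh hh] := ca_compresses act n3 n.
pose c := ((Num.sqrt m%:R)^-1)%:C : R[i].
pose Y (zeta : H) : H := c *: \sum_k lam (tk k) zeta.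
pose z xi := lam (aut_inv h) (t xi).
have zsupp xi x : ~ U n3 x -> z xi x = 0.
  by move=> nU; rewrite lamE /=; apply: tsupp; exact: hh.
have hYY xi eta := @compress_comb R X o U m tk s n3 (z xi) (z eta) m0.
have {}hYY xi eta : l2_inner (Y (z xi)) (Y (z eta)) = l2_inner xi eta /\
    l2_inner (comb s (Y (z xi))) (Y (z eta)) = transfer_coef o tk s * l2_inner xi eta.
  have [|||||h1 h2] := hYY xi eta; [| | |exact: zsupp|exact: zsupp|].
  - move=> k j kj x y Ux Uy; apply: (hn1 (k, j)) => //=.
      by apply: (ca_nested act _ Ux); exact: leq_maxl.
    by apply: (ca_nested act _ Uy); exact: leq_maxl.
  - move=> p k j ps E x Ux; have [h1 _] := hn2 p ps (k, j); apply: h1 => //=.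
    by apply: (ca_nested act _ Ux); exact: leq_maxr.
  - move=> p k j ps E x y Ux Uy; have [_ h1] := hn2 p ps (k, j); apply: h1 => //=.
      by apply: (ca_nested act _ Ux); exact: leq_maxr.
    by apply: (ca_nested act _ Uy); exact: leq_maxr.
  by rewrite h1 h2 inner_lam tiso.
exists (fun xi => Y (z xi)), (transfer_coef o tk s); split.
- have -> : (fun xi => Y (z xi)) = (fun xi => c *: \sum_k lam (tk k) (id (lam (aut1 X) xi)))
      \o (@lam R X (aut_inv h) \o t).
    apply/funext => xi; rewrite /= /Y; congr (_ *: _); apply: eq_bigr => k _.
    by rewrite lam1.
  apply: closed_span_comp => //; last first.
    by apply: closed_span_comp => //; apply: closed_span_lam; exact: GV.
  apply: (@closed_span_lam_sum _ _ _ Ggrp m tk (fun=> aut1 X) id c).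
  - by move=> i; case: (Gtk i).
  - by move=> _; have [] := Ggrp.
  - exact: closed_span_id.
- by move=> xi eta; case: (hYY xi eta).
- by move=> xi eta; case: (hYY xi eta).
apply: le_trans (@transfer_coef_near _ _ o _ tk s (e / (C + 1)) m0 (ltW e1) tinj _ _) _.
- by move=> p ps po; apply: tcard; exact: mem_stab.
- exact: hns.
by rewrite mulrAC ler_pdivrMr// ler_wpM2l ?(ltW e0)// lerDl.
Qed.

Lemma compress_to_identity a (e : R) : Cl a -> 0 < e -> a (delta R o) o = 1 ->
  exists W W' : op, [/\ Cl W, Cl W', is_adjoint W W' & bounded_by ((W' \o a \o W) - id) e].
Proof.
move=> Cla e0 a1.
have [n [t [t' [Clt Clt' adjt tt' tsupp]]]] := exists_isometry act.
(* One third for replacing [a] by [comb s], one for the Folner error, and one for the change this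
   replacement makes in the coefficient at [o]. *)
have e3 : 0 < e / 3 by rewrite divr_gt0.
have [s os hs] := closed_span_approx Cla e3.
have tiso xi eta : l2_inner (t xi) (t eta) = l2_inner xi eta.
  by rewrite adjt -[t' (t eta)]/((t' \o t) eta) tt'.
have [W [c [ClW Wiso Wcomb cnear]]] := exists_spread os e3 Clt tiso tsupp.
have [W' ClW' adjW] := closed_span_adjoint Ggrp ClW.
have Wnorm xi : l2_norm (W xi) = l2_norm xi.
  apply/eqP; rewrite -(@eqrXn2 _ 2)// ?norm_ge0//; apply/eqP/(@complexI R).
  by rewrite -!inner_normE Wiso.
have c1 : Normc.normc (c - 1) <= 2 * (e / 3).
  have -> : c - 1 = (c - comb s (delta R o) o) + (comb s (delta R o) o - 1) by ring.
  apply: le_trans (le_normcD _ _) _.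
  suff h : Normc.normc (comb s (delta R o) o - 1) <= e / 3 by lra.
  rewrite -normcN opprB -a1 -l2B; apply: le_trans (normc_le_norm _ _) _.
  by have := hs (delta R o); rewrite norm_delta mulr1.
exists W, W'; split => // xi; rewrite -[(_ - _) xi]/(W' (a (W xi)) - xi).
apply: norm_le_inner => [|eta]; first by rewrite mulr_ge0 ?norm_ge0// ltW.
have -> : l2_inner (W' (a (W xi)) - xi) eta =
    l2_inner (a (W xi) - comb s (W xi)) (W eta) + (c - 1) * l2_inner xi eta.
  by rewrite !innerBl (adjoint_sym adjW) Wcomb; ring.
apply: le_trans (le_normcD _ _) _; rewrite Normc.normcM.
have h1 := cauchy_schwarz (a (W xi) - comb s (W xi)) (W eta).
have h2 := hs (W xi).
have h3 := cauchy_schwarz xi eta.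
have h4 := ler_wpM2r (norm_ge0 eta) h2.
have h5 := ler_pM (normc_ge0 _) (normc_ge0 _) c1 h3.
rewrite Wnorm in h1; rewrite Wnorm in h4.
apply: le_trans (lerD (le_trans h1 h4) h5) _.
by rewrite le_eqVlt; apply/orP; left; apply/eqP; field.
Qed.

(** If all point masses are killed, every coordinate of every value of the adjoint vanishes, and [a]
    vanishes with its adjoint. *)
Lemma closed_span_nonzero a : Cl a -> a <> 0 -> exists x, a (delta R x) <> 0.
Proof.
move=> Cla a0; apply: contrapT => h; apply: a0.
have [a' _ adja] := closed_span_adjoint Ggrp Cla.
have ha' xi : a' xi = 0.
  apply: l2_ext => x; rewrite -inner_delta (adjoint_sym adja).
  have -> : a (delta R x) = 0 by apply: contrapT => ax; apply: h; exists x.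
  by rewrite inner0r.
apply/funext => xi; apply: l2_ext => x; rewrite -inner_delta adja ha'.
by rewrite inner0r.
Qed.

(* Conjugating [a^* a] by an element of the group moves a point where [a] does
   not vanish to the base point. *)
Lemma compress_nonzero a : Cl a -> a <> 0 -> forall e : R, 0 < e ->
  exists V V' : op, [/\ Cl V, Cl V', is_adjoint V V' &
    forall a', is_adjoint a a' -> bounded_by ((V' \o a' \o a \o V) - id) e].
Proof.
move=> Cla a0 e e0.
have [x ax] := closed_span_nonzero Cla a0.
have [g Gg gx] := ca_transitive act x.
have [a' Cla' adja] := closed_span_adjoint Ggrp Cla.
have nx : 0 < l2_norm (a (delta R x)).
  by rewrite lt_def norm_ge0 andbT; apply/eqP => /norm_eq0.
(* Used on both sides, this factor normalises the coefficient of [b] at [o] to 1. *)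
pose r := ((l2_norm (a (delta R x)))^-1)%:C : R[i].
have Clg := @closed_span_lam R _ _ _ Gg.
have Clg' := @closed_span_lam R _ _ _ (GV Gg).
pose b := (r *: @lam R X (aut_inv g) : op) \o a' \o a \o (r *: @lam R X g).
have Clrg : Cl (r *: @lam R X g) by apply: closed_span_scale.
have Clrg' : Cl (r *: @lam R X (aut_inv g)) by apply: closed_span_scale.
have adjg : is_adjoint (r *: @lam R X g) (r *: @lam R X (aut_inv g)).
  move=> xi eta; rewrite -[(r *: _) xi]/(r *: lam g xi) -[(r *: _) eta]/(r *: lam (aut_inv g) eta).
  by rewrite innerZl innerZr conjc_real lam_adj.
have Clb : Cl b by do 3 (apply: closed_span_comp => //).
have b1 : b (delta R o) o = 1.
  rewrite -inner_delta /b /= (adjoint_sym adjg) (adjoint_sym adja).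
  rewrite -[(r *: @lam R X g) _]/(r *: lam g (delta R o)) lam_delta gx.
  rewrite (linZ (closed_span_linear Cla)) innerZl innerZr conjc_real inner_normE.
  rewrite -!rmorphM/= -[RHS](rmorph1 (real_complex R)); congr (_%:C).
  by rewrite expr2; field; rewrite gt_eqF.
have [W [W' [ClW ClW' adjW hW]]] := compress_to_identity Clb e0 b1.
exists ((r *: @lam R X g) \o W), (W' \o (r *: @lam R X (aut_inv g))); split.
- exact: closed_span_comp.
- exact: closed_span_comp.
- exact: adjoint_comp.
by move=> a'' /(adjoint_unique adja) <-.
Qed.

Lemma closed_span_id_neq0 : (id : op) <> 0.
Proof.
move=> /(congr1 (fun f : op => f (delta R o) o)) /=.
by rewrite eqxx => /eqP; rewrite oner_eq0.
Qed.

Lemma closed_span_simple : simple_cstar Cl.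
Proof.
split.
  move=> E; have : Cl id by exact: closed_span_id.
  by rewrite E /=; exact: closed_span_id_neq0.
move=> J [JCl [J0 Jl] Jid Jc].
have [E|nE] := pselect (J = [set 0]); [by left|right].
have [a Ja a0] : exists2 a, J a & a <> 0.
  apply: contrapT => h; apply: nE; apply/seteqP; split => [a Ja|a -> //].
  by apply: contrapT => a0; apply: h; exists a.
have Cla := JCl _ Ja.
have [V [V' [ClV ClV' adjV hV]]] := compress_nonzero Cla a0 (divr_gt0 ltr01 (ltr0Sn R 1)).
have [a' Cla' adja] := closed_span_adjoint Ggrp Cla.
pose z := V' \o a' \o a \o V.
have Jz : J z.
  have [_ h1] := Jid V a ClV Ja.
  have [h2 _] := Jid (V' \o a') _ (closed_span_comp Ggrp ClV' Cla') h1.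
  exact: h2.
have Clz := JCl _ Jz.
have bz : bounded_by (id - z) (1 / 2) by apply: bounded_by_sym; exact: hV.
have Cl1 : Cl id by exact: closed_span_id.
(* In place of inverting [z]: 1 - (1 - z)^n lies in [J] for every n and tends to 1, so the closed
   ideal contains 1. *)
pose r n : op := iter n (fun f => f \o (id - z)) id.
have Clr n : Cl (r n).
  elim: n => [//|n IH]; apply: closed_span_comp => //; exact: closed_span_sub.
have br n : bounded_by (r n) ((1 / 2) ^+ n).
  elim: n => [|n IH]; first by move=> xi; rewrite expr0 mul1r.
  by rewrite exprSr; apply: bounded_by_comp IH bz; rewrite exprn_ge0.
have Jr n : J (id - r n).
  elim: n => [|n IH].
    by rewrite (_ : id - r 0%N = 0)//; apply/funext => xi; rewrite -[LHS]/(xi - xi) subrr.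
  have -> : id - r n.+1 = 1 *: (r n \o z) + (id - r n).
    apply/funext => xi; rewrite -[LHS]/(xi - r n (xi - z xi)) scale1r.
    rewrite -[RHS]/(r n (z xi) + (xi - r n xi)) (linB (closed_span_linear (Clr n))).
    by apply: l2_ext => x; rewrite !(l2D, l2N); ring.
  by apply: Jl => //; have [] := Jid (r n) z (Clr n) Jz.
have J1 : J id.
  apply: Jc; first exact: closed_span_bounded Cl1.
  move=> e e0.
  have [m _ hm] : \forall n \near \oo, (1 / 2 : R) ^+ n < e.
    have /cvgrPdist_lt /(_ e e0) := @cvg_expr R (1 / 2) ltac:(rewrite ger0_norm; lra).
    apply: filterS => n; rewrite sub0r normrN ger0_norm// exprn_ge0//; lra.
  exists (id - r m) => //; apply: le_lt_trans (hm m (leqnn m)).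
  apply: op_norm_le; first by rewrite exprn_ge0.
  have -> : id - (id - r m) = r m.
    by apply/funext => xi; rewrite -[LHS]/(xi - (xi - r m xi)) opprB addrC subrK.
  exact: br.
apply/seteqP; split => // T ClT.
by have [] := Jid T id ClT J1.
Qed.

Lemma op_leP S T : op_le S T <-> forall xi, 0 <= l2_inner (T xi - S xi) xi.
Proof. by []. Qed.

Lemma norm_le_sq xi eta : l2_norm xi <= l2_norm eta ->
  0 <= l2_inner eta eta - l2_inner xi xi.
Proof.
move=> h; rewrite !inner_normE -rmorphB/= ler0c subr_ge0.
by rewrite ler_pXn2r// nnegrE norm_ge0.
Qed.

Lemma closed_span_purely_infinite : purely_infinite Cl.
Proof.
move=> B [[Bb [B0 Bl] Bm Ba Bc] BCl Bh] BN0.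
have [a Ba0 a0] : exists2 a, B a & a <> 0.
  apply: contrapT => h; apply: BN0; apply/seteqP; split => [a Baa|a -> //].
  by apply: contrapT => a0; apply: h; exists a.
have Cla := BCl _ Ba0.
have [a' Cla' adja] := closed_span_adjoint Ggrp Cla.
have Ba' : B a' by exact: Ba adja.
have [V [V' [ClV ClV' adjV hV]]] :=
  compress_nonzero Cla a0 (ltac:(by rewrite invr_gt0) : 0 < 10^-1 :> R).
pose k := V' \o a' \o a \o V.
have Clk : Cl k by do 3 (apply: closed_span_comp => //).
have adjk : is_adjoint k k.
  move=> xi eta; rewrite /k /= (adjoint_sym adjV) (adjoint_sym adja).
  by rewrite (adjoint_sym (adjoint_sym adja)) (adjoint_sym (adjoint_sym adjV)).
have [d [Cld adjd dkd]] := inverse_sqrt Ggrp Clk adjk (hV _ adja).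
pose s := a \o (V \o d); pose s' := (d \o V') \o a'.
have Cls : Cl s by do 2 (apply: closed_span_comp => //).
have Cls' : Cl s' by do 2 (apply: closed_span_comp => //).
have adjs : is_adjoint s s' by apply: adjoint_comp => //; exact: adjoint_comp.
have ss : s' \o s = id by exact: dkd.
have ssE xi : s' (s xi) = xi by rewrite -[LHS]/((s' \o s) xi) ss.
pose p := s \o s'.
have [M M0 hM] : exists2 M : R, 0 <= M & bounded_by (d \o V') M.
  by apply: (@closed_span_bnd _ _ G); apply: closed_span_comp.
have Bp : B p.
  apply: (Bh p ((M ^+ 2)%:C *: (a \o a') + 0)).
  - exact: closed_span_comp.
  - by apply: Bl => //; exact: Bm.
  - apply/op_leP => xi; rewrite -[(0 : op) xi]/0 subr0 /p /= adjs inner_normE.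
    by rewrite ler0c sqr_ge0.
  apply/op_leP => xi.
  rewrite -[((M ^+ 2)%:C *: (a \o a') + 0) xi]/((M ^+ 2)%:C *: a (a' xi) + 0) addr0.
  rewrite innerBl innerZl /p /= adjs adja !inner_normE -rmorphM -rmorphB/= ler0c.
  rewrite subr_ge0 -exprMn ler_pXn2r// ?nnegrE ?mulr_ge0 ?norm_ge0//.
  exact: hM.
exists p => //; split; first exact: closed_span_comp.
  split; first by apply/funext => xi; rewrite /p /= ssE.
  by move=> xi eta; rewrite /p /= adjs -(adjoint_sym adjs).
have [n [t [t' [Clt Clt' adjt tt tsupp]]]] := exists_isometry act.
have ttE xi : t' (t xi) = xi by rewrite -[LHS]/((t' \o t) xi) tt.
have tnorm xi : l2_norm (t xi) = l2_norm xi.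
  apply/eqP; rewrite -(@eqrXn2 _ 2)// ?norm_ge0//; apply/eqP/(@complexI R).
  by rewrite -!inner_normE adjt ttE.
have t'bnd : bounded_by t' 1.
  by apply: adjoint_bnd adjt _ => // xi; rewrite tnorm mul1r.
exists (s \o t \o s'), (s \o t' \o s'); split.
- by do 2 (apply: closed_span_comp => //).
- move=> xi eta; rewrite /= adjs adjt.
  by rewrite (adjoint_sym adjs).
- by apply/funext => xi; rewrite /= ssE ttE.
- apply/op_leP => xi; rewrite innerBl /p /= !adjs !ssE adjt.
  by apply: norm_le_sq; have := t'bnd (s' xi); rewrite mul1r.
(* Cancelling [s], equality would give t t^* = 1, whereas vectors in the range of [t] vanish at
   [o]. *)
move=> E; have := congr1 (fun f : op => s' (f (s (delta R o))) o) E.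
rewrite /p /= !ssE tsupp; last exact: (ca_base act).
by rewrite /= eqxx => /eqP; rewrite eq_sym oner_eq0.
Qed.

End SimplePurelyInfinite.

(** * Germs of elements of T *)

Section Circle.
Variables (R : realType) (l : R).
Hypothesis l0 : 0 < l.
Implicit Types (x y z h s : R) (f g : R -> R).

Definition eqm x y := exists k : int, x - y = k%:~R * l.

Definition red x := x - (Num.floor (x / l))%:~R * l.

Lemma eqm_refl x : eqm x x.
Proof. by exists 0; rewrite subrr mul0r. Qed.

Lemma eqm_sym x y : eqm x y -> eqm y x.
Proof. by move=> [k E]; exists (- k); rewrite -opprB E rmorphN/= mulNr. Qed.

Lemma eqm_trans y x z : eqm x y -> eqm y z -> eqm x z.
Proof.
by move=> [k E] [j F]; exists (k + j); rewrite rmorphD/= mulrDl -E -F addrA subrK.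
Qed.

Lemma eqmDr z x y : eqm x y -> eqm (x + z) (y + z).
Proof. by move=> [k E]; exists k; rewrite -E; ring. Qed.

Lemma red_eqm x : eqm (red x) x.
Proof. by exists (- Num.floor (x / l)); rewrite /red rmorphN/=; ring. Qed.

Lemma red_ge0 x : 0 <= red x.
Proof. by rewrite subr_ge0 -ler_pdivlMr// floor_le. Qed.

Lemma red_lt x : red x < l.
Proof.
have := floorD1_gt (x / l); rewrite ltr_pdivrMr// rmorphD/= mulrDl mul1r /red.
by rewrite ltrBlDl.
Qed.

Lemma red_in x : red x \in `[0, l[.
Proof. by rewrite in_itv/= red_ge0 red_lt. Qed.

Lemma eqm_eq x y : 0 <= x < l -> 0 <= y < l -> eqm x y -> x = y.
Proof.
move=> /andP[x0 xl] /andP[y0 yl] [k E].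
have h1 : k%:~R * l < 1 * l by rewrite -E mul1r; lra.
have h2 : (-1) * l < k%:~R * l by rewrite -E mulN1r; lra.
rewrite ltr_pM2r// in h1; rewrite ltr_pM2r// in h2.
have k1 : (k < 1)%R by rewrite -(ltr_int R).
have k2 : (-1 < k)%R by rewrite -(ltr_int R).
have k0 : k = 0 by lia.
by move: E; rewrite k0 mul0r => /eqP; rewrite subr_eq0 => /eqP.
Qed.

Lemma red_id x : 0 <= x < l -> red x = x.
Proof.
by move=> hx; apply: eqm_eq => //; [rewrite red_ge0 red_lt|exact: red_eqm].
Qed.

Lemma eqm_redP x y : eqm x y -> red x = red y.
Proof.
move=> h; apply: eqm_eq; try by rewrite red_ge0 red_lt.
apply: eqm_trans (red_eqm x) _; apply: eqm_trans h _.
exact/eqm_sym/red_eqm.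
Qed.

Lemma eqm_small x : `|x| < l -> eqm x 0 -> x = 0.
Proof.
move=> xl [k]; rewrite subr0 => E.
have : `|k%:~R * l| < 1 * l by rewrite -E mul1r.
rewrite normrM (gtr0_norm l0) ltr_pM2r// -intr_norm -[1]/(1%:~R) ltr_int => h.
have k0 : k = 0 by lia.
by rewrite E k0 mul0r.
Qed.

(* The increment of a function with right slope [s1] and left slope [s2]. *)
Definition pw s1 s2 h := if 0 <= h then s1 * h else s2 * h.

Lemma pw_same s h : pw s s h = s * h.
Proof. by rewrite /pw; case: ifP. Qed.

Lemma pw_comp s1 s2 s3 s4 h : 0 < s3 -> 0 < s4 ->
  pw s1 s2 (pw s3 s4 h) = pw (s1 * s3) (s2 * s4) h.
Proof.
move=> s30 s40; rewrite /pw; case: (lerP 0 h) => h0.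
  by rewrite mulr_ge0// ?ltW// mulrA.
by rewrite pmulr_rge0// leNgt h0 /= mulrA.
Qed.

Lemma pw_norm s1 s2 h : 0 < s1 -> 0 < s2 -> `|pw s1 s2 h| <= (s1 + s2) * `|h|.
Proof.
move=> s10 s20; rewrite /pw; case: ifP => _; rewrite normrM ler_wpM2r//.
  by rewrite (gtr0_norm s10) lerDl ltW.
by rewrite (gtr0_norm s20) lerDr ltW.
Qed.

End Circle.

Section LocalGerms.
Variables (R : realType) (L G : set R) (l : R).
Hypothesis Lgrp : mul_subgroup_pos L.
Hypothesis Gmod : submodule_over L G.
Hypothesis Gl : G l.
Hypothesis l0 : 0 < l.
Implicit Types (x y z h s : R) (f g : R -> R).
Local Notation red := (red l).
Local Notation eqm := (eqm l).

Lemma slope_gt0 s : L s -> 0 < s. Proof. by case: Lgrp => + _ _ _; apply. Qed.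
Lemma slope1 : L 1. Proof. by case: Lgrp. Qed.
Lemma slopeM s t : L s -> L t -> L (s * t). Proof. by case: Lgrp => _ _ + _; exact. Qed.
Lemma slopeV s : L s -> L s^-1. Proof. by case: Lgrp => _ _ _; exact. Qed.
Lemma module0 : G 0. Proof. by case: Gmod. Qed.
Lemma moduleB x y : G x -> G y -> G (x - y). Proof. by case: Gmod => _ + _; exact. Qed.
Lemma moduleN x : G x -> G (- x).
Proof. by move=> h; rewrite -sub0r; apply: moduleB => //; exact: module0. Qed.
Lemma moduleD x y : G x -> G y -> G (x + y).
Proof. by move=> hx hy; rewrite -[y]opprK; apply: moduleB => //; exact: moduleN. Qed.
Lemma moduleZ s x : L s -> G x -> G (s * x). Proof. by case: Gmod => _ _; exact. Qed.

Lemma module_nat n x : G x -> G (n%:R * x).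
Proof.
move=> hx; elim: n => [|n IH]; first by rewrite mul0r; exact: module0.
by rewrite -natr1 mulrDl mul1r; exact: moduleD.
Qed.

Lemma module_int (k : int) x : G x -> G (k%:~R * x).
Proof.
move=> hx; case: k => n; first exact: module_nat.
by rewrite NegzE rmorphN/= mulNr; apply: moduleN; exact: module_nat.
Qed.

Lemma module_eqm x y : eqm x y -> G x -> G y.
Proof.
move=> [k E] hx; have -> : y = x - k%:~R * l by rewrite -E; ring.
by apply: moduleB => //; exact: module_int.
Qed.

Lemma module_red x : G (red x) <-> G x.
Proof. by split; apply: module_eqm; [|apply: eqm_sym]; exact: red_eqm. Qed.

(** Arguments and values are read modulo [l], so neither the cut at 0 nor the jump at the preimage
    of 0 is exceptional. *)
Definition germ f x := exists s1 s2 d, [/\ L s1, L s2, 0 < d,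
  forall h, `|h| < d -> eqm (f (red (x + h))) (f (red x) + pw s1 s2 h) &
  G x \/ s1 = s2].

(* A description of the elements of T that only refers to germs at points of
   the circle; it is visibly stable under composition and inversion. *)
Definition local_T f := [/\ set_bij `[0, l[ `[0, l[ f,
  forall x, x \notin `[0, l[ -> f x = x,
  forall x, x \in `[0, l[ -> (G x <-> G (f x)) &
  forall x, germ f x].

Lemma itv_coP x : `[0, l[%classic x <-> 0 <= x < l.
Proof. by rewrite /= in_itv. Qed.

Section Elements.
Variables (f : R -> R) (hf : local_T f).

Lemma local_T_range x : 0 <= x < l -> 0 <= f x < l.
Proof. by move=> hx; case: hf => -[h _ _] _ _ _; apply/itv_coP/h/itv_coP. Qed.

Lemma local_T_red_range x : 0 <= f (red x) < l.
Proof. by apply: local_T_range; rewrite red_ge0// red_lt. Qed.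

Lemma local_T_inj : injective f.
Proof.
move=> x y E; case: hf => -[hr hi _] ho _ _.
have out z : ~ (0 <= z < l) -> f z = z.
  by move=> nz; apply: ho; rewrite in_itv/=; apply/negP.
have [hx|hx] := pselect (0 <= x < l); have [hy|hy] := pselect (0 <= y < l).
- by apply: hi => //; apply/mem_set/itv_coP.
- by have := local_T_range hx; rewrite E out.
- by have := local_T_range hy; rewrite -E out.
- by rewrite -(out x)// -(out y).
Qed.

Lemma local_T_surj y : exists x, f x = y.
Proof.
case: hf => -[_ _ hs] ho _ _.
have [hy|hy] := pselect (0 <= y < l).
  by have [x _ <-] := hs y (proj2 (itv_coP y) hy); exists x.
by exists y; apply: ho; rewrite in_itv/=; apply/negP.
Qed.

Lemma local_T_range_inv x : 0 <= f x < l -> 0 <= x < l.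
Proof.
move=> hx; apply: contrapT => nx; case: hf => _ ho _ _.
by move: hx; rewrite ho// in_itv/=; apply/negP.
Qed.

Lemma local_T_eqm x y : 0 <= x < l -> eqm x y -> f x = f (red y).
Proof. by move=> hx /(eqm_redP l0) <-; rewrite red_id. Qed.

End Elements.

Lemma local_T_bij f : (forall x, 0 <= x < l -> 0 <= f x < l) -> injective f ->
  (forall y, exists x, f x = y) -> (forall x, 0 <= f x < l -> 0 <= x < l) ->
  set_bij `[0, l[ `[0, l[ f.
Proof.
move=> h1 h2 h3 h4; split.
- by move=> x /itv_coP hx; apply/itv_coP/h1.
- by move=> x y _ _; exact: h2.
- by move=> y /itv_coP hy; have [x E] := h3 y; exists x => //; apply/itv_coP/h4; rewrite E.
Qed.

Lemma local_T_comp f g : local_T f -> local_T g -> local_T (f \o g).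
Proof.
move=> hf hg; split.
- apply: local_T_bij.
  + by move=> x /(local_T_range hg) /(local_T_range hf).
  + exact: inj_comp (local_T_inj hf) (local_T_inj hg).
  + move=> y; have [x <-] := local_T_surj hf y; have [z <-] := local_T_surj hg x.
    by exists z.
  + by move=> x /(local_T_range_inv hf) /(local_T_range_inv hg).
- by move=> x hx; case: hf hg => [_ hf _ _] [_ hg _ _]; rewrite /= hg// hf.
- move=> x hx; case: (hf) (hg) => [_ _ hf' _] [_ _ hg' _]; rewrite hg'// hf'//.
  by move: hx; rewrite !in_itv /=; exact: local_T_range hg _.
move=> x; case: (hg) => _ _ hgG /(_ x) [s1 [s2 [d [Ls1 Ls2 d0 hd hb]]]].
case: (hf) => _ _ _ /(_ (g (red x))) [t1 [t2 [e [Lt1 Lt2 e0 he hc]]]].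
have gr y := local_T_red_range hg y.
have s0 : 0 < s1 + s2 by rewrite addr_gt0// slope_gt0.
exists (t1 * s1), (t2 * s2), (Num.min d (e / (s1 + s2))); split.
- exact: slopeM.
- exact: slopeM.
- by rewrite lt_min d0 divr_gt0.
- move=> h; rewrite lt_min => /andP[h1 h2].
  rewrite /= (local_T_eqm f (gr _) (hd h h1)).
  have h3 : `|pw s1 s2 h| < e.
    apply: le_lt_trans (pw_norm _ (slope_gt0 Ls1) (slope_gt0 Ls2)) _.
    by rewrite mulrC -ltr_pdivlMr.
  have := he _ h3; rewrite (red_id l0 (gr x)) pw_comp//; exact: slope_gt0.
(* A break of [f] at [g x] has [g x] in [G], hence [x] in [G]: this is where invariance of [G] in
   both directions is needed. *)
have [Gx|nGx] := pselect (G x); [by left|right].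
have Es : s1 = s2 by case: hb.
case: hc => [Gg|->]; last by rewrite Es.
by case: nGx; apply/module_red/hgG => //; exact: red_in.
Qed.

Lemma local_T_inv f : local_T f -> exists2 g, local_T g & cancel f g /\ cancel g f.
Proof.
move=> hf; have [g gK] := choice (local_T_surj hf).
have fK : cancel f g by move=> x; apply: (local_T_inj hf); rewrite gK.
have gr x : 0 <= x < l -> 0 <= g x < l.
  by move=> hx; apply: (local_T_range_inv hf); rewrite gK.
exists g => //; split.
- apply: local_T_bij => //.
  + exact: can_inj gK.
  + by move=> y; exists (f y).
  + by move=> x hx; rewrite -(gK x); exact: local_T_range hf _ hx.
- by move=> x hx; apply: (local_T_inj hf); rewrite gK; case: hf => _ ->.
- move=> x hx; case: (hf) => _ _ hG _; rewrite -{1}(gK x); symmetry; apply: hG.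
  by rewrite in_itv/= gr// -in_itv.
move=> y; pose x := g (red y).
have xr : 0 <= x < l by apply: gr; rewrite red_ge0// red_lt.
case: (hf) => _ _ hG /(_ x) [s1 [s2 [d [Ls1 Ls2 d0 hd hb]]]].
have s0 : 0 < s1^-1 + s2^-1 by rewrite addr_gt0// invr_gt0 slope_gt0.
exists s1^-1, s2^-1, (d / (s1^-1 + s2^-1)); split.
- exact: slopeV.
- exact: slopeV.
- by rewrite divr_gt0.
- move=> k hk; set h := pw _ _ k.
  have h1 : `|h| < d.
    have i1 : 0 < s1^-1 by rewrite invr_gt0 slope_gt0.
    have i2 : 0 < s2^-1 by rewrite invr_gt0 slope_gt0.
    apply: le_lt_trans (pw_norm _ i1 i2) _.
    by rewrite mulrC -ltr_pdivlMr.
  have := hd _ h1; rewrite (red_id l0 xr) {2}/h pw_comp ?invr_gt0 ?slope_gt0//.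
  rewrite !divff ?gt_eqF ?slope_gt0// pw_same mul1r {2}/x gK => E.
  have -> : red (y + k) = f (red (x + h)).
    rewrite -(red_id l0 (local_T_red_range hf (x + h))).
    apply: eqm_redP => //; apply: eqm_sym; apply: eqm_trans E _.
    by apply: eqmDr; exact: red_eqm.
  by rewrite fK; exact: red_eqm.
case: hb => [Gx|->]; [left|by right].
apply/module_red; have <- : f x = red y by exact: gK.
by apply: (proj1 (hG x _)) => //; rewrite in_itv.
Qed.

End LocalGerms.

(** * From germs to the interval definition of T *)

Section LocalToGlobal.
Variables (R : realType) (L G : set R) (l : R).
Hypothesis Lgrp : mul_subgroup_pos L.
Hypothesis Gmod : submodule_over L G.
Hypothesis Gl : G l.
Hypothesis l0 : 0 < l.
Implicit Types (x y z h s : R) (f g : R -> R).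
Local Notation red := (red l).
Local Notation eqm := (eqm l).
Local Notation local_T := (local_T L G l).

(** The body of [germ] with its witnesses exposed, so that slopes can be named and compared. *)
Definition germ_data f x s1 s2 d := [/\ L s1, L s2, 0 < d,
  forall h, `|h| < d -> eqm (f (red (x + h))) (f (red x) + pw s1 s2 h) &
  G x \/ s1 = s2].

(* The left limit of f at a point where its value in [0, l) is z. *)
Definition top z := if z == 0 then l else z.

Section Formulas.
Variables (f : R -> R) (hf : local_T f) (x s1 s2 d : R).
Hypothesis hg : germ_data f x s1 s2 d.

(** The congruence becomes an equality as long as neither the argument nor the value reaches [l],
    which dictates the choice of [e]. *)
Lemma right_formula : 0 <= x < l ->
  exists e, [/\ 0 < e, x + e <= l & forall h, 0 <= h < e -> f (x + h) = f x + s1 * h].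
Proof.
move=> hx; have [Ls1 Ls2 d0 hd _] := hg.
have s10 := slope_gt0 Lgrp Ls1.
have /andP[fx0 fxl] := local_T_range hf hx.
have e10 : 0 < (l - f x) / s1 by rewrite divr_gt0// subr_gt0.
exists (Num.min d (Num.min (l - x) ((l - f x) / s1))); split.
- by rewrite !lt_min d0 e10 subr_gt0; case/andP: hx => _ ->.
- by rewrite -lerBrDl !ge_min lexx orbT.
move=> h /andP[h0]; rewrite !lt_min => /and3P[hd1 hd2 hd3].
have := hd h; rewrite ger0_norm// /pw h0 (red_id l0 hx) => /(_ hd1).
rewrite (red_id l0); last by case/andP: hx => ? ?; apply/andP; split; lra.
rewrite ltr_pdivlMr// in hd3.
apply: (eqm_eq l0).
  by apply: (local_T_range hf); case/andP: hx => ? ?; apply/andP; split; lra.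
by have := mulr_ge0 (ltW s10) h0 => ?; apply/andP; split; lra.
Qed.

Lemma left_formula : 0 < x <= l ->
  exists e, [/\ 0 < e, e <= x & forall h, 0 < h < e -> f (x - h) = top (f (red x)) - s2 * h].
Proof.
move=> /andP[x0 xl]; have [Ls1 Ls2 d0 hd _] := hg.
have s20 := slope_gt0 Lgrp Ls2.
have /andP[fx0 fxl] := local_T_red_range l0 hf x.
have t0 : 0 < top (f (red x)).
  by rewrite /top; case: eqVneq => // ne; rewrite lt_def ne.
have tl : top (f (red x)) <= l by rewrite /top; case: eqVneq => // _; exact: ltW.
have te : eqm (f (red x)) (top (f (red x))).
  rewrite /top; case: eqP => [->|_]; last exact: eqm_refl.
  by exists (-1); rewrite rmorphN1; ring.
have e10 : 0 < top (f (red x)) / s2 by rewrite divr_gt0.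
exists (Num.min d (Num.min x (top (f (red x)) / s2))); split.
- by rewrite !lt_min d0 e10 x0.
- by rewrite !ge_min lexx orbT.
move=> h /andP[h0]; rewrite !lt_min => /and3P[hd1 hd2 hd3].
have := hd (- h); rewrite normrN gtr0_norm// => /(_ hd1).
rewrite /pw oppr_ge0 leNgt h0 /= (red_id l0); last by apply/andP; split; lra.
rewrite ltr_pdivlMr// in hd3; have sh := mulr_gt0 s20 h0.
move=> E; apply: (eqm_eq l0).
- by apply: (local_T_range hf); apply/andP; split; lra.
- by apply/andP; split; lra.
by apply: eqm_trans E _; rewrite mulrN; apply: eqmDr.
Qed.

End Formulas.

Definition affine_on f u v := exists2 s, L s & exists b, forall x, u < x < v -> f x = s * x + b.

Definition partition_upto f y := exists (n : nat) (a : nat -> R),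
  [/\ a 0%N = 0, a n = y, forall i, (i < n)%N -> a i < a i.+1 &
      forall i, (i < n)%N -> affine_on f (a i) (a i.+1)].

Lemma partition_extend f u v : partition_upto f u -> u < v -> affine_on f u v ->
  partition_upto f v.
Proof.
move=> [n [a [a0 an ai ap]]] uv huv.
exists n.+1, (fun i => if (i <= n)%N then a i else v); split => //.
- by rewrite ltnn.
- move=> i; rewrite ltnS => ilen; rewrite ilen.
  case: ltnP => [/ai//|ni]; have E : i = n by lia.
  by rewrite E an.
move=> i; rewrite ltnS => ilen; rewrite ilen.
case: ltnP => [/ap//|ni]; have E : i = n by lia.
by rewrite E an.
Qed.

(** Compactness through a supremum: the left germ at the supremum of reachable points makes it
    reachable, and the right germ leads beyond it unless it is [l]. *)
Lemma local_T_partition f : local_T f -> partition_upto f l.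
Proof.
move=> hf.
pose S : set R := [set y | 0 <= y <= l /\ partition_upto f y].
have S0 : S 0.
  split; first by rewrite lexx ltW.
  by exists 0%N, (fun=> 0); split.
have Sub : ubound S l by move=> y [/andP[_ ?] _].
have hasS : has_sup S by split; [exists 0|exists l].
pose c := sup S.
have c0 : 0 <= c by apply: sup_ubound => //; exists l.
have cl : c <= l by apply: ge_sup => //; exists 0.
have Pc : partition_upto f c.
  have [c1|c1] := eqVneq c 0; first by rewrite c1; case: S0.
  have cp : 0 < c by rewrite lt_def c1.
  have [_ _ _ /(_ c) [s1 [s2 [d hd]]]] := hf.
  have [|e [e0 ec he]] := left_formula hf hd; first by rewrite cp.
  have [u [hu Pu] cu] := sup_adherent e0 hasS.
  have uc : u <= c by apply: sup_ubound; [exists l|split].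
  have [<-//|ne] := eqVneq u c.
  apply: (partition_extend Pu); first by rewrite lt_neqAle ne.
  have [_ Ls2 _ _ _] := hd; exists s2 => //.
  exists (top (f (red c)) - s2 * c) => y /andP[y1 y2].
  have -> : y = c - (c - y) by ring.
  rewrite he; first by ring.
  by rewrite -/c in cu; apply/andP; split; lra.
have [<-//|ne] := eqVneq c l; exfalso.
have cl' : c < l by rewrite lt_neqAle ne.
have [_ _ _ /(_ c) [s1 [s2 [d hd]]]] := hf.
have [|e [e0 ec he]] := right_formula hf hd; first by rewrite c0.
suff : S (c + e / 2).
  move=> /(sup_ubound (ex_intro _ l Sub)); rewrite -/c; lra.
split; first by apply/andP; split; lra.
apply: (partition_extend Pc); first by lra.
have [Ls1 _ _ _ _] := hd; exists s1 => //.
exists (f c - s1 * c) => y /andP[y1 y2].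
have -> : y = c + (y - c) by ring.
by rewrite he; [ring|apply/andP; split; lra].
Qed.

Lemma right_continuous_atP f x : right_continuous_at f x <->
  forall e, 0 < e -> exists2 d, 0 < d & forall y, x < y < x + d -> `|f x - f y| < e.
Proof.
split=> [/cvgrPdist_lt h e e0|h].
  have [d /= d0 hd] := h e e0; exists d => // y /andP[y1 y2].
  by apply: hd => //=; rewrite distrC gtr0_norm; lra.
apply/cvgrPdist_lt => e e0; have [d d0 hd] := h e e0.
exists d => //= y yd xy; apply: hd.
by rewrite xy/=; move: yd => /=; rewrite distrC gtr0_norm; lra.
Qed.

Lemma within_cvgP (A : set R) f x (z : R) :
  f y @[y --> within A (nbhs x)] --> z <->
  forall e, 0 < e -> exists2 d, 0 < d & forall y, A y -> `|y - x| < d -> `|z - f y| < e.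
Proof.
split=> [/cvgrPdist_lt h e e0|h].
  have [d /= d0 hd] := h e e0; exists d => // y Ay yd.
  by apply: hd => //=; rewrite distrC.
apply/cvgrPdist_lt => e e0; have [d d0 hd] := h e e0.
by exists d => //= y yd Ay; apply: hd => //; move: yd => /=; rewrite distrC.
Qed.

Lemma piece_of n (a : nat -> R) x : a 0%N <= x < a n ->
  exists2 i, (i < n)%N & a i <= x < a i.+1.
Proof.
elim: n => [|n IH] /andP[x0 xn]; first by lra.
have [h|h] := ltP x (a n); last by exists n => //; rewrite h.
by have [|i ilt hi] := IH; [rewrite x0|exists i => //; exact: ltnW].
Qed.

Lemma germ_circle f x s1 s2 d y (j : int) : germ_data f x s1 s2 d ->
  0 <= x < l -> y \in `[0, l[ -> let h := y - x + j%:~R * l in `|h| < d ->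
  eqm (f y) (f x + pw s1 s2 h).
Proof.
move=> [_ _ _ hd _] hx; rewrite in_itv /= => hy; set h := _ + _ => hh.
have := hd h hh; rewrite (red_id l0 hx).
have -> : red (x + h) = y; last by [].
rewrite -[RHS](red_id l0 hy); apply: (eqm_redP l0); exists j; rewrite /h; ring.
Qed.

Lemma local_T_circle_continuous f x : local_T f -> x \in `[0, l[ ->
  circle_continuous_at l f x.
Proof.
move=> hf hx e e0; have [_ _ _ /(_ x) [s1 [s2 [d hd]]]] := hf.
have [Ls1 Ls2 d0 _ _] := hd; have s10 := slope_gt0 Lgrp Ls1; have s20 := slope_gt0 Lgrp Ls2.
have s0 : 0 < s1 + s2 by exact: addr_gt0.
exists (Num.min d (e / (s1 + s2))); first by rewrite lt_min d0 divr_gt0.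
move=> y j hy; rewrite lt_min => /andP[h1 h2].
have [k E] : eqm (f y) (f x + pw s1 s2 (y - x + j%:~R * l)).
  by apply: germ_circle hd _ hy h1; move: hx; rewrite in_itv.
exists (- k); rewrite rmorphN mulNr -E.
have -> : f y - f x - (f y - (f x + pw s1 s2 (y - x + j%:~R * l))) =
  pw s1 s2 (y - x + j%:~R * l) by ring.
apply: le_lt_trans (pw_norm _ s10 s20) _.
by rewrite mulrC -ltr_pdivlMr.
Qed.

Lemma germ_differentiable f x s d : germ_data f x s s d -> 0 <= x < l ->
  circle_differentiable_at l f x.
Proof.
move=> hd hx; have [_ _ d0 _ _] := hd.
exists s => e e0; exists d => // y j hy h hh.
have [k E] : eqm (f y) (f x + pw s s h) by exact: germ_circle hd hx hy hh.
exists (- k); rewrite rmorphN mulNr -E pw_same.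
have -> : f y - f x - (f y - (f x + s * h)) - s * h = 0 by ring.
by rewrite normr0 mulr_ge0// ltW.
Qed.

Lemma local_T_nondifferentiable f : local_T f ->
  let D := [set x | (x \in `[0, l[) /\ ~ circle_differentiable_at l f x] in
  finite_set D /\ D `<=` G.
Proof.
move=> hf D; have [_ _ _ hg] := hf; split; last first.
  move=> x [xl nd]; have [s1 [s2 [d hd]]] := hg x.
  have [_ _ _ _ [//|E]] := hd; case: nd; rewrite E in hd.
  by apply: germ_differentiable hd _; move: xl; rewrite in_itv.
have [n [a [a0 an ai ap]]] := local_T_partition hf.
apply: (@sub_finite_set _ _ (a @` `I_n)); last exact/finite_image/finite_II.
move=> x [xl nd]; rewrite in_itv/= in xl.
have [|i ilt /andP[h1 h2]] := @piece_of n a x; first by rewrite a0 an.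
exists i => //; have [//|ne] := eqVneq (a i) x; exfalso; apply: nd.
have h3 : a i < x by rewrite lt_neqAle ne.
have x0 : 0 < x.
  apply: le_lt_trans h3; elim: (i) ilt => [|m IH] hm; first by rewrite a0.
  by apply: le_trans (IH (ltnW hm)) _; exact/ltW/ai/ltnW.
have [s1 [s2 [d hd]]] := hg x.
have [s Ls [b hs]] := ap i ilt.
have [e1 [e10 _ he1]] := right_formula hf hd xl.
have [|e2 [e20 _ he2]] := left_formula hf hd; first by rewrite x0 ltW//; case/andP: xl.
have fx : f x = s * x + b by apply: hs; rewrite h3.
have E1 : s1 = s.
  pose h := Num.min (e1 / 2) ((a i.+1 - x) / 2).
  have hp : 0 < h by rewrite lt_min !divr_gt0// subr_gt0.
  have hle : h <= e1 / 2 by rewrite ge_min lexx.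
  have hle2 : h <= (a i.+1 - x) / 2 by rewrite ge_min lexx orbT.
  have := he1 h; rewrite hs ?fx => [|]; last by apply/andP; split; lra.
  move=> /(_ _) E; have {}E : s * (x + h) + b = s * x + b + s1 * h.
    by apply: E; apply/andP; split; lra.
  by apply: (@mulIf _ h); rewrite ?gt_eqF//; lra.
have E2 : s2 = s.
  pose h := Num.min (e2 / 2) ((x - a i) / 2).
  have hp : 0 < h by rewrite lt_min !divr_gt0// subr_gt0.
  have hle : h <= e2 / 2 by rewrite ge_min lexx.
  have hle2 : h <= (x - a i) / 2 by rewrite ge_min lexx orbT.
  (* The constant [top (f (red x))] is not yet related to [s * x + b]; comparing [k = h] with
     [k = h / 2] eliminates it. *)
  have F k : 0 < k <= h -> s * (x - k) + b = top (f (red x)) - s2 * k.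
    move=> /andP[k0 kh]; rewrite -he2; last by apply/andP; split; lra.
    by rewrite hs//; apply/andP; split; lra.
  have := F h; have := F (h / 2).
  rewrite hp lexx/= => F1 /(_ isT) F2.
  have {}F1 : s * (x - h / 2) + b = top (f (red x)) - s2 * (h / 2).
    by apply: F1; apply/andP; split; lra.
  by apply: (@mulIf _ h); rewrite ?gt_eqF//; lra.
by rewrite E1 E2 in hd; exact: germ_differentiable hd xl.
Qed.

(** When the value is not 0, small increments do not cross the cut. A jump can thus occur only at
    the preimage of 0, which is in [G] by invariance. *)
Lemma local_T_interval_continuous f x : local_T f -> 0 <= x < l -> f x <> 0 ->
  interval_continuous_at l f x.
Proof.
move=> hf hx fx0; apply/within_cvgP => e e0.
have [_ _ _ /(_ x) [s1 [s2 [d hd]]]] := hf.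
have [Ls1 Ls2 d0 hh _] := hd; have s10 := slope_gt0 Lgrp Ls1; have s20 := slope_gt0 Lgrp Ls2.
have s0 : 0 < s1 + s2 by exact: addr_gt0.
have /andP[fx1 fx2] := local_T_range hf hx.
have fp : 0 < f x by rewrite lt_def fx1 andbT; apply/eqP.
pose m := Num.min e (Num.min (f x) (l - f x)).
have m0 : 0 < m by rewrite !lt_min e0 fp subr_gt0.
exists (Num.min d (m / (s1 + s2))); first by rewrite lt_min d0 divr_gt0.
move=> y /itv_coP hy; rewrite lt_min => /andP[h1 h2].
have E : eqm (f y) (f x + pw s1 s2 (y - x)).
  have := @germ_circle f x s1 s2 d y 0 hd hx; rewrite in_itv/= mul0r addr0.
  by apply.
have hpw : `|pw s1 s2 (y - x)| < m.
  by apply: le_lt_trans (pw_norm _ s10 s20) _; rewrite mulrC -ltr_pdivlMr.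
have := hpw; rewrite !lt_min => /and3P[p1 p2 p3].
have -> : f y = f x + pw s1 s2 (y - x).
  apply: (eqm_eq l0) E; first exact: (local_T_range hf).
  by move: p2 p3; rewrite !ltr_norml => /andP[? ?] /andP[? ?]; apply/andP; split; lra.
have -> : f x - (f x + pw s1 s2 (y - x)) = - pw s1 s2 (y - x) by ring.
by rewrite normrN.
Qed.

Lemma local_T_T_group f : local_T f -> T_group G L l f.
Proof.
move=> hf; have [hb ho hG hg] := hf; split.
- split => //.
  + have [n [a [a0 an ai ap]]] := local_T_partition hf.
    by exists n, a; split.
  + move=> x; rewrite in_itv /= => hx; apply/right_continuous_atP => e e0.
    have [s1 [s2 [d hd]]] := hg x.
    have [e1 [e10 _ he1]] := right_formula hf hd hx.
    have [Ls1 _ _ _ _] := hd; have s10 := slope_gt0 Lgrp Ls1.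
    exists (Num.min e1 (e / s1)); first by rewrite lt_min e10 divr_gt0.
    move=> y /andP[xy]; rewrite -ltrBlDl lt_min => /andP[y1 y2].
    have -> : y = x + (y - x) by ring.
    rewrite he1 ?y1 ?subr_ge0 ?ltW//.
    rewrite opprD addrA subrr sub0r normrN gtr0_norm ?mulr_gt0 ?subr_gt0//.
    by rewrite mulrC -ltr_pdivlMr.
  move=> D; have sub x : D x -> f x = 0.
    move=> [xl nc]; apply: contrapT => fx; apply: nc.
    by apply: local_T_interval_continuous => //; move: xl; rewrite in_itv.
  split; last first.
    move=> x Dx; have [xl _] := Dx; apply/(hG x xl).
    by rewrite sub//; exact: (module0 Gmod).
  have [p fp] := local_T_surj hf 0.
  apply: (@sub_finite_set _ _ [set p]); last exact: finite_set1.
  by move=> x /sub fx; apply: (local_T_inj hf); rewrite fx fp.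
- by move=> x; exact: local_T_circle_continuous.
- exact: local_T_nondifferentiable.
Qed.

End LocalToGlobal.

(** * From the interval definition of T to germs *)

Section GlobalToLocal.
Variables (R : realType) (L G : set R) (l : R).
Hypothesis Lgrp : mul_subgroup_pos L.
Hypothesis Gmod : submodule_over L G.
Hypothesis Gl : G l.
Hypothesis l0 : 0 < l.
Implicit Types (x y z h s : R) (f g : R -> R).
Local Notation red := (red l).
Local Notation eqm := (eqm l).
Local Notation local_T := (local_T L G l).

Lemma closed_eqm z :
  (forall e, 0 < e -> exists k : int, `|z + k%:~R * l| < e) -> eqm z 0.
Proof.
move=> h; suff E : red z = 0 by rewrite -E; exact/eqm_sym/red_eqm.
apply: contrapT => /eqP nz.
have z0 : 0 < red z by rewrite lt_def nz red_ge0.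
have zl := red_lt l0 z.
have m0 : 0 < Num.min (red z) (l - red z) by rewrite lt_min z0 subr_gt0.
have [k] := h _ m0; rewrite lt_min => /andP[].
have [j E] := red_eqm l z.
have -> : z + k%:~R * l = red z + (k - j)%:~R * l by rewrite rmorphB/=; lra.
have [k0|k0] := leP 0 (k - j).
  have : 0 <= (k - j)%:~R * l by rewrite mulr_ge0 ?ler0z// ltW.
  by move=> h1; rewrite ger0_norm; lra.
have : (k - j)%:~R * l <= (-1) * l by rewrite ler_pM2r// -[-1]/((-1)%:~R) ler_int; lia.
by move=> h1 _; rewrite ltr0_norm; lra.
Qed.

(** For [h] so small that [|s - t| * h <= l / 2] the integer [k] must be 0, so a derivative modulo
    [l] is an ordinary one. *)
Lemma slope_unique s t :
  (forall e, 0 < e -> exists2 d, 0 < d & forall h, 0 < h < d ->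
     exists k : int, `|(s - t) * h + k%:~R * l| <= e * h) -> s = t.
Proof.
move=> H; apply/eqP; rewrite -subr_eq0 -normr_eq0; apply/negP => /negP n0.
pose a := `|s - t|.
have a0 : 0 < a by rewrite lt_def n0 normr_ge0.
have [d d0 hd] := H (a / 2) (divr_gt0 a0 (ltr0Sn R 1)).
pose h := Num.min (d / 2) (l / (2 * a)).
have h0 : 0 < h by rewrite lt_min !divr_gt0// mulr_gt0.
have hd2 : h <= d / 2 by rewrite ge_min lexx.
have hl : a * h <= l / 2.
  have : h <= l / (2 * a) by rewrite ge_min lexx orbT.
  rewrite ler_pdivlMr ?mulr_gt0//; lra.
have [|k hk] := hd h; first by rewrite h0; lra.
have n1 : `|(s - t) * h| = a * h by rewrite normrM (gtr0_norm h0).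
have k0 : k%:~R * l = 0.
  apply: (eqm_small l0); last by exists k; rewrite subr0.
  have := ler_normB ((s - t) * h + k%:~R * l) ((s - t) * h).
  have -> : (s - t) * h + k%:~R * l - (s - t) * h = k%:~R * l by ring.
  rewrite n1 => h1; have := l0; lra.
by move: hk; rewrite k0 addr0 n1 ler_pM2r//; lra.
Qed.

Section Pieces.
Variables (f : R -> R) (n : nat) (a sl b : nat -> R).
Hypothesis hf : T_group G L l f.
Hypothesis a0 : a 0%N = 0.
Hypothesis an : a n = l.
Hypothesis ai : forall i, (i < n)%N -> a i < a i.+1.
Hypothesis Ls : forall i, (i < n)%N -> L (sl i).
Hypothesis fE : forall i, (i < n)%N -> forall x, a i < x < a i.+1 -> f x = sl i * x + b i.

Let frange x : 0 <= x < l -> 0 <= f x < l.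
Proof.
by move=> hx; have [[[h _ _] _ _ _ _] _ _] := hf; apply/itv_coP/h/itv_coP.
Qed.

Let a_ge0 i : (i <= n)%N -> 0 <= a i.
Proof.
elim: i => [|i IH] h; first by rewrite a0.
by apply: le_trans (IH (ltnW h)) _; apply/ltW/ai.
Qed.

Let a_le i : (i <= n)%N -> a i <= l.
Proof.
move=> h; rewrite -an; have : (n <= n)%N by [].
elim: {-3}n h => [|m IH]; first by rewrite leqn0 => /eqP ->.
rewrite leq_eqVlt => /orP[/eqP ->//|im mn].
by apply: le_trans (IH im (ltnW mn)) _; apply/ltW/ai.
Qed.

(** Right continuity extends the affine formula to the left endpoint. *)
Lemma right_value x i : (i < n)%N -> a i <= x < a i.+1 -> f x = sl i * x + b i.
Proof.
move=> ilt /andP[h1 h2].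
have [h3|h3] := ltP (a i) x; first by apply: fE => //; rewrite h3.
have x0 : 0 <= x by apply: le_trans h1; exact/a_ge0/ltnW.
have xl : x < l by apply: lt_le_trans h2 (a_le ilt).
have [[_ _ _ hr _] _ _] := hf.
have /right_continuous_atP hr' := hr x ltac:(by rewrite in_itv/= x0).
apply/eqP; rewrite -subr_eq0 -normr_eq0; apply/negP => /negP n0.
pose c := `|f x - (sl i * x + b i)|.
have c0 : 0 < c by rewrite lt_def n0 normr_ge0.
have [d d0 hd] := hr' (c / 2) (divr_gt0 c0 (ltr0Sn R 1)).
have s0 := slope_gt0 Lgrp (Ls ilt).
pose h := Num.min (d / 2) (Num.min ((a i.+1 - x) / 2) (c / (2 * sl i))).
have hp : 0 < h by rewrite !lt_min !divr_gt0 ?mulr_gt0// subr_gt0.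
have q1 : h <= d / 2 by rewrite ge_min lexx.
have q2 : h <= (a i.+1 - x) / 2 by rewrite !ge_min lexx orbT.
have q3 : sl i * h <= c / 2.
  have : h <= c / (2 * sl i) by rewrite !ge_min lexx !orbT.
  rewrite ler_pdivlMr ?mulr_gt0//; lra.
have := hd (x + h) ltac:(apply/andP; split; lra).
have -> : f (x + h) = sl i * (x + h) + b i.
  by apply: (fE ilt); apply/andP; split; lra.
have -> : f x - (sl i * (x + h) + b i) = (f x - (sl i * x + b i)) - sl i * h by ring.
have := lerB_dist (f x - (sl i * x + b i)) (sl i * h).
have sh0 := mulr_gt0 s0 hp.
by rewrite -/c (gtr0_norm sh0); lra.
Qed.

Lemma right_piece x i : (i < n)%N -> a i <= x < a i.+1 ->
  exists2 d, 0 < d & forall h, 0 <= h < d -> f (x + h) = f x + sl i * h.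
Proof.
move=> ilt hx; have fx := right_value ilt hx; case/andP: hx => h1 h2.
exists (a i.+1 - x); first by rewrite subr_gt0.
move=> h /andP[h0 hd]; rewrite le_eqVlt in h0; case/orP: h0 => [/eqP <-|h0].
  by rewrite addr0 mulr0 addr0.
have -> : f (x + h) = sl i * (x + h) + b i.
  by apply: (fE ilt); apply/andP; split; lra.
by rewrite fx; ring.
Qed.

(** Continuity on the circle identifies the limit from the left, though only modulo [l]; [red x]
    covers [x = l], which is the point 0 of the circle. *)
Lemma left_piece x i : (i < n)%N -> a i < x <= a i.+1 ->
  eqm (sl i * x + b i) (f (red x)) /\
  exists2 d, 0 < d <= x & forall h, 0 < h < d -> f (x - h) = sl i * (x - h) + b i.
Proof.
move=> ilt /andP[h1 h2].
have a00 : 0 <= a i by exact/a_ge0/ltnW.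
have xl : x <= l by apply: le_trans h2 (a_le ilt).
have formula h : 0 < h < x - a i -> f (x - h) = sl i * (x - h) + b i.
  by move=> /andP[q1 q2]; apply: (fE ilt); apply/andP; split; lra.
split; last by exists (x - a i) => //; apply/andP; split; lra.
suff [k E] : eqm (sl i * x + b i - f (red x)) 0 by exists k; rewrite -E subr0.
apply: closed_eqm => e e0; have [_ hc _] := hf.
have [d d0 hd] := hc (red x) (red_in l0 x) (e / 2) (divr_gt0 e0 (ltr0Sn R 1)).
have s0 := slope_gt0 Lgrp (Ls ilt).
pose h := Num.min (d / 2) (Num.min ((x - a i) / 2) (e / (2 * sl i))).
have hp : 0 < h by rewrite !lt_min !divr_gt0 ?mulr_gt0// subr_gt0.
have q1 : h <= d / 2 by rewrite ge_min lexx.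
have q2 : h <= (x - a i) / 2 by rewrite !ge_min lexx orbT.
have q3 : sl i * h <= e / 2.
  have : h <= e / (2 * sl i) by rewrite !ge_min lexx !orbT.
  rewrite ler_pdivlMr ?mulr_gt0//; lra.
have [j Ej] := red_eqm l x.
have [||k] := hd (x - h) j.
- by rewrite in_itv/=; apply/andP; split; lra.
- have -> : x - h - red x + j%:~R * l = - h by rewrite -Ej; ring.
  by rewrite normrN gtr0_norm//; lra.
rewrite formula; last by apply/andP; split; lra.
move=> hk; exists k.
have -> : sl i * x + b i - f (red x) + k%:~R * l =
  (sl i * (x - h) + b i - f (red x) + k%:~R * l) + sl i * h by ring.
apply: le_lt_trans (ler_normD _ _) _.
by rewrite (gtr0_norm (mulr_gt0 s0 hp)); lra.
Qed.

(** [z] is the point [x] as seen from its left: it is [l] when [x] is 0. Outside [G] the map is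
    differentiable on the circle, which forces both slopes to agree. *)
Lemma two_sided_germ x i j z : (i < n)%N -> a i <= x < a i.+1 ->
  (j < n)%N -> a j < z <= a j.+1 -> eqm z x ->
  exists d, germ_data L G l f x (sl i) (sl j) d.
Proof.
move=> ilt hi jlt hj zx.
have x0 : 0 <= x by case/andP: hi => + _; apply: le_trans; exact/a_ge0/ltnW.
have xl : x < l by case/andP: hi => _ h; apply: lt_le_trans h (a_le ilt).
have xr : 0 <= x < l by rewrite x0.
have [d1 d10 hd1] := right_piece ilt hi.
have [ez [d2 /andP[d20 d2z] hd2]] := left_piece jlt hj.
have zl : z <= l by case/andP: hj => _ h; apply: le_trans h (a_le jlt).
have rz : red z = x by rewrite (eqm_redP l0 zx) red_id.
rewrite rz in ez.
pose d := Num.min d1 (Num.min d2 (l - x)).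
have dp : 0 < d by rewrite !lt_min d10 d20 subr_gt0.
have F h : `|h| < d -> eqm (f (red (x + h))) (f (red x) + pw (sl i) (sl j) h).
  rewrite (red_id l0 xr) !lt_min => /and3P[q1 q2 q3].
  rewrite /pw; case: ifP => h0.
    rewrite (ger0_norm h0) in q1 q2 q3.
    rewrite red_id//; last by apply/andP; split; lra.
    by rewrite hd1 ?h0//; exact: eqm_refl.
  have {}h0 : h < 0 by rewrite ltNge h0.
  rewrite (ltr0_norm h0) in q1 q2 q3.
  have -> : red (x + h) = z - (- h).
    rewrite -(red_id l0 (x := z - (- h))); last by apply/andP; split; lra.
    by apply: (eqm_redP l0); rewrite opprK; apply: eqmDr; exact: eqm_sym.
  rewrite hd2; last by apply/andP; split; lra.
  have -> : sl j * (z - - h) + b j = (sl j * z + b j) + sl j * h by ring.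
  exact: eqmDr.
exists d; split => //; [exact: Ls|exact: Ls|].
have [Gx|nGx] := pselect (G x); [by left|right].
have [_ _ [_ DG]] := hf.
have xin : x \in `[0, l[ by rewrite in_itv.
have [s hs] : circle_differentiable_at l f x.
  by apply: contrapT => nd; apply: nGx; apply: DG; split.
have key h e d' : `|h| < d -> `|h| < d' -> (forall y (j : int), y \in `[0, l[ ->
      let h := y - x + j%:~R * l in `|h| < d' ->
      exists k : int, `|f y - f x + k%:~R * l - s * h| <= e * `|h|) ->
    exists k : int, `|pw (sl i) (sl j) h - s * h + k%:~R * l| <= e * `|h|.
  move=> hd hd' H.
  have [m Em] := red_eqm l (x + h).
  have eh : red (x + h) - x + (- m)%:~R * l = h by rewrite rmorphN/= mulNr -Em; ring.
  have [|k] := H (red (x + h)) (- m) (red_in l0 _); rewrite eh// => hk.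
  have [p Ep] := F h hd; rewrite (red_id l0 xr) in Ep.
  exists (k + p); congr (`|_| <= _): hk.
  by rewrite rmorphD/= mulrDl -Ep; ring.
have E1 : sl i = s.
  apply: slope_unique => e e0; have [d' d'0 hd'] := hs e e0.
  exists (Num.min d d'); first by rewrite lt_min dp.
  move=> h; rewrite lt_min => /and3P[h0 hh1 hh2].
  have := key h e d'; rewrite !(gtr0_norm h0) => /(_ hh1 hh2 hd').
  by rewrite /pw (ltW h0) mulrBl.
have E2 : sl j = s.
  apply: slope_unique => e e0; have [d' d'0 hd'] := hs e e0.
  exists (Num.min d d'); first by rewrite lt_min dp.
  move=> h; rewrite lt_min => /and3P[h0 hh1 hh2].
  have := key (- h) e d'; rewrite !normrN !(gtr0_norm h0) => /(_ hh1 hh2 hd')[k].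
  have -> : pw (sl i) (sl j) (- h) = sl j * (- h).
    by rewrite /pw lt_geF ?oppr_lt0.
  move=> hk; exists (- k).
  rewrite -normrN; congr (`|_| <= _): hk.
  by rewrite rmorphN/=; ring.
by rewrite E1.
Qed.

(** Modulo [l] the offsets differ by (sl_(i+1) - sl_i) a_(i+1). This is in [G] since either the node
    is in [G] or the two slopes agree, the latter covering nodes outside [G]. *)
Lemma junction_offset i : (i.+1 < n)%N -> G (b i) <-> G (b i.+1).
Proof.
move=> ilt; have ilt' := ltnW ilt.
have hr : a i.+1 <= a i.+1 < a i.+2 by rewrite lexx ai.
have hl : a i < a i.+1 <= a i.+1 by rewrite lexx ai.
have [d [_ _ _ _ hG]] := two_sided_germ ilt hr ilt' hl (eqm_refl l _).
have [he _] := left_piece ilt' hl.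
have xl : 0 <= a i.+1 < l.
  by rewrite a_ge0 ?(ltnW ilt)//=; apply: lt_le_trans (a_le ilt); exact: ai.
rewrite (red_id l0 xl) (right_value ilt hr) in he.
have {}he : eqm (b i) (b i.+1 + (sl i.+1 - sl i) * a i.+1).
  by case: he => k Ek; exists k; rewrite -Ek; ring.
have hb : G ((sl i.+1 - sl i) * a i.+1).
  case: hG => [Ga|->]; last by rewrite subrr mul0r; exact: (module0 Gmod).
  by rewrite mulrBl; apply: (moduleB Gmod); apply: (moduleZ Gmod) => //; apply: Ls.
split=> h.
  have := moduleB Gmod (module_eqm Gmod Gl he h) hb.
  by rewrite addrK.
apply: (module_eqm Gmod Gl (eqm_sym he)).
exact: (moduleD Gmod).
Qed.

Lemma offset_in : (exists2 i, (i < n)%N & G (b i)) -> forall i, (i < n)%N -> G (b i).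
Proof.
move=> [j jlt Gj].
have E i : (i < n)%N -> G (b i) <-> G (b 0%N).
  elim: i => [//|i IH] h; have [h1 h2] := junction_offset h.
  by have [h3 h4] := IH (ltnW h); split=> ?; [apply/h3/h2|apply/h1/h4].
by move=> i ilt; apply/(E i ilt)/(E j jlt).
Qed.

Lemma left_piece_of z : 0 < z <= l -> exists2 j, (j < n)%N & a j < z <= a j.+1.
Proof.
rewrite -{1}a0 -an; elim: n => [|m IH] /andP[z0 zn]; first by lra.
have [h|h] := ltP (a m) z; first by exists m => //; rewrite h.
have [|i ilt hi] := IH; first by rewrite z0.
by exists i => //; exact: ltnW.
Qed.

(** If [p > 0], the limit [c] from the left is congruent to 0 and lies in (0, l], so it is [l] while
    [f p = 0]: [f] jumps at [p], and jumps of elements of V lie in [G]. *)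
Lemma preimage0_in p : 0 <= p < l -> f p = 0 -> G p.
Proof.
move=> hp fp; have [[_ _ _ _ [_ DG]] _ _] := hf.
have [->|p0] := eqVneq p 0; first exact: (module0 Gmod).
have pp : 0 < p by rewrite lt_def p0; case/andP: hp.
have pl : p <= l by case/andP: hp => _ /ltW.
have [|j jlt hj] := @left_piece_of p; first by rewrite pp.
apply: DG; split; first by rewrite in_itv.
move=> /within_cvgP /(_ (l / 2) (divr_gt0 l0 (ltr0Sn R 1)))[d d0 hd].
have [he [d' /andP[d'0 d'p] hd']] := left_piece jlt hj.
rewrite (red_id l0 hp) fp in he.
have s0 := slope_gt0 Lgrp (Ls jlt).
pose c := sl j * p + b j.
have val h : 0 < h < d' -> f (p - h) = c - sl j * h.
  by move=> /hd' ->; rewrite /c; ring.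
have cl : c = l.
  pose h := d' / 2; have h0 : 0 < h by rewrite divr_gt0.
  have r1 : 0 <= p - h < l by rewrite /h; case/andP: hp => ? ?; apply/andP; split; lra.
  have := frange r1; rewrite val; last by rewrite /h; apply/andP; split; lra.
  have sh := mulr_gt0 s0 h0 => /andP[q1 q2].
  have cp : 0 < c by lra.
  have cl' : c <= l.
    rewrite leNgt; apply/negP => lc.
    pose k := Num.min (d' / 2) ((c - l) / (2 * sl j)).
    have kp : 0 < k by rewrite lt_min !divr_gt0 ?mulr_gt0// subr_gt0.
    have k1 : k <= d' / 2 by rewrite ge_min lexx.
    have k2 : sl j * k <= (c - l) / 2.
      have : k <= (c - l) / (2 * sl j) by rewrite ge_min lexx orbT.
      rewrite ler_pdivlMr ?mulr_gt0//; lra.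
    have r2 : 0 <= p - k < l by case/andP: hp => ? ?; apply/andP; split; lra.
    by have := frange r2; rewrite val; [case/andP => ? ?; lra|apply/andP; split; lra].
  have [c1|c1] := eqVneq c l; first by [].
  have : c = 0; last by move=> c2; rewrite c2 ltxx in cp.
  apply: (eqm_small l0) => //; rewrite gtr0_norm//.
  by rewrite lt_neqAle c1.
pose h := Num.min (d / 2) (Num.min (d' / 2) (l / (2 * sl j))).
have hp0 : 0 < h by rewrite !lt_min !divr_gt0 ?mulr_gt0.
have q1 : h <= d / 2 by rewrite ge_min lexx.
have q2 : h <= d' / 2 by rewrite !ge_min lexx orbT.
have q3 : sl j * h <= l / 2.
  have : h <= l / (2 * sl j) by rewrite !ge_min lexx !orbT.
  rewrite ler_pdivlMr ?mulr_gt0//; lra.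
have hlt : `|f p - f (p - h)| < l / 2.
  apply: hd; first by apply/itv_coP; case/andP: hp => ? ?; apply/andP; split; lra.
  have -> : p - h - p = - h by ring.
  by rewrite normrN gtr0_norm//; lra.
move: hlt; rewrite fp sub0r normrN val; last by apply/andP; split; lra.
by rewrite cl ger0_norm => [?|]; lra.
Qed.

End Pieces.

Lemma germ_red f x : germ L G l f (red x) -> germ L G l f x.
Proof.
move=> [s1 [s2 [d [Ls1 Ls2 d0 hd hG]]]]; exists s1, s2, d; split => //.
  move=> h hh; have := hd h hh.
  rewrite (red_id l0 (x := red x)) ?red_ge0 ?red_lt//.
  have -> : red (x + h) = red (red x + h); last by [].
  by apply: (eqm_redP l0); apply: eqmDr; exact/eqm_sym/red_eqm.
by case: hG => [/(module_red Gmod Gl) ?|?]; [left|right].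
Qed.

Lemma T_group_local_T f : T_group G L l f -> local_T f.
Proof.
move=> hf; have [[hb ho [n [a [a0 an ai hp]]] hr hV] hc hd] := hf.
have /choice[sb hsb] : forall i, exists sb : R * R, (i < n)%N -> L sb.1 /\
    forall x, a i < x < a i.+1 -> f x = sb.1 * x + sb.2.
  move=> i; have [ilt|] := ltnP i n; last by exists (0, 0).
  by have [s Ls [b fE]] := hp i ilt; exists (s, b).
pose sl i := (sb i).1; pose b i := (sb i).2.
have Ls i : (i < n)%N -> L (sl i) by move=> /hsb[].
have fE i : (i < n)%N -> forall x, a i < x < a i.+1 -> f x = sl i * x + b i.
  by move=> /hsb[].
have piece x : 0 <= x < l -> exists2 i, (i < n)%N & a i <= x < a i.+1.
  by move=> hx; apply: piece_of; rewrite a0 an.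
have [p hpl fp] : exists2 p, 0 <= p < l & f p = 0.
  case: hb => _ _ /(_ 0)[|p /itv_coP hpl fp]; first by apply/itv_coP; rewrite lexx.
  by exists p.
(* The piece through the zero [p] has offset [- (sl i * p)], which is in [G], and the junctions
   carry this to all pieces. Invariance of [G] follows from [f x = sl i * x + b i]. *)
have Gb : forall i, (i < n)%N -> G (b i).
  apply: (offset_in hf a0 an ai Ls fE).
  have Gp := preimage0_in hf a0 an ai Ls fE hpl fp.
  have [i ilt hi] := piece p hpl; exists i => //.
  have := right_value hf a0 an ai Ls fE ilt hi; rewrite fp => E.
  have -> : b i = - (sl i * p) by apply/eqP; rewrite -addr_eq0 addrC -E.
  by apply: (moduleN Gmod); apply: (moduleZ Gmod) => //; exact: Ls.
split => //.
  move=> x; rewrite in_itv /= => hx; have [i ilt hi] := piece x hx.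
  rewrite (right_value hf a0 an ai Ls fE ilt hi).
  have s0 := slope_gt0 Lgrp (Ls i ilt).
  split=> h; first by apply: (moduleD Gmod); [apply: (moduleZ Gmod) => //; exact: Ls|exact: Gb].
  have -> : x = (sl i)^-1 * ((sl i * x + b i) - b i) by field; rewrite gt_eqF.
  apply: (moduleZ Gmod); first exact/(slopeV Lgrp)/Ls.
  by apply: (moduleB Gmod) => //; exact: Gb.
move=> y; apply: germ_red; set x := red y.
have hx : 0 <= x < l by rewrite red_ge0// red_lt.
pose z := if x == 0 then l else x.
have zx : eqm z x.
  rewrite /z; case: eqP => [->|_]; last exact: eqm_refl.
  by exists 1; rewrite subr0 mul1r.
have hz : 0 < z <= l.
  rewrite /z; case: eqVneq => [_|ne]; first by rewrite l0 lexx.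
  by case/andP: hx => h1 h2; rewrite lt_def ne h1 ltW.
have [i ilt hi] := piece x hx.
have [j jlt hj] := left_piece_of a0 an hz.
have [d hg] := two_sided_germ hf a0 an ai Ls fE ilt hi jlt hj zx.
by exists (sl i), (sl j), d.
Qed.

End GlobalToLocal.

(** * The stabiliser F, rotations and bumps *)

Section ThompsonElements.
Variables (R : realType) (L G : set R) (l : R).
Hypothesis Lgrp : mul_subgroup_pos L.
Hypothesis Gmod : submodule_over L G.
Hypothesis Gl : G l.
Hypothesis l0 : 0 < l.
Implicit Types (x y z h s : R) (f g : R -> R).
Local Notation red := (red l).
Local Notation eqm := (eqm l).
Local Notation local_T := (local_T L G l).

Lemma T_groupP f : T_group G L l f <-> local_T f.
Proof. by split=> h; [exact: T_group_local_T|exact: local_T_T_group]. Qed.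

Lemma extend_endpoint_continuous f : local_T f -> f 0 = 0 ->
  {within `[0, l], continuous (extend_endpoint l f)}.
Proof.
move=> hf f0; apply/subspace_continuousP => x; rewrite /= in_itv /= => /andP[x0 xl].
apply/within_cvgP => e e0.
have [_ _ _ /(_ x)[s1 [s2 [d hd]]]] := hf.
have [Ls1 Ls2 _ _ _] := hd; have s10 := slope_gt0 Lgrp Ls1; have s20 := slope_gt0 Lgrp Ls2.
have [dr dr0 hr] : exists2 d, 0 < d & forall y, x <= y < x + d -> y <= l ->
    `|extend_endpoint l f x - extend_endpoint l f y| < e.
  have [h|h] := ltP x l; last first.
    exists 1 => // y /andP[xy _] yl; have -> : y = x by lra.
    by rewrite subrr normr0.
  have [|e1 [e10 e1l he1]] := right_formula Lgrp l0 hf hd; first by rewrite x0.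
  exists (Num.min e1 (e / s1)); first by rewrite lt_min e10 divr_gt0.
  move=> y /andP[xy]; rewrite -ltrBlDl lt_min => /andP[y1 y2] yl.
  rewrite /extend_endpoint h ifT; last by lra.
  have {1}-> : y = x + (y - x) by ring.
  rewrite he1; last by rewrite y1 subr_ge0 xy.
  rewrite opprD addrA subrr sub0r normrN normrM (gtr0_norm s10) ger0_norm ?subr_ge0//.
  by rewrite mulrC -ltr_pdivlMr.
have [dl dl0 hl] : exists2 d, 0 < d & forall y, x - d < y < x -> 0 <= y ->
    `|extend_endpoint l f x - extend_endpoint l f y| < e.
  have [h|h] := ltP 0 x; last first.
    by exists 1 => // y /andP[_ xy] y0; exfalso; lra.
  have [|e1 [e10 e1l he1]] := left_formula Lgrp l0 hf hd; first by rewrite h.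
  exists (Num.min e1 (e / s2)); first by rewrite lt_min e10 divr_gt0.
  move=> y /andP[]; rewrite ltrBlDl -ltrBlDr lt_min => /andP[y1 y2] xy y0.
  have -> : extend_endpoint l f x = top l (f (red x)).
    rewrite /extend_endpoint /top; case: ltP => h1.
      rewrite red_id ?x0//; case: eqVneq => // fx.
      by move: h; rewrite (local_T_inj hf (etrans fx (esym f0))) ltxx.
    have -> : x = l by lra.
    have -> : red l = 0; last by rewrite f0 eqxx.
    rewrite -(red_id l0 (x := 0)) ?lexx//.
    by apply: (eqm_redP l0); exists 1; rewrite subr0 mul1r.
  rewrite /extend_endpoint ifT; last by lra.
  have -> : y = x - (x - y) by ring.
  rewrite he1; last by apply/andP; split; lra.
  have -> : top l (f (red x)) - (top l (f (red x)) - s2 * (x - y)) = s2 * (x - y) by ring.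
  rewrite normrM (gtr0_norm s20) ger0_norm ?subr_ge0 ?ltW//.
  by rewrite mulrC -ltr_pdivlMr.
exists (Num.min dr dl); first by rewrite lt_min dr0.
move=> y; rewrite /= in_itv/= => /andP[y0 yl]; rewrite lt_min.
move=> /andP[/ltr_normlP[r1 r2] /ltr_normlP[r3 r4]].
suff : `|extend_endpoint l f x - extend_endpoint l f y| < e by [].
have [h|h] := leP x y; first by apply: (hr y _ yl); apply/andP; split; lra.
by apply: (hl y _ y0); apply/andP; split; lra.
Qed.

(** A zero [p > 0] is impossible in F: [f] would tend to [l] from the left of [p] while [f p = 0],
    against continuity of the extension to [0, l]. *)
Lemma F_groupP f : F_group G L l f <-> local_T f /\ f 0 = 0.
Proof.
split=> [[/T_groupP hf [hb hc _]]|[hf f0]].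
  split=> //; have [p fp] := local_T_surj hf 0.
  have hp : 0 <= p < l by apply: (local_T_range_inv hf); rewrite fp lexx.
  have [p0|p0] := eqVneq p 0; first by rewrite -{1}p0.
  have pp : 0 < p by rewrite lt_def p0; case/andP: hp.
  have [_ _ _ /(_ p)[s1 [s2 [d hd]]]] := hf.
  have [|e1 [e10 e1l he1]] := left_formula Lgrp l0 hf hd.
    by rewrite pp ltW//; case/andP: hp.
  exfalso; move/subspace_continuousP : hc => /(_ p).
  have pl : p < l by case/andP: hp.
  rewrite /= in_itv /= (ltW pp) (ltW pl) => /(_ isT)/within_cvgP.
  move=> /(_ (l / 2) (divr_gt0 l0 (ltr0Sn R 1)))[d' d'0 hd'].
  have [_ Ls2 _ _ _] := hd; have s20 := slope_gt0 Lgrp Ls2.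
  pose h := Num.min (d' / 2) (Num.min (e1 / 2) (l / (2 * s2))).
  have h0 : 0 < h by rewrite !lt_min !divr_gt0 ?mulr_gt0.
  have q1 : h <= d' / 2 by rewrite ge_min lexx.
  have q2 : h <= e1 / 2 by rewrite !ge_min lexx orbT.
  have q3 : s2 * h <= l / 2.
    have : h <= l / (2 * s2) by rewrite !ge_min lexx !orbT.
    rewrite ler_pdivlMr ?mulr_gt0//; lra.
  have hlt : `|extend_endpoint l f p - extend_endpoint l f (p - h)| < l / 2.
    apply: hd'; first by rewrite /= in_itv/=; apply/andP; split; lra.
    have -> : p - h - p = - h by ring.
    by rewrite normrN gtr0_norm//; lra.
  move: hlt; rewrite /extend_endpoint pl ifT; last by lra.
  rewrite he1; last by apply/andP; split; lra.
  rewrite (red_id l0 hp) fp /top eqxx sub0r normrN ger0_norm; lra.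
have [g hg [fK gK]] := local_T_inv Lgrp Gmod Gl l0 hf.
have g0 : g 0 = 0 by rewrite -{1}f0 fK.
have eK f1 f2 x : local_T f1 -> cancel f1 f2 -> 0 <= x <= l ->
    extend_endpoint l f2 (extend_endpoint l f1 x) = x.
  move=> h1 h2 /andP[x0 xl]; rewrite /extend_endpoint.
  case: (ltP x l) => h; last by rewrite ltxx; lra.
  have hx : 0 <= x < l by rewrite x0.
  by have /andP[_ ->] := local_T_range h1 hx.
have er f1 x : local_T f1 -> 0 <= x <= l -> 0 <= extend_endpoint l f1 x <= l.
  move=> h1 /andP[x0 xl]; rewrite /extend_endpoint; case: (ltP x l) => h.
    have hx : 0 <= x < l by rewrite x0.
    by have /andP[-> /ltW ->] := local_T_range h1 hx.
  by rewrite lexx ltW.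
split; first exact/T_groupP; split.
- split.
  + by move=> x; rewrite /= !in_itv /=; exact: er.
  + move=> x y /set_mem; rewrite /= in_itv/= => hx /set_mem; rewrite /= in_itv/= => hy E.
    by rewrite -(eK _ _ _ hf fK hx) E (eK _ _ _ hf fK hy).
  + move=> y; rewrite /= in_itv /= => hy; exists (extend_endpoint l g y).
      by rewrite /= in_itv /=; exact: er.
    exact: eK hg gK hy.
- exact: extend_endpoint_continuous.
exists (extend_endpoint l g); split; first exact: extend_endpoint_continuous.
by move=> x; rewrite /= in_itv/=; exact: eK hf fK.
Qed.

Definition rot c x := if 0 <= x < l then red (x + c) else x.

Lemma rotE c x : 0 <= x < l -> rot c x = red (x + c).
Proof. by rewrite /rot => ->. Qed.

Lemma rotK c : cancel (rot c) (rot (- c)).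
Proof.
move=> x; rewrite {2}/rot; case: ifP => hx; last by rewrite /rot hx.
rewrite rotE ?red_ge0 ?red_lt// -[RHS](red_id l0 hx); apply: (eqm_redP l0).
by have := eqmDr (- c) (red_eqm l (x + c)); rewrite addrK.
Qed.

Lemma rot_range c x : 0 <= rot c x < l <-> 0 <= x < l.
Proof. by rewrite /rot; case: ifP => [_|->//]; rewrite red_ge0 ?red_lt. Qed.

Lemma rot_local_T c : G c -> local_T (rot c).
Proof.
move=> Gc; split.
- apply: local_T_bij.
  + by move=> x /rot_range.
  + exact: can_inj (@rotK c).
  + by move=> y; exists (rot (- c) y); rewrite -{1}[c]opprK rotK.
  + by move=> x /rot_range.
- by move=> x; rewrite in_itv /= /rot => /negbTE ->.
- move=> x; rewrite in_itv/= => hx; rewrite rotE//; split=> h.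
    by apply/(module_red Gmod Gl); apply: (moduleD Gmod).
  have -> : x = (x + c) - c by rewrite addrK.
  by apply: (moduleB Gmod) => //; apply/(module_red Gmod Gl).
move=> x; exists 1, 1, 1; split; try exact: (slope1 Lgrp); last by right.
  exact: ltr01.
move=> h _; rewrite !rotE ?red_ge0 ?red_lt// pw_same mul1r.
apply: eqm_trans (red_eqm _ _) _; apply: eqm_trans (eqmDr c (red_eqm _ _)) _.
apply: eqm_sym; apply: eqm_trans (eqmDr h (red_eqm _ _)) _.
by rewrite addrAC; apply: eqmDr; apply: eqmDr; exact: red_eqm.
Qed.

(* The break points 0, a and (1 + e) a are in G for all a in G and e in L, so that
   no divisibility condition on the lengths is needed. *)
Definition bump a e x := if x < 0 then x else if x < a then e * x
  else if x < (1 + e) * a then e * a + (x - a) / e else x.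

Section Bump.
Variables (a e : R).
Hypothesis a0 : 0 < a.
Hypothesis e0 : 0 < e.

Let ea0 : 0 < e * a. Proof. exact: mulr_gt0. Qed.

Lemma bump1 x : 0 <= x <= a -> bump a e x = e * x.
Proof.
have ea0' := ea0; have a0' := a0.
move=> /andP[x0 xa]; rewrite /bump ltNge x0 /=; case: ltP => // h.
have -> : x = a by lra.
rewrite ifT; first by rewrite subrr mul0r addr0.
lra.
Qed.

Lemma bump2 x : a <= x <= (1 + e) * a -> bump a e x = e * a + (x - a) / e.
Proof.
have ea0' := ea0; have a0' := a0.
move=> /andP[x0 xa]; rewrite /bump ifF; last by apply/negbTE; rewrite -leNgt; lra.
rewrite ltNge x0 /=; case: ltP => // h.
have -> : x = (1 + e) * a by lra.
by field; rewrite gt_eqF.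
Qed.

Lemma bump3 x : (1 + e) * a <= x -> bump a e x = x.
Proof.
have ea0' := ea0; have a0' := a0.
move=> hx; rewrite /bump ifF; last by apply/negbTE; rewrite -leNgt; lra.
rewrite ifF; last by apply/negbTE; rewrite -leNgt; lra.
by rewrite ltNge hx.
Qed.

Lemma bump0 x : x <= 0 -> bump a e x = x.
Proof.
rewrite /bump; case: ltP => // h1 h2; have -> : x = 0 by lra.
by rewrite a0 mulr0.
Qed.

End Bump.

Lemma bump_case a e x : 0 < a -> 0 < e ->
  [\/ x <= 0, 0 <= x <= a, a <= x <= (1 + e) * a | (1 + e) * a <= x].
Proof.
move=> a0 e0; have [h1|h1] := leP x 0; first by constructor 1.
have [h2|h2] := leP x a; first by constructor 2; rewrite ltW.
have [h3|h3] := leP x ((1 + e) * a); first by constructor 3; rewrite ltW.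
by constructor 4; rewrite ltW.
Qed.

(** Inverting exchanges the lengths a and e a of the two linear pieces and keeps their sum. *)
Lemma bumpK a e : 0 < a -> 0 < e -> cancel (bump a e) (bump (e * a) e^-1).
Proof.
move=> a0 e0 x; have i0 : 0 < e^-1 by rewrite invr_gt0.
have ea0 : 0 < e * a by exact: mulr_gt0.
have E : (1 + e^-1) * (e * a) = (1 + e) * a by field; rewrite gt_eqF.
have [h|h|h|h] := bump_case x a0 e0.
- by rewrite bump0// bump0.
- case/andP: (h) => h1 h2.
  rewrite (bump1 a0 e0 h) bump1//; first by rewrite mulKf// gt_eqF.
  by rewrite mulr_ge0 ?(ltW e0)//= ler_pM2l.
- case/andP: (h) => h1 h2.
  rewrite (bump2 a0 e0 h) bump2//; first by field; rewrite gt_eqF.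
  rewrite E lerDl divr_ge0 ?subr_ge0 ?(ltW e0)//=.
  have -> : (1 + e) * a = e * a + a by ring.
  by rewrite lerD2l ler_pdivrMr//; lra.
- by rewrite bump3// bump3// E.
Qed.

Lemma bump_range a e x : 0 < a -> 0 < e -> (1 + e) * a < l ->
  0 <= x < l -> 0 <= bump a e x < l.
Proof.
move=> a0 e0 al /andP[x0 xl]; have ea0 : 0 < e * a by exact: mulr_gt0.
have [h|h|h|h] := bump_case x a0 e0.
- by rewrite bump0// x0.
- case/andP: (h) => h1 h2.
  rewrite (bump1 a0 e0 h); have := ler_wpM2l (ltW e0) h2; have := mulr_ge0 (ltW e0) h1.
  by move=> ? ?; apply/andP; split; lra.
- case/andP: (h) => h1 h2.
  rewrite (bump2 a0 e0 h).
  have : 0 <= (x - a) / e by rewrite divr_ge0 ?subr_ge0// ltW.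
  have : (x - a) / e <= a by rewrite ler_pdivrMr//; lra.
  by move=> ? ?; apply/andP; split; lra.
- by rewrite bump3// x0.
Qed.

Lemma bump_local_T a e : L e -> G a -> 0 < a -> (1 + e) * a < l -> local_T (bump a e).
Proof.
move=> Le Ga a0 al; have e0 := slope_gt0 Lgrp Le.
have i0 : 0 < e^-1 by rewrite invr_gt0.
have ea0 : 0 < e * a by exact: mulr_gt0.
have E : (1 + e^-1) * (e * a) = (1 + e) * a by field; rewrite gt_eqF.
have K := bumpK a0 e0.
have K' : cancel (bump (e * a) e^-1) (bump a e).
  have := bumpK ea0 i0; rewrite invrK.
  by have -> : e^-1 * (e * a) = a by rewrite mulKf// gt_eqF.
have Li := slopeV Lgrp Le.
have Gea : G (e * a) by apply: (moduleZ Gmod).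
have Gc : G ((1 + e) * a) by rewrite mulrDl mul1r; apply: (moduleD Gmod).
have al' : (1 + e^-1) * (e * a) < l by rewrite E.
split.
- apply: local_T_bij.
  + by move=> x; exact: bump_range.
  + exact: can_inj K.
  + by move=> y; exists (bump (e * a) e^-1 y).
  + by move=> x hx; rewrite -(K x); exact: bump_range.
- move=> x; rewrite in_itv/= => hx; have [h|h] := ltP x 0; first by rewrite bump0// ltW.
  rewrite bump3//; move: hx; rewrite h/= -leNgt; lra.
- have GG b c x : L c -> G b -> 0 < b -> G x -> G (bump b c x).
    move=> Lc Gb b0 Gx; have c0 := slope_gt0 Lgrp Lc.
    have [h|h|h|h] := bump_case x b0 c0.
    + by rewrite bump0.
    + by rewrite bump1//; apply: (moduleZ Gmod).
    + rewrite bump2//; apply: (moduleD Gmod); first exact: (moduleZ Gmod).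
      by rewrite mulrC; apply: (moduleZ Gmod); [exact: (slopeV Lgrp)|exact: (moduleB Gmod)].
    + by rewrite bump3.
  move=> x _; split=> h; first exact: GG.
  by rewrite -(K x); apply: GG.
move=> y; apply: germ_red => //; set x := red y.
have hx : 0 <= x < l by rewrite red_ge0// red_lt.
have germ_in s1 s2 d : L s1 -> L s2 -> 0 < d -> G x \/ s1 = s2 ->
    (forall h, `|h| < d -> 0 <= x + h < l /\ bump a e (x + h) = bump a e x + pw s1 s2 h) ->
    germ L G l (bump a e) x.
  move=> Ls1 Ls2 d0 hG H; exists s1, s2, d; split => // h hh.
  have [r1 r2] := H h hh; rewrite !red_id// r2; exact: eqm_refl.
case/andP: (hx) => x0 xl.
(* At 0 the left slope is read near [l], where the bump is the identity because
   [(1 + e) * a < l]. *)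
have [xz|xz] := eqVneq x 0.
  exists e, 1, (Num.min a (l - (1 + e) * a)); split.
  - by [].
  - exact: (slope1 Lgrp).
  - by rewrite lt_min a0 subr_gt0.
  - move=> h; rewrite lt_min => /andP[q1 q2].
    rewrite xz add0r (red_id l0 (x := 0)) ?lexx// [bump a e 0]bump0// add0r /pw.
    case: ifP => h0.
      rewrite (ger0_norm h0) in q1 q2.
      rewrite red_id//; last by apply/andP; split; lra.
      by rewrite bump1 ?h0 ?ltW//; exact: eqm_refl.
    have {}h0 : h < 0 by rewrite ltNge h0.
    rewrite (ltr0_norm h0) in q1 q2.
    have -> : red h = h + l.
      rewrite -(red_id l0 (x := h + l)); last by apply/andP; split; lra.
      by apply: (eqm_redP l0); exists (-1); rewrite rmorphN1; ring.
    rewrite bump3//; last by lra.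
    by exists 1; ring.
  by left; rewrite xz; exact: (module0 Gmod).
have xp : 0 < x by rewrite lt_def xz.
have [xa|xa|xa] := ltrgtP x a.
- apply: (germ_in e e (Num.min x (a - x))) => //; [by rewrite lt_min xp subr_gt0|by right|].
  move=> h; rewrite lt_min !ltr_norml => /andP[/andP[q1 q2] /andP[q3 q4]].
  split; first by apply/andP; split; lra.
  rewrite pw_same !bump1//; (try by apply/andP; split; lra); ring.
- have [xc|xc|xc] := ltrgtP x ((1 + e) * a).
  + apply: (germ_in e^-1 e^-1 (Num.min (x - a) ((1 + e) * a - x))) => //.
    * by rewrite lt_min !subr_gt0 xa.
    * by right.
    move=> h; rewrite lt_min !ltr_norml => /andP[/andP[q1 q2] /andP[q3 q4]].
    split; first by apply/andP; split; lra.
    rewrite pw_same !bump2//; (try by apply/andP; split; lra); ring.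
  + apply: (germ_in 1 1 (Num.min (x - (1 + e) * a) (l - x))) => //.
    * exact: (slope1 Lgrp).
    * exact: (slope1 Lgrp).
    * by rewrite lt_min !subr_gt0 xc.
    * by right.
    move=> h; rewrite lt_min !ltr_norml => /andP[/andP[q1 q2] /andP[q3 q4]].
    split; first by apply/andP; split; lra.
    rewrite pw_same !bump3 ?mul1r//; lra.
  + apply: (germ_in 1 e^-1 (Num.min (e * a) (l - x))) => //.
    * exact: (slope1 Lgrp).
    * by rewrite lt_min ea0 subr_gt0.
    * by left; rewrite xc.
    move=> h; rewrite lt_min !ltr_norml => /andP[/andP[q1 q2] /andP[q3 q4]].
    split; first by apply/andP; split; lra.
    rewrite /pw; case: ifP => h0; first by rewrite !bump3 ?mul1r//; lra.
    have {}h0 : h < 0 by rewrite ltNge h0.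
    rewrite !bump2//; (try by apply/andP; split; lra); ring.
- apply: (germ_in e^-1 e (Num.min a (e * a))) => //.
  + by rewrite lt_min a0.
  + by left; rewrite xa.
  move=> h; rewrite lt_min !ltr_norml => /andP[/andP[q1 q2] /andP[q3 q4]].
  split; first by apply/andP; split; lra.
  rewrite /pw; case: ifP => h0.
    rewrite !bump2//; (try by apply/andP; split; lra); ring.
  have {}h0 : h < 0 by rewrite ltNge h0.
  rewrite !bump1//; (try by apply/andP; split; lra); ring.
Qed.

End ThompsonElements.

(** * Folner sets of slopes *)

Section Folner.
Variable R : realType.
Implicit Types (x e : R).

Lemma bernoulli e n : 0 <= e -> 1 + n%:R * e <= (1 + e) ^+ n.
Proof.
move=> e0; elim: n => [|n IH]; first by rewrite mul0r addr0 expr0.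
rewrite exprS; apply: le_trans (ler_wpM2l _ IH); last by rewrite addr_ge0.
have := mulr_ge0 (mulr_ge0 (ler0n R n) e0) e0.
by rewrite -natr1 => h; lra.
Qed.

Lemma exponential_beats_polynomial e r : 0 < e ->
  exists n : nat, (n.+1)%:R ^+ r < (1 + e) ^+ n.
Proof.
move=> e0; pose q := r.+1; have q0 : 0 < q%:R :> R by rewrite ltr0n.
have ee : 0 < e ^+ 2 by rewrite exprn_gt0.
(* For n = 2 q K this choice gives n + 1 < 1 + K^2 e^2 <= (1 + K e)^2, and Bernoulli bounds 1 + K e
   by (1 + e)^K; raise to the power q. *)
pose K := (Num.truncn (2 * q%:R / e ^+ 2)).+1.
have K0 : 0 < K%:R :> R by rewrite ltr0n.
have hK : 2 * q%:R < K%:R * e ^+ 2.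
  by rewrite -ltr_pdivrMr//; exact: truncnS_gt.
exists (K * (2 * q))%N.
apply: (@le_lt_trans _ _ ((K * (2 * q)).+1%:R ^+ q)).
  by rewrite ler_weXn2l ?ler1n.
rewrite exprM; apply: (@lt_le_trans _ _ ((1 + K%:R * e) ^+ (2 * q))).
  rewrite exprM ltr_pXn2r ?nnegrE ?ler0n ?sqr_ge0//.
  have h := ltr_pM2l K0 (2 * q%:R) (K%:R * e ^+ 2); rewrite hK in h.
  have ke := mulr_ge0 (ltW K0) (ltW e0).
  rewrite -natr1 !natrM expr2; rewrite expr2 in h; lra.
by rewrite lerXn2r ?nnegrE ?bernoulli ?exprn_ge0 ?addr_ge0 ?mulr_ge0 ?ltW.
Qed.

(** [E M] collects the monomials in [s] with exponents at most [M], without repetition since the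
    slopes may be multiplicatively dependent. Its size is at most (M + 1)^r, so it cannot grow by a
    factor above 1 + e at every step; where it does not, [E M] is a Folner set. *)
Lemma folner_seq (L : set R) (s : seq R) e : mul_subgroup_pos L ->
  (forall g, g \in s -> L g) -> 0 < e ->
  exists E : seq R, [/\ uniq E, (0 < size E)%N, forall x, x \in E -> L x &
    forall g, g \in s -> (1 - e) * (size E)%:R <= (count (fun x => g * x \in E) E)%:R].
Proof.
move=> Lgrp Ls e0; pose r := size s.
pose mon M (f : {ffun 'I_r -> 'I_M.+1}) : R := \prod_(i < r) s`_i ^+ f i.
pose E M := undup [seq mon M f | f <- enum {ffun 'I_r -> 'I_M.+1}].
have memE M f : mon M f \in E M by rewrite mem_undup map_f// mem_enum.
have EP M x : x \in E M -> exists f, x = mon M f.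
  by rewrite mem_undup => /mapP[f _ ->]; exists f.
have sizeE M : (size (E M) <= M.+1 ^ r)%N.
  apply: leq_trans (size_undup _) _; rewrite size_map -cardE card_ffun !card_ord.
  by [].
have size0 M : (0 < size (E M))%N.
  by have := memE M [ffun=> ord0]; case: (E M).
have LE M x : x \in E M -> L x.
  move=> /EP[f ->]; rewrite /mon; elim/big_ind : _ => [||i _].
  - exact: slope1 Lgrp.
  - by move=> a b; exact: slopeM.
  elim: (nat_of_ord (f i)) => [|k IH]; first by rewrite expr0; exact: slope1 Lgrp.
  by rewrite exprS; apply: (slopeM Lgrp) => //; apply: Ls; exact: mem_nth.
have subE M : {subset E M <= E M.+1}.
  move=> x /EP[f ->].
  have -> : mon M f = mon M.+1 [ffun i => widen_ord (leqnSn _) (f i)].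
    by apply: eq_bigr => i _; rewrite ffunE.
  exact: memE.
have mulE M g x : g \in s -> x \in E M -> g * x \in E M.+1.
  move=> gs /EP[f ->]; have ilt : (index g s < r)%N by rewrite index_mem.
  pose i0 := Ordinal ilt.
  have -> : g * mon M f = mon M.+1 [ffun i => inord (f i + (i == i0))].
    rewrite /mon (bigD1 i0)//= [RHS](bigD1 i0)//= mulrA; congr (_ * _).
      rewrite ffunE eqxx addn1 inordK; last by rewrite ltnS ltn_ord.
      by rewrite exprS /i0 /= nth_index.
    apply: eq_bigr => i /negbTE ne; rewrite ffunE ne addn0 inordK//.
    by rewrite ltnW// ltnS ltn_ord.
  exact: memE.
have [M hM] : exists M, (size (E M.+1))%:R <= (1 + e) * (size (E M))%:R.
  apply: contrapT => /forallNP h.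
  have grow M : (1 + e) ^+ M <= (size (E M))%:R.
    elim: M => [|M IH]; first by rewrite expr0 ler1n.
    have /negP := h M; rewrite -ltNge => /ltW; apply: le_trans.
    by rewrite exprS ler_wpM2l// addr_ge0// ltW.
  have [n hn] := exponential_beats_polynomial r e0.
  have := lt_le_trans hn (grow n); rewrite -natrX ltr_nat.
  by rewrite ltnNge sizeE.
exists (E M); split=> [|//||g gs].
- exact: undup_uniq.
- exact: LE.
have g0 : 0 < g by apply: (slope_gt0 Lgrp); exact: Ls.
pose out := [seq x <- E M | g * x \notin E M].
(* Multiplication by [g] injects the escaping elements into [E M.+1] minus [E M]. *)
have hout : (size out + size (E M) <= size (E M.+1))%N.
  have -> : (size out + size (E M))%N = size ([seq g * x | x <- out] ++ E M).
    by rewrite size_cat size_map.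
  apply: uniq_leq_size.
    rewrite cat_uniq undup_uniq andbT map_inj_uniq ?filter_uniq ?undup_uniq//=.
      apply/hasPn => x xE; apply/mapP => -[y]; rewrite mem_filter => /andP[ny _] E'.
      by rewrite -E' xE in ny.
    by move=> x y; apply: mulfI; rewrite gt_eqF.
  move=> x; rewrite mem_cat => /orP[/mapP[y]|/subE//].
  by rewrite mem_filter => /andP[_ yE] ->; exact: mulE.
pose p x := g * x \in E M.
have cnt : (count p (E M) + size out = size (E M))%N.
  by rewrite size_filter -(count_predC p (E M)).
have c1 : (count p (E M))%:R + (size out)%:R = (size (E M))%:R :> R.
  by rewrite -natrD cnt.
have c2 : (size out)%:R + (size (E M))%:R <= (size (E M.+1))%:R :> R.
  by rewrite -natrD ler_nat.
rewrite -/p; lra.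
Qed.

End Folner.

(** * The action of T on T / F *)

Section Density.
Variables (R : realType) (L G : set R) (l : R).
Hypothesis Lgrp : mul_subgroup_pos L.
Hypothesis Lnt : L <> [set 1].
Hypothesis Gmod : submodule_over L G.
Hypothesis Gl : G l.
Hypothesis l0 : 0 < l.

Lemma exists_contraction : exists2 s : R, L s & s < 1.
Proof.
have [e Le e1] : exists2 e, L e & e <> 1.
  apply: contrapT => h; apply: Lnt; apply/seteqP; split => [e Le|_ ->]; last exact: slope1 Lgrp.
  by apply: contrapT => e1; apply: h; exists e.
have e0 := slope_gt0 Lgrp Le.
have [h|h|//] := ltrgtP e 1; first by exists e.
by exists e^-1; [exact: slopeV|rewrite invf_lt1].
Qed.

Lemma small_slope (d : R) : 0 < d -> exists2 s, L s & s < d /\ s < 1.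
Proof.
move=> d0; have [s Ls s1] := exists_contraction.
have s0 := slope_gt0 Lgrp Ls.
have Lp n : L (s ^+ n.+1).
  by elim: n => [|n IH]; [rewrite expr1|rewrite exprS; exact: slopeM].
have [m _ hm] : \forall n \near \oo, s ^+ n < d.
  have /cvgrPdist_lt /(_ d d0) : (GRing.exp s : R^nat) @ \oo --> (0 : R).
    by apply: cvg_expr; rewrite gtr0_norm.
  by apply: filterS => n; rewrite sub0r normrN gtr0_norm// exprn_gt0.
exists (s ^+ m.+1); first exact: Lp.
split; first by apply: hm; exact: leqnSn.
by rewrite exprn_ilt1 ?ltW.
Qed.

(** The multiples of s l lie in [G] and form a grid finer than v - u once the slope s is small. *)
Lemma module_dense (u v : R) : u < v -> exists2 a, G a & u < a < v.
Proof.
move=> uv; have [s Ls [sd _]] := small_slope (divr_gt0 (ltac:(by rewrite subr_gt0) : 0 < v - u) l0).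
have s0 := slope_gt0 Lgrp Ls.
have w0 : 0 < s * l by exact: mulr_gt0.
have wlt : s * l < v - u by rewrite -ltr_pdivlMr.
exists ((Num.floor (u / (s * l)) + 1)%:~R * (s * l)).
  by apply: (module_int Gmod); exact: (moduleZ Gmod).
have := floorD1_gt (u / (s * l)); rewrite ltr_pdivrMr// => -> /=.
have := floor_le (u / (s * l)); rewrite ler_pdivlMr// rmorphD/= mulrDl mul1r; lra.
Qed.

End Density.

Section CosetAction.
Variables (R : realType) (L G : set R) (l : R).
Hypothesis Lgrp : mul_subgroup_pos L.
Hypothesis Lnt : L <> [set 1].
Hypothesis Gmod : submodule_over L G.
Hypothesis Gl : G l.
Hypothesis l0 : 0 < l.
Local Notation red := (red l).
Local Notation eqm := (eqm l).
Local Notation local_T := (local_T L G l).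
Local Notation T := (T_group G L l).
Local Notation F := (F_group G L l).
Local Notation X := (left_cosets T F).
Implicit Types (f g : R -> R) (c d : X).

Let TP f : T f <-> local_T f. Proof. exact: T_groupP. Qed.
Let FP f : F f <-> local_T f /\ f 0 = 0. Proof. exact: F_groupP. Qed.

Lemma local_T_id : local_T id.
Proof.
have -> : id = rot l 0; last by apply: rot_local_T => //; exact: (module0 Gmod).
apply/funext => x; rewrite /rot; case: ifP => // hx.
by rewrite addr0 red_id.
Qed.

Lemma translate_eq g h : local_T g -> local_T h ->
  translate g F = translate h F <-> g 0 = h 0.
Proof.
move=> hg hh; split=> [E|E].
  have [f /FP[_ f0] <-] : translate h F g.
    by rewrite -E; exists id => //; apply/FP; split => //; exact: local_T_id.
  by rewrite /= f0.
have half g1 g2 : local_T g1 -> local_T g2 -> g1 0 = g2 0 ->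
    translate g1 F `<=` translate g2 F.
  move=> h1 h2 E12 _ [f /FP[hf f0] <-].
  have [k hk [K1 K2]] := local_T_inv Lgrp Gmod Gl l0 h2.
  exists (k \o (g1 \o f)); last by apply/funext => x; rewrite /= K2.
  apply/FP; split; last by rewrite /= f0 E12 K1.
  by do 2 apply: local_T_comp => //.
by apply/seteqP; split; exact: half.
Qed.

Lemma coset_rep c : exists g, local_T g /\ translate g F = val c.
Proof. by have /set_mem [g /TP hg E] := valP c; exists g. Qed.

Definition rep c : R -> R := projT1 (cid (coset_rep c)).

Lemma rep_local_T c : local_T (rep c).
Proof. by rewrite /rep; case: cid => g []. Qed.

Lemma rep_val c : translate (rep c) F = val c.
Proof. by rewrite /rep; case: cid => g []. Qed.

Lemma coset_subproof g : local_T g -> translate g F \in X.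
Proof. by move=> /TP Tg; apply/mem_set; exists g. Qed.

Definition coset g (hg : local_T g) : X := exist _ (translate g F) (coset_subproof hg).

(* T / F is identified with the orbit of 0. *)
Definition pt c : R := rep c 0.

Lemma pt_coset g (hg : local_T g) : pt (coset hg) = g 0.
Proof.
apply/translate_eq => //; first exact: rep_local_T.
exact: rep_val.
Qed.

Lemma pt_inj c d : pt c = pt d -> c = d.
Proof.
move=> E; apply/val_inj; rewrite -!rep_val.
by apply/translate_eq => //; exact: rep_local_T.
Qed.

Lemma pt_range c : 0 <= pt c < l.
Proof. by apply: (local_T_range (rep_local_T c)); rewrite lexx. Qed.

Definition act g (hg : local_T g) c : X :=
  coset (local_T_comp Lgrp Gmod Gl l0 hg (rep_local_T c)).

Lemma pt_act g (hg : local_T g) c : pt (act hg c) = g (pt c).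
Proof. by rewrite pt_coset. Qed.

Lemma val_act g (hg : local_T g) c : val (act hg c) = translate g (val c).
Proof.
rewrite -(rep_val c) -[val (act hg c)]/(translate (g \o rep c) F) /translate.
apply/seteqP; split => [_ [f Ff <-]|_ [_ [f Ff <-] <-]].
  by exists (rep c \o f) => //; exists f.
by exists f.
Qed.

(** The image of T in the permutations of T / F, described on the orbit of 0 so that group laws
    reduce to computations with points. *)
Definition coset_group : set (aut X) :=
  [set a | exists2 g, local_T g & forall c, pt (a c) = g (pt c)].

Lemma exists_aut g : local_T g -> exists2 a : aut X, coset_group a &
  forall c, pt (a c) = g (pt c).
Proof.
move=> hg; have [k hk [K1 K2]] := local_T_inv Lgrp Gmod Gl l0 hg.
have C1 : cancel (act hg) (act hk) by move=> c; apply: pt_inj; rewrite !pt_act K1.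
have C2 : cancel (act hk) (act hg) by move=> c; apply: pt_inj; rewrite !pt_act K2.
have H c : pt (act hg c) = g (pt c) by exact: pt_act.
by exists (Aut C1 C2) => //; exists g.
Qed.

Lemma coset_group_subgroup : subgroup coset_group.
Proof.
split.
- by exists id => //; exact: local_T_id.
- move=> a b [g hg ag] [h hh bh]; exists (g \o h); first exact: local_T_comp.
  by move=> c; rewrite /= ag bh.
move=> a [g hg ag]; have [k hk [K1 K2]] := local_T_inv Lgrp Gmod Gl l0 hg.
exists k => // c; apply: (can_inj K1); rewrite K2 -ag.
by rewrite /= bwdK.
Qed.

(** Since [g] permutes T / F, the defining relation determines [U] at every coset. This is the form
    of the generators required by [cstar_generated_lam]. *)
Lemma quasi_regular_lam (U : l2 R X -> l2 R X) :
  (exists2 g, T g & is_quasi_regular (R := R) (G := T) (K := F) g U) <->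
  (exists2 a : aut X, coset_group a & U = @lam R X a).
Proof.
split=> [[g /TP hg hU]|[a [g hg ag] ->]].
  have [a Ga ag] := exists_aut hg; exists a => //.
  apply/funext => xi; apply: l2_ext => d; rewrite lamE; apply: hU.
  rewrite -(val_act hg); congr val; apply: pt_inj.
  by rewrite pt_act -ag bwdK.
exists g; first exact/TP.
move=> xi c d; rewrite -(val_act hg) => /val_inj E.
rewrite lamE; congr (xi _); apply: (can_inj (@fwdK _ a)); rewrite bwdK.
by apply: pt_inj; rewrite E pt_act ag.
Qed.

Definition base : X := coset local_T_id.

Lemma pt_base : pt base = 0. Proof. exact: pt_coset. Qed.

Definition nbd (n : nat) : set X :=
  [set c | pt c < n.+1%:R^-1 \/ l - n.+1%:R^-1 < pt c].

Lemma inv_le m n : (m <= n)%N -> n.+1%:R^-1 <= m.+1%:R^-1 :> R.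
Proof. by move=> mn; rewrite lef_pV2 ?posrE ?ltr0n// ler_nat. Qed.

Lemma inv_gt0 n : 0 < n.+1%:R^-1 :> R. Proof. by rewrite invr_gt0 ltr0n. Qed.

Lemma inv_small (e : R) : 0 < e -> exists n : nat, n.+1%:R^-1 < e.
Proof.
move=> e0; exists (Num.truncn e^-1).
by rewrite invf_plt ?posrE// ?truncnS_gt// ltr0n.
Qed.

Lemma nbd_small n c : nbd n c -> exists2 h, `|h| < n.+1%:R^-1 & eqm (pt c) h.
Proof.
have /andP[c0 cl] := pt_range c; rewrite /nbd /=; set v := n.+1%:R^-1 => -[h|h].
  by exists (pt c); [rewrite ger0_norm|exact: eqm_refl].
exists (pt c - l); first by rewrite ltr0_norm; lra.
by exists 1; ring.
Qed.

Lemma nbd_nested m n : (m <= n)%N -> nbd n `<=` nbd m.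
Proof.
move=> /inv_le mn c; rewrite /nbd /=; move: mn.
set u := n.+1%:R^-1; set v := m.+1%:R^-1 => mn [h|h]; [left|right]; lra.
Qed.

Lemma nbd_separates (a : aut X) : coset_group a -> a base <> base ->
  exists n, forall c, nbd n c -> ~ nbd n (a c).
Proof.
move=> [g hg ag] ne.
have gne : g 0 <> 0.
  by move=> E; apply: ne; apply: pt_inj; rewrite ag pt_base.
have z1 : 0 <= (0 : R) < l by rewrite lexx.
have /andP[g0 gl] := local_T_range hg z1.
have gp : 0 < g 0 by rewrite lt_def g0 andbT; apply/eqP.
have [_ _ _ /(_ 0)[s1 [s2 [d [Ls1 Ls2 d0 hd _]]]]] := hg.
have s10 := slope_gt0 Lgrp Ls1; have s20 := slope_gt0 Lgrp Ls2.
have s0 : 0 < s1 + s2 by exact: addr_gt0.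
(* Values within [m] of [g 0] stay at distance at least [m] from 0 on the circle, so an arc of
   radius below [m] misses them. *)
pose m := Num.min (g 0 / 2) ((l - g 0) / 2).
have m0 : 0 < m by rewrite lt_min !divr_gt0// subr_gt0.
have mg : m <= g 0 / 2 by rewrite ge_min lexx.
have ml : m <= (l - g 0) / 2 by rewrite ge_min lexx orbT.
clearbody m; have e0 : 0 < Num.min d (Num.min m (m / (s1 + s2))) by rewrite !lt_min d0 m0 divr_gt0.
have [n] := inv_small e0; rewrite !lt_min => /and3P[n1 n2 n3].
exists n => c /nbd_small[h hn hc].
have hm : `|pw s1 s2 h| < m.
  apply: le_lt_trans (pw_norm _ s10 s20) _; rewrite mulrC -ltr_pdivlMr//.
  exact: lt_trans hn n3.
have := hd h (lt_trans hn n1); rewrite add0r (red_id l0 z1) => E.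
have -> : nbd n (a c) <-> (g (pt c) < n.+1%:R^-1 \/ l - n.+1%:R^-1 < g (pt c)).
  by rewrite /nbd /= ag.
rewrite (local_T_eqm l0 g (pt_range c) hc).
move: hm; rewrite ltr_norml => /andP[p1 p2].
have -> : g (red h) = g 0 + pw s1 s2 h.
  apply: (eqm_eq l0) E; first exact: (local_T_red_range l0 hg).
  by apply/andP; split; lra.
by move: n2; clear -gl p1 p2 mg ml; set v := n.+1%:R^-1 => n2 [q|q]; lra.
Qed.

Lemma nbd_compresses m n : exists2 h : aut X, coset_group h &
  forall c, ~ nbd m c -> nbd n (h c).
Proof.
have dm := inv_gt0 m; have dn := inv_gt0 n.
set u := m.+1%:R^-1 in dm *; set v := n.+1%:R^-1 in dn *.
(* A bump of slope e on [0, a] is used. From e l < v its image falls into the target arc, and e l <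
   u gives l - u < l / (1 + e), leaving room for [a] with l - u < a and (1 + e) a < l. *)
have r0 : 0 < Num.min u v / l by rewrite divr_gt0// lt_min dm.
have [e Le []] := small_slope Lgrp Lnt r0.
rewrite ltr_pdivlMr// lt_min => /andP[e1 e2] _; have e0 := slope_gt0 Lgrp Le.
have lt1 : Num.max 0 (l - u) < l / (1 + e).
  have ep : 0 < 1 + e by rewrite addr_gt0.
  rewrite gt_max divr_gt0//= ltr_pdivlMr//.
  by have := mulr_gt0 e0 dm; lra.
have [a Ga /andP[]] := module_dense Lgrp Lnt Gmod Gl l0 lt1.
rewrite gt_max => /andP[a0 a1]; rewrite ltr_pdivlMr ?addr_gt0// => a2.
have al : (1 + e) * a < l by lra.
have [h Gh hh] := exists_aut (bump_local_T Lgrp Gmod Gl l0 Le Ga a0 al).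
exists h => // c nc; left; rewrite hh.
have /andP[c0 cl] := pt_range c.
have c1 : pt c <= l - u by rewrite leNgt; apply/negP => q; apply: nc; right.
rewrite bump1//; last by rewrite c0/=; lra.
have := ler_wpM2l (ltW e0) (ltW cl); rewrite -/v; lra.
Qed.

(** A bump conjugated by the rotation by [a] is supported in [a, (2 + e) a]. Since e < 1 and a < l /
    4, this misses the arc of radius [a] around 0, while 2a is sent to a + e a. *)
Lemma nbd_local : exists (u : aut X) c n,
  [/\ coset_group u, u c <> c & forall d, nbd n d -> u d = d].
Proof.
have [e Le e1] := exists_contraction Lgrp Lnt; have e0 := slope_gt0 Lgrp Le.
have l4 : 0 < l / 4 by rewrite divr_gt0.
have [a Ga /andP[a0 a4]] := module_dense Lgrp Lnt Gmod Gl l0 l4.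
have ea : e * a < a by rewrite gtr_pMl.
have ea0 : 0 < e * a by exact: mulr_gt0.
have al : (1 + e) * a < l by lra.
have hb := bump_local_T Lgrp Gmod Gl l0 Le Ga a0 al.
have hr := rot_local_T Lgrp Gmod Gl l0 Ga.
have hr' := rot_local_T Lgrp Gmod Gl l0 (moduleN Gmod Ga).
have [u Gu uE] := exists_aut
  (local_T_comp Lgrp Gmod Gl l0 hr (local_T_comp Lgrp Gmod Gl l0 hb hr')).
have Gaa : G (a + a) by exact: (moduleD Gmod).
have [n] := inv_small (a0); move=> hn.
exists u, (coset (rot_local_T Lgrp Gmod Gl l0 Gaa)), n; split => //.
  move=> /(congr1 pt); rewrite uE pt_coset /=.
  have z1 : 0 <= (0 : R) < l by rewrite lexx.
  rewrite (rotE _ z1) add0r (red_id l0 (x := a + a)); last by apply/andP; split; lra.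
  rewrite (rotE _ (x := a + a)); last by apply/andP; split; lra.
  rewrite addrK red_id//; last by apply/andP; split; lra.
  rewrite bump1 ?lexx ?ltW// rotE; last by apply/andP; split; lra.
  rewrite red_id//; last by apply/andP; split; lra.
  lra.
move=> d hd; apply: pt_inj; rewrite uE /=.
have /andP[d0 dl] := pt_range d.
suff fix_bump : bump a e (rot l (- a) (pt d)) = rot l (- a) (pt d).
  by rewrite fix_bump -{1}[a]opprK rotK.
apply: bump3 => //; rewrite rotE ?pt_range//.
move: hn hd; rewrite /nbd /=; set v := n.+1%:R^-1 => hn [q|q].
  have -> : red (pt d - a) = pt d - a + l; last by lra.
  rewrite -(red_id l0 (x := pt d - a + l)); last by apply/andP; split; lra.
  by apply: (eqm_redP l0); exists (-1); rewrite rmorphN1; ring.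
by rewrite red_id//; [lra|apply/andP; split; lra].
Qed.

Lemma min_seq (I : eqType) (s : seq I) (D : I -> R) : (forall i, i \in s -> 0 < D i) ->
  exists2 d, 0 < d & forall i, i \in s -> d <= D i.
Proof.
elim: s => [|i s IH] h; first by exists 1.
have [j js|d d0 hd] := IH; first by apply: h; rewrite inE js orbT.
exists (Num.min (D i) d); first by rewrite lt_min d0 h ?mem_head.
move=> j; rewrite inE => /orP[/eqP ->|/hd]; first by rewrite ge_min lexx.
by move=> q; rewrite ge_min q orbT.
Qed.

(** With t_k h = E_k (p + h) near 0, an element of right slope x at 0 satisfies a t_k = t_j near 0
    exactly when x E_k = E_j. The problem thus reduces to a Folner set for multiplication by the
    right slopes of [s]. *)
Lemma nbd_germs (s : seq (aut X)) (e : R) N :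
  (forall a, a \in s -> coset_group a /\ a base = base) -> 0 < e ->
  exists m (t : 'I_m -> aut X), [/\ (0 < m)%N,
    forall k, coset_group (t k) /\ nbd N (t k base), injective (fun k => t k base),
    forall a k j, a \in s -> a (t k base) = t j base ->
      exists n, forall c, nbd n c -> a (t k c) = t j c &
    forall a, a \in s ->
      (1 - e) * m%:R <= #|[pred k | [exists j, a (t k base) == t j base]]|%:R :> R].
Proof.
move=> hs e0.
have z1 : 0 <= (0 : R) < l by rewrite lexx.
have /choice[sd hsd] : forall a : aut X, exists sd : R * R, a \in s ->
    [/\ L sd.1, 0 < sd.2 & forall c, pt c < sd.2 -> pt (a c) = sd.1 * pt c].
  move=> a; have [as_|] := boolP (a \in s); last by exists (0, 0).
  have [[g hg ag] ab] := hs a as_.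
  have g0 : g 0 = 0 by rewrite -{1}pt_base -ag ab pt_base.
  have [_ _ _ /(_ 0)[s1 [s2 [d hd]]]] := hg.
  have [d' [d'0 _ hd']] := right_formula Lgrp l0 hg hd z1.
  exists (s1, d') => _; split => //=; first by case: hd.
  move=> c cd; rewrite ag; have := hd' (pt c); rewrite add0r g0 add0r; apply.
  by case/andP: (pt_range c) => -> _.
pose sl a := (sd a).1.
have [E [uE E0 LE hE]] : exists E : seq R, [/\ uniq E, (0 < size E)%N,
    forall x, x \in E -> L x & forall g : R, g \in [seq sl a | a <- s] ->
    (1 - e) * (size E)%:R <= (count (fun x => g * x \in E) E)%:R].
  by apply: (folner_seq Lgrp) => // _ /mapP[a as_ ->]; case: (hsd a as_).
have [D D0 hD] : exists2 D, 0 < D & forall a, a \in s -> D <= (sd a).2.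
  by apply: min_seq => a as_; case: (hsd a as_).
(* A common upper bound for the slopes in [E]: with a' < l / (1 + C), all the bumps of base a' fit
   into [0, l). *)
pose C := 1 + \sum_(x <- E) x.
have sum0 : 0 <= \sum_(x <- E) x.
  by rewrite big_seq; apply: sumr_ge0 => x xE; exact/ltW/(slope_gt0 Lgrp)/LE.
have C0 : 0 < C by rewrite ltr_wpDr.
have EC x : x \in E -> x <= C.
  move=> xE; rewrite /C (perm_big _ (perm_to_rem xE)) big_cons/=.
  suff : 0 <= \sum_(y <- rem x E) y by lra.
  rewrite big_seq; apply: sumr_ge0 => y /mem_rem yE.
  exact/ltW/(slope_gt0 Lgrp)/LE.
have C1 : 0 < 1 + C by rewrite addr_gt0.
have lC : 0 < l / (1 + C) by rewrite divr_gt0.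
have [a' Ga' /andP[a0 al]] := module_dense Lgrp Lnt Gmod Gl l0 lC.
rewrite ltr_pdivlMr// in al.
(* The three bounds on [p] keep p + h in the first piece of each bump when |h| < p, keep E_k (p + h)
   where every element of [s] is linear, and put the points E_k p into [nbd N]. *)
have r0 : 0 < Num.min (a' / 2) (Num.min (D / (2 * C)) (N.+1%:R^-1 / C)).
  by rewrite !lt_min !divr_gt0 ?mulr_gt0 ?inv_gt0.
have [p Gp /andP[p0]] := module_dense Lgrp Lnt Gmod Gl l0 r0.
rewrite !lt_min => /and3P[p1 p2 p3].
rewrite ltr_pdivlMr ?mulr_gt0// in p2; rewrite ltr_pdivlMr// in p3.
have Ea x : x \in E -> (1 + x) * a' < l.
  by move=> /EC xC; have := ler_wpM2r (ltW a0) xC; lra.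
have Ep x : x \in E -> x * p <= p * C.
  by move=> /EC xC; rewrite mulrC ler_wpM2l// ltW.
have ap2 : p < l.
  by have := mulr_gt0 C0 a0; lra.
pose m := size E.
have inE' (k : 'I_m) : E`_k \in E by exact: mem_nth.
(* Rotating by [p] before the bump puts the whole arc |h| < p to the right of 0, where only right
   slopes matter. *)
have /choice[t ht] : forall k : 'I_m, exists a : aut X, coset_group a /\
    forall c h, eqm (pt c) h -> `|h| < p -> pt (a c) = E`_k * (p + h).
  move=> k; have hb := bump_local_T Lgrp Gmod Gl l0 (LE _ (inE' k)) Ga' a0 (Ea _ (inE' k)).
  have hr := rot_local_T Lgrp Gmod Gl l0 Gp.
  have [a Ga aE] := exists_aut (local_T_comp Lgrp Gmod Gl l0 hb hr).
  exists a; split => // c h hc; rewrite ltr_norml => /andP[h1 h2]; rewrite aE /=.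
  have xp := mulr_gt0 (slope_gt0 Lgrp (LE _ (inE' k))) a0.
  have al2 := Ea _ (inE' k).
  rewrite rotE ?pt_range//.
  have -> : red (pt c + p) = p + h.
    rewrite -(red_id l0 (x := p + h)); last by apply/andP; split; lra.
    by apply: (eqm_redP l0); rewrite [p + h]addrC; exact: eqmDr.
  rewrite bump1//; last by apply/andP; split; lra.
  exact: (slope_gt0 Lgrp (LE _ (inE' k))).
have tb k : pt (t k base) = E`_k * p.
  have [_ h] := ht k; rewrite (h base 0) ?addr0 ?normr0//.
  by rewrite pt_base; exact: eqm_refl.
have tN k : pt (t k base) < N.+1%:R^-1.
  by rewrite tb; apply: le_lt_trans (Ep _ (inE' k)) p3.
have at_ a k : a \in s -> pt (a (t k base)) = sl a * (E`_k * p).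
  move=> as_; have [_ _ h] := hsd a as_; rewrite h ?tb//.
  have := hD a as_; have := Ep _ (inE' k).
  by have := mulr_gt0 p0 C0; lra.
have atE a k j : a \in s -> (a (t k base) = t j base) <-> sl a * E`_k = E`_j.
  move=> as_; split=> [/(congr1 pt)|E'].
    by rewrite at_// tb mulrA; apply: mulIf; rewrite gt_eqF.
  by apply: pt_inj; rewrite at_// tb mulrA E'.
exists m, t; split => //.
- by move=> k; split; [case: (ht k)|left; exact: tN].
- move=> k j /(congr1 pt); rewrite !tb => /(mulIf _) E'.
  have /eqP : E`_k = E`_j by apply: E'; rewrite gt_eqF.
  by rewrite nth_uniq// => /eqP /val_inj.
- move=> a k j as_ /(atE _ _ _ as_) E'; have [n hn] := inv_small p0.
  exists n => c /nbd_small[h hh hc]; have hp := lt_trans hh hn.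
  have [_ hk] := ht k; have [_ hj] := ht j.
  apply: pt_inj; rewrite (hj c h hc hp) -E' -mulrA -(hk c h hc hp).
  have [_ _ ha] := hsd a as_; apply: ha; rewrite (hk c h hc hp).
  have Ek0 := slope_gt0 Lgrp (LE _ (inE' k)).
  have h2 : E`_k * (p + h) <= E`_k * (p + p).
    by rewrite ler_pM2l// lerD2l; move: hp; rewrite ltr_norml => /andP[_ /ltW].
  by have := hD a as_; have := Ep _ (inE' k); lra.
move=> a as_; apply: le_trans (hE (sl a) (map_f _ as_)) _.
have -> : count (fun x => sl a * x \in E) E = #|[pred k : 'I_m | sl a * E`_k \in E]|.
  rewrite -sum1_count (big_nth 0) big_mkord -sum1_card.
  by apply: eq_bigl.
rewrite ler_nat; apply: subset_leq_card; apply/fintype.subsetP => k; rewrite !inE => hk.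
have ilt : (index (sl a * E`_k)%R E < m)%N by rewrite index_mem.
apply/existsP; exists (Ordinal ilt); apply/eqP/(atE _ _ _ as_).
by rewrite /= nth_index.
Qed.

Lemma coset_compressing_action : compressing_action R coset_group base nbd.
Proof.
split.
- exact: coset_group_subgroup.
- move=> c; have [a Ga ha] := exists_aut (rep_local_T c); exists a => //.
  by apply: pt_inj; rewrite ha pt_base.
- have [s Ls s1] := exists_contraction Lgrp Lnt; have s0 := slope_gt0 Lgrp Ls.
  have Lp n : L (s ^+ n.+1).
    by elim: n => [|n IH]; [rewrite expr1|rewrite exprS; exact: slopeM].
  have /choice[z hz] : forall n, exists a : aut X, coset_group a /\ pt (a base) = s ^+ n.+1 * l.
    move=> n; have Gn : G (s ^+ n.+1 * l) by exact: (moduleZ Gmod).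
    have [a Ga ha] := exists_aut (rot_local_T Lgrp Gmod Gl l0 Gn).
    exists a; split => //; rewrite ha pt_base rotE ?lexx// add0r red_id//.
    by rewrite mulr_ge0 ?exprn_ge0 ?ltW//= gtr_pMl// exprn_ilt1 ?ltW.
  exists z; split; first by move=> i; case: (hz i).
  move=> i j /eqP ij /(congr1 pt); case: (hz i) => _ ->; case: (hz j) => _ ->.
  move=> /mulIf; rewrite gt_eqF// => /(_ isT) E.
  have := @ieexprIn R s s0 ltac:(by rewrite lt_eqF) _ _ E.
  by case.
- exact: nbd_nested.
- by move=> n; left; rewrite pt_base inv_gt0.
- exact: nbd_separates.
- exact: nbd_compresses.
- exact: nbd_local.
exact: nbd_germs.
Qed.

End CosetAction.

Theorem theorem1p6 (R : realType) (Lambda Gamma : set R) (l : R)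
    (Lambda_group : mul_subgroup_pos Lambda)
    (Lambda_nontrivial : Lambda <> [set 1])
    (Gamma_module : submodule_over Lambda Gamma)
    (Lambda_Gamma : [set a * x | a in Lambda & x in Gamma] = Gamma)
    (Gamma_l : Gamma l) (l_ge1 : 1 <= l) :
  let A := quasi_regular_cstar R (T_group Gamma Lambda l)
                                 (F_group Gamma Lambda l) in
  simple_cstar A /\ purely_infinite A.
Proof.
have l0 : 0 < l by apply: lt_le_trans l_ge1.
have act := coset_compressing_action Lambda_group Lambda_nontrivial Gamma_module Gamma_l l0.
have -> : quasi_regular_cstar R (T_group Gamma Lambda l) (F_group Gamma Lambda l) =
    @closed_span R _ (coset_group Lambda_group Gamma_module Gamma_l l0).
  apply: cstar_generated_lam; first exact: (ca_group act).
  exact: quasi_regular_lam.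
split; first exact: closed_span_simple act.
exact: closed_span_purely_infinite act.
Qed.
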